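(* For each of the following types there exists a group divisible design with block size $5$ (a $5$-$\mathrm{GDD}$) of that type: $1^{48} 9^1$, $1^{60} 9^1$, $1^{60} 13^1$, $1^{68} 9^1$, $1^{72} 17^1$, $1^{80} 9^1$, $1^{80} 13^1$, $1^{80} 25^1$, $1^{84} 21^1$, $1^{88} 9^1$, $1^{92} 17^1$, $1^{96} 25^1$, $1^{100} 9^1$, $1^{100} 13^1$, $1^{100} 25^1$, $1^{104} 21^1$, $1^{108} 9^1$, $1^{108} 29^1$, $1^{112} 17^1$, $1^{124} 21^1$, $1^{128} 9^1$, $1^{128} 29^1$, $1^{132} 17^1$, $1^{132} 37^1$, $1^{136} 25^1$, $1^{144} 21^1$, $1^{144} 41^1$, $1^{148} 29^1$, $1^{152} 17^1$, $1^{152} 37^1$, $1^{156} 25^1$, $1^{156} 45^1$, $1^{160} 33^1$, $1^{164} 21^1$, $1^{164} 41^1$, $1^{168} 29^1$, $1^{168} 49^1$, $1^{172} 17^1$, $1^{176} 25^1$, $1^{176} 45^1$, $1^{184} 21^1$, $1^{184} 41^1$, $1^{188} 29^1$, $1^{192} 17^1$, $1^{192} 37^1$, $1^{192} 57^1$, $1^{196} 25^1$, $1^{196} 45^1$, $2^{32} 14^1$, $2^{40} 6^1$, $2^{48} 18^1$, $2^{52} 14^1$, $2^{56} 10^1$, $2^{60} 6^1$, $3^{20} 11^1$, $3^{28} 7^1$, $3^{32} 11^1$, $3^{36} 15^1$, $5^{24} 25^1$, $5^{28} 25^1$, $5^{32} 25^1$, $5^{32} 45^1$, $5^{36} 45^1$,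 $5^{40} 45^1$, $5^{44} 25^1$, $5^{44} 45^1$, $6^{16} 10^1$, $8^8 12^1$, $8^{10} 16^1$, $8^{10} 20^1$, $8^{14} 28^1$, $8^{15} 4^1$, $8^{15} 16^1$, $8^{15} 24^1$, $8^{15} 36^1$, $8^{16} 20^1$, $8^{17} 16^1$, $8^{18} 32^1$, $8^{20} 44^1$, $8^{21} 20^1$, $8^{21} 40^1$, $8^{22} 16^1$, $8^{22} 36^1$, $8^{23} 32^1$, $8^{24} 28^1$, $8^{25} 4^1$, $8^{25} 24^1$, $8^{26} 20^1$, $8^{27} 16^1$, $8^{28} 12^1$, $9^8 1^1$, $9^{12} 13^1$, $9^{16} 5^1$, $9^{16} 25^1$, $9^{20} 17^1$, $9^{20} 29^1$, $9^{20} 37^1$, $9^{20} 49^1$, $9^{28} 1^1$, $10^{10} 18^1$, $10^{20} 38^1$, $11^{20} 19^1$, $12^5 8^1$, $12^{10} 8^1$, $12^{10} 16^1$, $12^{10} 28^1$, $12^{11} 20^1$, $12^{12} 4^1$, $12^{12} 24^1$, $12^{13} 8^1$, $12^{13} 28^1$, $12^{14} 32^1$, $12^{15} 8^1$, $12^{15} 16^1$, $12^{15} 28^1$, $12^{15} 36^1$, $12^{15} 48^1$, $12^{16} 20^1$, $12^{16} 40^1$, $12^{17} 4^1$, $12^{17} 24^1$, $12^{17} 44^1$, $12^{18} 8^1$, $12^{18} 28^1$, $12^{18} 48^1$, $12^{19} 32^1$, $12^{19} 52^1$, $12^{20} 8^1$, $12^{21} 20^1$, $12^{21} 40^1$, $12^{21}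 60^1$, $12^{22} 4^1$, $12^{22} 24^1$, $12^{22} 44^1$, $12^{22} 64^1$, $12^{23} 28^1$, $12^{23} 48^1$, $12^{23} 68^1$, $12^{24} 32^1$, $12^{24} 52^1$, $12^{27} 4^1$, $13^8 17^1$, $13^{12} 1^1$, $13^{12} 21^1$, $13^{12} 41^1$, $13^{16} 5^1$, $13^{16} 25^1$, $13^{20} 1^1$, $14^8 6^1$, $16^6 20^1$, $16^7 12^1$, $16^8 4^1$, $16^9 36^1$, $16^{10} 8^1$, $16^{10} 20^1$, $16^{10} 28^1$, $16^{10} 36^1$, $16^{10} 40^1$, $16^{11} 20^1$, $16^{11} 40^1$, $16^{12} 12^1$, $16^{12} 52^1$, $16^{13} 4^1$, $16^{13} 24^1$, $16^{13} 44^1$, $16^{14} 36^1$, $16^{15} 8^1$, $16^{15} 28^1$, $16^{16} 20^1$, $16^{16} 40^1$, $16^{17} 12^1$, $17^8 13^1$, $17^8 33^1$, $17^{12} 9^1$, $17^{12} 29^1$, $17^{12} 49^1$, $17^{16} 5^1$, $20^8 40^1$, $20^9 40^1$, $20^{10} 36^1$, $20^{10} 40^1$, $20^{11} 40^1$, $21^8 9^1$, $21^8 29^1$, $21^{12} 17^1$, $23^8 7^1$, $24^6 20^1$, $24^7 8^1$, $24^7 28^1$, $24^8 16^1$, $24^8 36^1$, $24^9 4^1$, $24^9 44^1$, $24^{10} 4^1$, $24^{10} 12^1$, $24^{10} 32^1$, $24^{11} 20^1$, $25^8 5^1$, $25^8 45^1$, $28^6 20^1$, $28^6 40^1$, $28^7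 16^1$, $28^7 36^1$, $28^8 12^1$, $28^8 32^1$, $28^8 52^1$, $28^9 8^1$, $28^9 48^1$, $28^{10} 4^1$, $28^{10} 24^1$, $29^8 1^1$, $29^8 21^1$, $32^6 20^1$, $32^6 40^1$, $32^7 4^1$, $32^7 24^1$, $32^7 44^1$, $32^8 8^1$, $32^8 28^1$, $32^9 12^1$, $36^6 20^1$, $36^6 40^1$, $36^7 12^1$, $36^7 32^1$, $36^8 24^1$, $40^6 20^1$, $44^6 20^1$, $44^6 40^1$, $44^7 8^1$, $48^6 20^1$, $1^{16} 9^5$, $1^{46} 5^3$ and $4^5 8^5$.
   Context: A group divisible design with block size $5$ (a $5$-GDD) of type $g_1^{u_1} g_2^{u_2} \dots g_r^{u_r}$ is an ordered triple $(V,\mathcal{G},\mathcal{B})$ such that: (i) $V$ is a base set of cardinality $u_1 g_1 + u_2 g_2 + \dots + u_r g_r$; (ii) $\mathcal{G}$ is a partition of $V$ into $u_i$ subsets of cardinality $g_i$, $i = 1, 2, \dots, r$, called groups; (iii) $\mathcal{B}$ is a non-empty collection of $5$-element subsets of $V$, called blocks; and (iv) each pair of elements from distinct groups occurs in precisely one block, but no pair of (distinct) elements from the same group occurs in any block. The exponential notation for types is formal: $g^u m^1$ means $u$ groups of size $g$ and one group of size $m$ (and similarly $1^{16} 9^5$ means $16$ groups of size $1$ and $5$ groups of size $9$, etc.). *)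

(* Defs.v *)
From mathcomp Require Import all_boot.

Set Implicit Arguments.
Unset Strict Implicit.
Unset Printing Implicit Defensive.

(* The formal type g_1^{u_1} ... g_r^{u_r} is [:: (g_1, u_1); ...; (g_r, u_r)]. *)
Definition gdd_type := seq (nat * nat).

Definition group_sizes (t : gdd_type) : seq nat :=
  flatten [seq nseq gu.2 gu.1 | gu <- t].

(* Taking the blocks to be a set rather than a multiset loses nothing when
   k >= 2: by the last two fields a repeated block would cover a pair twice. *)
Record is_gdd (k : nat) (t : gdd_type) (V : finType)
    (G B : {set {set V}}) : Prop := IsGDD {
  gdd_card : #|V| = \sum_(gu <- t) gu.2 * gu.1;
  gdd_partition : partition G [set: V];
  gdd_groups : perm_eq [seq #|A : {set V}| | A <- enum G] (group_sizes t);
  gdd_nonempty : B != set0;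
  gdd_block_size : forall b : {set V}, b \in B -> #|b| = k;
  gdd_distinct_groups : forall (A A' : {set V}) (x y : V),
    A \in G -> A' \in G -> A != A' -> x \in A -> y \in A' ->
    exists! b : {set V}, [/\ b \in B, x \in b & y \in b];
  gdd_same_group : forall (A b : {set V}) (x y : V),
    A \in G -> b \in B -> x \in A -> y \in A -> x != y ->
    ~ (x \in b /\ y \in b)
}.

Definition gdd_exists (k : nat) (t : gdd_type) : Prop :=
  exists (V : finType) (G B : {set {set V}}), is_gdd k t G B.

Definition listed_types : seq gdd_type :=
  [:: [:: (1, 48); (9, 1)]; [:: (1, 60); (9, 1)]; [:: (1, 60); (13, 1)];
     [:: (1, 68); (9, 1)]; [:: (1, 72); (17, 1)]; [:: (1, 80); (9, 1)];
     [:: (1, 80); (13, 1)]; [:: (1, 80); (25, 1)]; [:: (1, 84); (21, 1)];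
     [:: (1, 88); (9, 1)]; [:: (1, 92); (17, 1)]; [:: (1, 96); (25, 1)];
     [:: (1, 100); (9, 1)]; [:: (1, 100); (13, 1)]; [:: (1, 100); (25, 1)];
     [:: (1, 104); (21, 1)]; [:: (1, 108); (9, 1)]; [:: (1, 108); (29, 1)];
     [:: (1, 112); (17, 1)]; [:: (1, 124); (21, 1)]; [:: (1, 128); (9, 1)];
     [:: (1, 128); (29, 1)]; [:: (1, 132); (17, 1)]; [:: (1, 132); (37, 1)];
     [:: (1, 136); (25, 1)]; [:: (1, 144); (21, 1)]; [:: (1, 144); (41, 1)];
     [:: (1, 148); (29, 1)]; [:: (1, 152); (17, 1)]; [:: (1, 152); (37, 1)];
     [:: (1, 156); (25, 1)]; [:: (1, 156); (45, 1)]; [:: (1, 160); (33, 1)];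
     [:: (1, 164); (21, 1)]; [:: (1, 164); (41, 1)]; [:: (1, 168); (29, 1)];
     [:: (1, 168); (49, 1)]; [:: (1, 172); (17, 1)]; [:: (1, 176); (25, 1)];
     [:: (1, 176); (45, 1)]; [:: (1, 184); (21, 1)]; [:: (1, 184); (41, 1)];
     [:: (1, 188); (29, 1)]; [:: (1, 192); (17, 1)]; [:: (1, 192); (37, 1)];
     [:: (1, 192); (57, 1)]; [:: (1, 196); (25, 1)]; [:: (1, 196); (45, 1)];

     [:: (2, 32); (14, 1)]; [:: (2, 40); (6, 1)]; [:: (2, 48); (18, 1)];
     [:: (2, 52); (14, 1)]; [:: (2, 56); (10, 1)]; [:: (2, 60); (6, 1)];

     [:: (3, 20); (11, 1)]; [:: (3, 28); (7, 1)]; [:: (3, 32); (11, 1)];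
     [:: (3, 36); (15, 1)];

     [:: (5, 24); (25, 1)]; [:: (5, 28); (25, 1)]; [:: (5, 32); (25, 1)];
     [:: (5, 32); (45, 1)]; [:: (5, 36); (45, 1)]; [:: (5, 40); (45, 1)];
     [:: (5, 44); (25, 1)]; [:: (5, 44); (45, 1)];

     [:: (6, 16); (10, 1)];

     [:: (8, 8); (12, 1)]; [:: (8, 10); (16, 1)]; [:: (8, 10); (20, 1)];
     [:: (8, 14); (28, 1)]; [:: (8, 15); (4, 1)]; [:: (8, 15); (16, 1)];
     [:: (8, 15); (24, 1)]; [:: (8, 15); (36, 1)]; [:: (8, 16); (20, 1)];
     [:: (8, 17); (16, 1)]; [:: (8, 18); (32, 1)]; [:: (8, 20); (44, 1)];
     [:: (8, 21); (20, 1)]; [:: (8, 21); (40, 1)]; [:: (8, 22); (16, 1)];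
     [:: (8, 22); (36, 1)]; [:: (8, 23); (32, 1)]; [:: (8, 24); (28, 1)];
     [:: (8, 25); (4, 1)]; [:: (8, 25); (24, 1)]; [:: (8, 26); (20, 1)];
     [:: (8, 27); (16, 1)]; [:: (8, 28); (12, 1)];

     [:: (9, 8); (1, 1)]; [:: (9, 12); (13, 1)]; [:: (9, 16); (5, 1)];
     [:: (9, 16); (25, 1)]; [:: (9, 20); (17, 1)]; [:: (9, 20); (29, 1)];
     [:: (9, 20); (37, 1)]; [:: (9, 20); (49, 1)]; [:: (9, 28); (1, 1)];

     [:: (10, 10); (18, 1)]; [:: (10, 20); (38, 1)];

     [:: (11, 20); (19, 1)];

     [:: (12, 5); (8, 1)]; [:: (12, 10); (8, 1)]; [:: (12, 10); (16, 1)];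
     [:: (12, 10); (28, 1)]; [:: (12, 11); (20, 1)]; [:: (12, 12); (4, 1)];
     [:: (12, 12); (24, 1)]; [:: (12, 13); (8, 1)]; [:: (12, 13); (28, 1)];
     [:: (12, 14); (32, 1)]; [:: (12, 15); (8, 1)]; [:: (12, 15); (16, 1)];
     [:: (12, 15); (28, 1)]; [:: (12, 15); (36, 1)]; [:: (12, 15); (48, 1)];
     [:: (12, 16); (20, 1)]; [:: (12, 16); (40, 1)]; [:: (12, 17); (4, 1)];
     [:: (12, 17); (24, 1)]; [:: (12, 17); (44, 1)]; [:: (12, 18); (8, 1)];
     [:: (12, 18); (28, 1)]; [:: (12, 18); (48, 1)]; [:: (12, 19); (32, 1)];
     [:: (12, 19); (52, 1)]; [:: (12, 20); (8, 1)]; [:: (12, 21); (20, 1)];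
     [:: (12, 21); (40, 1)]; [:: (12, 21); (60, 1)]; [:: (12, 22); (4, 1)];
     [:: (12, 22); (24, 1)]; [:: (12, 22); (44, 1)]; [:: (12, 22); (64, 1)];
     [:: (12, 23); (28, 1)]; [:: (12, 23); (48, 1)]; [:: (12, 23); (68, 1)];
     [:: (12, 24); (32, 1)]; [:: (12, 24); (52, 1)]; [:: (12, 27); (4, 1)];

     [:: (13, 8); (17, 1)]; [:: (13, 12); (1, 1)]; [:: (13, 12); (21, 1)];
     [:: (13, 12); (41, 1)]; [:: (13, 16); (5, 1)]; [:: (13, 16); (25, 1)];
     [:: (13, 20); (1, 1)];

     [:: (14, 8); (6, 1)];

     [:: (16, 6); (20, 1)]; [:: (16, 7); (12, 1)]; [:: (16, 8); (4, 1)];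
     [:: (16, 9); (36, 1)]; [:: (16, 10); (8, 1)]; [:: (16, 10); (20, 1)];
     [:: (16, 10); (28, 1)]; [:: (16, 10); (36, 1)]; [:: (16, 10); (40, 1)];
     [:: (16, 11); (20, 1)]; [:: (16, 11); (40, 1)]; [:: (16, 12); (12, 1)];
     [:: (16, 12); (52, 1)]; [:: (16, 13); (4, 1)]; [:: (16, 13); (24, 1)];
     [:: (16, 13); (44, 1)]; [:: (16, 14); (36, 1)]; [:: (16, 15); (8, 1)];
     [:: (16, 15); (28, 1)]; [:: (16, 16); (20, 1)]; [:: (16, 16); (40, 1)];
     [:: (16, 17); (12, 1)];

     [:: (17, 8); (13, 1)]; [:: (17, 8); (33, 1)]; [:: (17, 12); (9, 1)];
     [:: (17, 12); (29, 1)]; [:: (17, 12); (49, 1)]; [:: (17, 16); (5, 1)];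

     [:: (20, 8); (40, 1)]; [:: (20, 9); (40, 1)]; [:: (20, 10); (36, 1)];
     [:: (20, 10); (40, 1)]; [:: (20, 11); (40, 1)];

     [:: (21, 8); (9, 1)]; [:: (21, 8); (29, 1)]; [:: (21, 12); (17, 1)];

     [:: (23, 8); (7, 1)];

     [:: (24, 6); (20, 1)]; [:: (24, 7); (8, 1)]; [:: (24, 7); (28, 1)];
     [:: (24, 8); (16, 1)]; [:: (24, 8); (36, 1)]; [:: (24, 9); (4, 1)];
     [:: (24, 9); (44, 1)]; [:: (24, 10); (4, 1)]; [:: (24, 10); (12, 1)];
     [:: (24, 10); (32, 1)]; [:: (24, 11); (20, 1)];

     [:: (25, 8); (5, 1)]; [:: (25, 8); (45, 1)];

     [:: (28, 6); (20, 1)]; [:: (28, 6); (40, 1)]; [:: (28, 7); (16, 1)];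
     [:: (28, 7); (36, 1)]; [:: (28, 8); (12, 1)]; [:: (28, 8); (32, 1)];
     [:: (28, 8); (52, 1)]; [:: (28, 9); (8, 1)]; [:: (28, 9); (48, 1)];
     [:: (28, 10); (4, 1)]; [:: (28, 10); (24, 1)];

     [:: (29, 8); (1, 1)]; [:: (29, 8); (21, 1)];

     [:: (32, 6); (20, 1)]; [:: (32, 6); (40, 1)]; [:: (32, 7); (4, 1)];
     [:: (32, 7); (24, 1)]; [:: (32, 7); (44, 1)]; [:: (32, 8); (8, 1)];
     [:: (32, 8); (28, 1)]; [:: (32, 9); (12, 1)];

     [:: (36, 6); (20, 1)]; [:: (36, 6); (40, 1)]; [:: (36, 7); (12, 1)];
     [:: (36, 7); (32, 1)]; [:: (36, 8); (24, 1)];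

     [:: (40, 6); (20, 1)];

     [:: (44, 6); (20, 1)]; [:: (44, 6); (40, 1)]; [:: (44, 7); (8, 1)];

     [:: (48, 6); (20, 1)];

     [:: (1, 16); (9, 5)]; [:: (1, 46); (5, 3)]; [:: (4, 5); (8, 5)]
  ].

(* Main.v *)
(* Let sigma be an automorphism of a GDD all of whose non-regular orbits lie in a
   single group.  Any two points of distinct groups include one in a regular
   orbit, so condition (iv) has to be checked only at one point of each regular
   orbit, and the design is determined by one block from each sigma-orbit of
   blocks.  Such base blocks were found by computer search for every listed type;
   verifying them is a finite computation. *)
Require Import Defs.
From HB Require Import structures.
From Stdlib Require Import NArith Lia.
From mathcomp Require Import all_boot zify_ssreflect.

Set Implicit Arguments.
Unset Strict Implicit.
Unset Printing Implicit Defensive.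

(** A group that sigma maps to itself, such as the one of size m in a type g^u m^1, need not have a
    multiple of the order n of sigma as its size; hence the short orbits. In a regular orbit exactly
    one power of sigma modulo n carries a given point to the chosen point p, so the blocks through p
    can be read off the base blocks. Condition (iv) at p then becomes one equality of lists with
    multiplicities: the points other than p on these blocks against the points outside the group of
    p. Equality gives a block for each such point, and the absence of repetitions makes the block
    unique. Two things need care. A block invariant under a nontrivial power of sigma yields the
    same block through p from several of its points, so repeated translates of one base block are
    merged before counting. And two points of short orbits on a common block go unnoticed at every
    regular point, so it is tested separately that the points of a block lie in distinct groups. *)

HB.instance Definition _ := Countable.copy N (can_type nat_of_binK).

(** * Lists without repetition *)

(** An element shared by two different lists would be repeated in the concatenation. Applied to the
    blocks through a fixed point, this turns an exact list of covered points into uniqueness of the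
    covering block. *)
Lemma flatten_map_inj (S T : eqType) (f : S -> seq T) (ss : seq S) (s s' : S) (x : T) :
  uniq (flatten [seq f s | s <- ss]) -> s \in ss -> s' \in ss ->
  x \in f s -> x \in f s' -> s = s'.
Proof.
elim: ss => //= a ss IH; rewrite cat_uniq => /and3P[_ /hasPn disj us].
have no u : u \in ss -> x \in f u -> x \in f a -> False.
  move=> uss xu xa; have /negP := disj x (introT flatten_mapP (ex_intro2 _ _ u uss xu)).
  by apply.
rewrite !inE => /predU1P[->|sss] /predU1P[->|s'ss] xs xs' //.
- by case: (no s').
- by case: (no s).
- exact: IH.
Qed.

Lemma map_uniq_inj (S T : eqType) (f : S -> T) (s : seq S) :
  uniq [seq f x | x <- s] -> {in s &, injective f}.
Proof.
elim: s => //= a s IH /andP[na us] x y; rewrite !inE => /predU1P[->|xs] /predU1P[->|ys] e //.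
- by move: na; rewrite e map_f.
- by move: na; rewrite -e map_f.
- exact: IH.
Qed.

(** * Residues of binary numbers *)

Lemma ltN_trans : transitive N.ltb.
Proof. by move=> a b c; lia. Qed.

Lemma mod_to_origin (n i : N) : N.ltb i n -> N.modulo (N.add i (N.sub n i)) n = 0%num.
Proof.
move=> lt_in; have -> : N.add i (N.sub n i) = n by lia.
exact: N.Div0.mod_same.
Qed.

(** Supplies the exponent of the inverse power of sigma. Subtraction on [N] is truncated, so [j] is
    reduced modulo [n] before it is subtracted. *)
Lemma mod_opp (n j : N) : N.ltb 0 n -> N.modulo (N.add j (N.sub n (N.modulo j n))) n = 0%num.
Proof.
move=> n0; rewrite -N.Div0.add_mod_idemp_l; apply: mod_to_origin.
by apply/N.ltb_lt/N.mod_lt => e; rewrite e in n0.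
Qed.

Lemma interval_disjoint (f f' w w' a a' : N) :
  N.leb (N.add f w) f' -> N.lt a w -> N.lt a' w' -> N.add f a = N.add f' a' -> False.
Proof. lia. Qed.

(** Reduction modulo [n] changes [a] by a multiple of [n], hence of [l]. With [l] the length of an
    orbit, exponents of sigma matter only modulo [n], on short orbits as well; with [l] a period and
    [n] a length, wrapping around an orbit does not disturb group labels. *)
Lemma modD_dvd (l n i a : N) : N.divide l n ->
  N.modulo (N.add i (N.modulo a n)) l = N.modulo (N.add i a) l.
Proof.
case=> d nE; rewrite {2}(N.div_mod' a n) {2}nE.
rewrite -(N.Div0.mod_add (N.add i (N.modulo a n)) (N.mul d (N.div a n)) l).
by congr N.modulo; lia.
Qed.

Lemma mod_from_origin (n i j : N) : N.ltb i n ->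
  N.modulo (N.add (N.sub n i) (N.add i j)) n = N.modulo j n.
Proof.
move=> lt_in; have -> : N.add (N.sub n i) (N.add i j) = N.add j (N.mul 1 n) by lia.
exact: N.Div0.mod_add.
Qed.

(** In a regular orbit only one exponent modulo [n] carries index [i] to index 0, so each point of a
    block accounts for a single translate having that point at the origin. *)
Lemma mod_origin_uniq (n i j : N) : N.ltb i n -> N.modulo (N.add i j) n = 0%num ->
  N.modulo j n = N.modulo (N.sub n i) n.
Proof.
move=> lt_in e; rewrite -(mod_from_origin j lt_in).
by rewrite -(@modD_dvd n n) ?e ?N.add_0_r //; exact: N.divide_refl.
Qed.

(** * Points, orbits and powers of sigma *)

(* An orbit is (length, offset, first group, period): its [i]-th point has number
   [offset + i] and lies in the group with label [first group + i mod period]. *)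
Definition orbit := (N * N * N * N)%type.
Definition olen (o : orbit) := o.1.1.1.
Definition ooff (o : orbit) := o.1.1.2.
Definition ofirst (o : orbit) := o.1.2.
Definition operiod (o : orbit) := o.2.
Definition point := (orbit * N)%type.

(** The residue of [k], arranged for fast evaluation: an index in a regular orbit plus an exponent
    of at most [n] is below [2n], so one subtraction suffices. Division is left to sums of [2n] or
    more, as they arise on short orbits. *)
Definition wrap (n k : N) : N :=
  if N.ltb k n then k else
  let k' := N.sub k n in if N.ltb k' n then k' else N.modulo k n.

Lemma wrapE (n k : N) : n <> 0%num -> wrap n k = N.modulo k n.
Proof.
move=> n0; rewrite /wrap; case: N.ltb_spec => [lt_kn|le_nk]; first by rewrite N.mod_small.
case: N.ltb_spec => // lt_kn.
have -> : k = N.add (N.sub k n) (N.mul 1 n) by lia.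
rewrite N.Div0.mod_add N.mod_small //; lia.
Qed.

(** This is sigma^j: sigma moves every point one step along its orbit. *)
Definition shift (j : N) (p : point) : point := (p.1, wrap (olen p.1) (N.add p.2 j)).
Definition key (p : point) : N := N.add (ooff p.1) p.2.
Definition group (p : point) : N :=
  N.add (ofirst p.1) (wrap (operiod p.1) p.2).

Definition range (n : N) : seq N := [seq bin_of_nat i | i <- iota 0 n].

Lemma mem_range (n i : N) : (i \in range n) = N.ltb i n.
Proof.
apply/mapP/idP => [[k]|lt_in]; first by rewrite mem_iota => /andP[_ lt_kn] ->; lia.
by exists (nat_of_bin i); rewrite ?nat_of_binK ?mem_iota //; lia.
Qed.

Definition points (os : seq orbit) : seq point :=
  flatten [seq [seq (o, i) | i <- range (olen o)] | o <- os].

Lemma mem_points (os : seq orbit) (p : point) :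
  (p \in points os) = (p.1 \in os) && N.ltb p.2 (olen p.1).
Proof.
case: p => o i /=; apply/flatten_mapP/andP => [[o' o'os /mapP[i' i'r [-> ->]]]|[oos lt_i]].
  by rewrite -mem_range.
by exists o => //; apply/mapP; exists i => //; rewrite mem_range.
Qed.

(** * The test of a list of base blocks *)

(** A point of [b] at index i of the orbit [o] is carried to index 0 by the exponent [n - i]. Sorted
    keys are a normal form of a translate, and [undup] merges the coinciding translates of a block
    that a proper power of sigma preserves. Orbits are compared by their offsets, which identify
    them. *)
Definition through (n : N) (o : orbit) (b : seq point) : seq (seq N) :=
  undup [seq sort N.leb [seq key (shift (N.sub n p.2) q) | q <- b]
        | p <- b & ooff p.1 == ooff o].

(** Condition (iv) at the first point of [o], whose key is [ooff o]. The right-hand list needs no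
    sorting because [check] demands increasing keys. Since [undup] acts within one base block, a
    translate through this point that is common to two base blocks is counted twice, and the test
    fails. *)
Definition local_check (n : N) (kgs : seq (N * N)) (bs : seq (seq point)) (o : orbit) :=
  let g := group (o, 0%num) in
  sort N.leb (flatten [seq [seq k <- s | k != ooff o]
                      | s <- flatten [seq through n o b | b <- bs]])
  == [seq kg.1 | kg <- kgs & kg.2 != g].

Definition tidy (h : N) (n : N) (os : seq orbit) (o : orbit) :=
  [&& N.ltb 0 (olen o), N.modulo n (olen o) == 0%num, N.ltb 0 (operiod o),
      N.modulo (olen o) (operiod o) == 0%num,
      (olen o == n) || (ofirst o == h) && (operiod o == 1%num)
    & all (fun o' => [|| (ofirst o == ofirst o') && (operiod o == operiod o'),
                         N.leb (N.add (ofirst o) (operiod o)) (ofirst o')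
                       | N.leb (N.add (ofirst o') (operiod o')) (ofirst o)]) os].

(* The label of the only group that may contain non-regular orbits. *)
Definition spare (os : seq orbit) : N := ofirst (last (0, 0, 0, 0)%num os).

(** Increasing keys make the numbering of points injective. A label is a position in
    [group_sizes t], and sorting the labels of all points verifies that each occurs as often as the
    size at its position says. The condition on the groups within a block is independent of
    [local_check], which does not notice two points of short orbits on one block. *)
Definition check (t : gdd_type) (n : N) (os : seq orbit) (bs : seq (seq point)) : bool :=
  let P := points os in
  let kgs := [seq (key p, group p) | p <- P] in
  let gs := group_sizes t in
  [&& N.ltb 0 n && all (fun s => 0 < s) gs,
      all (tidy (spare os) n os) os,
      sorted N.ltb (unzip1 kgs),
      sort N.leb (unzip2 kgs)
        == flatten [seq nseq (nth 0 gs k) (bin_of_nat k) | k <- iota 0 (size gs)],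
      bs != [::],
      all (fun b => [&& size b == 5, uniq [seq group p | p <- b]
                      & all (fun p => (p.1 \in os) && N.ltb p.2 (olen p.1)) b]) bs
    & all (fun o => (olen o != n) || local_check n kgs bs o) os].

(** * Group labels of tidy orbits *)

Lemma tidyP (h n : N) (os : seq orbit) (o : orbit) : tidy h n os o ->
  [/\ olen o <> 0%num, operiod o <> 0%num, N.divide (olen o) n,
      N.divide (operiod o) (olen o)
    & olen o <> n -> ofirst o = h /\ operiod o = 1%num].
Proof.
case/and5P=> l0 /eqP dl p0 /eqP dp /andP[reg _].
split; [lia|lia|exact/N.Lcm0.mod_divide|exact/N.Lcm0.mod_divide|].
by move=> ne; case/orP: reg => [/eqP //|/andP[/eqP-> /eqP->]].
Qed.

(** A common label makes the two label ranges overlap. Overlapping ranges coincide, and within one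
    range the label determines the residue of the index. *)
Lemma tidy_group (h n : N) (os : seq orbit) (o o' : orbit) (a a' : N) :
  tidy h n os o -> tidy h n os o' -> o' \in os ->
  N.add (ofirst o) (wrap (operiod o) a) = N.add (ofirst o') (wrap (operiod o') a') ->
  [/\ ofirst o = ofirst o', operiod o = operiod o'
    & N.modulo a (operiod o) = N.modulo a' (operiod o)].
Proof.
move=> to to' o'os; have [_ p0 _ _ _] := tidyP to; have [_ p0' _ _ _] := tidyP to'.
case/and5P: to => _ _ _ _ /andP[_ /allP/(_ o' o'os) sep].
rewrite !wrapE // => e.
have lt := N.mod_lt a _ p0; have lt' := N.mod_lt a' _ p0'.
case/or3P: sep => [/andP[/eqP ef /eqP ep]|c|c].
- by move: e; rewrite ef ep => /N.add_cancel_l.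
- by case: (interval_disjoint c lt lt' e).
- by case: (interval_disjoint c lt' lt (esym e)).
Qed.

(** * Action of sigma on points and groups *)

Section CheckSound.
Variables (t : gdd_type) (n : N) (os : seq orbit) (bs : seq (seq point)).
Hypothesis ok : check t n os bs.
Let P := points os.
Let gs := group_sizes t.
Let kgs := [seq (key p, group p) | p <- P].

Let n_gt0 : N.ltb 0 n. Proof. by case/and3P: ok => /andP[]. Qed.
Let gs_gt0 : all (fun s => 0 < s) gs. Proof. by case/and3P: ok => /andP[]. Qed.
Let os_tidy : all (tidy (spare os) n os) os. Proof. by case/and3P: ok. Qed.
Let keys_sorted : sorted N.ltb (unzip1 kgs). Proof. by case/and4P: ok. Qed.
Let groupsE : perm_eq [seq group p | p <- P]
  (flatten [seq nseq (nth 0 gs k) (bin_of_nat k) | k <- iota 0 (size gs)]).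
Proof.
case/and5P: ok => _ _ _ /eqP <- _.
by rewrite perm_sym perm_sort /unzip2 -map_comp.
Qed.
Let bs_neq0 : bs != [::]. Proof. by case/and5P: ok => _ _ _ _ /and3P[]. Qed.
Let bs_ok : all (fun b => [&& size b == 5, uniq [seq group p | p <- b]
                      & all (fun p => (p.1 \in os) && N.ltb p.2 (olen p.1)) b]) bs.
Proof. by case/and5P: ok => _ _ _ _ /and3P[]. Qed.
Let os_ok : all (fun o => (olen o != n) || local_check n kgs bs o) os.
Proof. by case/and5P: ok => _ _ _ _ /and3P[]. Qed.

Lemma tidy_in (o : orbit) : o \in os -> tidy (spare os) n os o.
Proof. exact: (allP os_tidy). Qed.

Lemma keys_uniq : uniq [seq key p | p <- P].
Proof.
have := sorted_uniq ltN_trans N.ltb_irrefl keys_sorted.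
by rewrite /unzip1 -map_comp.
Qed.

Lemma key_inj : {in P &, injective key}.
Proof. exact/map_uniq_inj/keys_uniq. Qed.

Lemma P_uniq : uniq P.
Proof. exact: map_uniq keys_uniq. Qed.

Lemma shift_in (j : N) (p : point) : p \in P -> shift j p \in P.
Proof.
rewrite !mem_points /= => /andP[oos _]; rewrite oos /=.
have [l0 _ _ _ _] := tidyP (tidy_in oos).
by rewrite wrapE //; apply/N.ltb_lt/N.mod_lt.
Qed.

Lemma shiftD (j k : N) (p : point) : p \in P -> shift j (shift k p) = shift (N.add k j) p.
Proof.
case: p => o i; rewrite mem_points /shift /= => /andP[/tidy_in/tidyP[l0 _ _ _ _] _].
by rewrite !wrapE // N.Div0.add_mod_idemp_l N.add_assoc.
Qed.

(** Every orbit length divides [n], so sigma^n fixes all points. *)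
Lemma shift_mod (j k : N) (p : point) :
  N.modulo j n = N.modulo k n -> p \in P -> shift j p = shift k p.
Proof.
case: p => o i e; rewrite mem_points /shift /= => /andP[/tidy_in/tidyP[l0 _ dl _ _] _].
by rewrite !wrapE // -(modD_dvd _ j dl) e modD_dvd.
Qed.

(** Points of one group have congruent indices modulo a common period, even on different orbits, and
    advancing both by [j] preserves the congruence. Wrapping is harmless because the period divides
    both lengths. So sigma maps groups into groups. *)
Lemma group_shift (j : N) (p q : point) : p \in P -> q \in P ->
  group p = group q -> group (shift j p) = group (shift j q).
Proof.
case: p q => [o i] [o' i']; rewrite !mem_points /= => /andP[oos _] /andP[o'os _].
rewrite /group /shift /= => e.
have [ef ep em] := tidy_group (tidy_in oos) (tidy_in o'os) o'os e.
have [l0 p0 _ dp _] := tidyP (tidy_in oos); have [l0' p0' _ dp' _] := tidyP (tidy_in o'os).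
rewrite (wrapE _ p0) (wrapE _ p0') (wrapE _ l0) (wrapE _ l0') ef; congr N.add.
have mod_mod l p m : N.divide p l -> N.modulo (N.modulo m l) p = N.modulo m p.
  by move=> dl; rewrite -(N.add_0_l (N.modulo m l)) modD_dvd.
by rewrite !mod_mod // -ep -N.Div0.add_mod_idemp_l em N.Div0.add_mod_idemp_l.
Qed.

Definition translate (j : N) (s : seq point) : seq point := [seq shift j p | p <- s].

Lemma block_in (b : seq point) : b \in bs -> {subset b <= P}.
Proof.
by move=> bbs p pb; move/allP: bs_ok => /(_ b bbs) /and3P[_ _ /allP/(_ p pb)]; rewrite mem_points.
Qed.

Lemma translate_in (j : N) (s : seq point) : {subset s <= P} -> {subset translate j s <= P}.
Proof. by move=> sP p /mapP[q qs ->]; apply/shift_in/sP. Qed.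

Lemma translateD (j k : N) (s : seq point) :
  {subset s <= P} -> translate j (translate k s) = translate (N.add k j) s.
Proof.
by move=> sP; rewrite /translate -map_comp; apply/eq_in_map => p /sP pP; apply: shiftD.
Qed.

Lemma translate_mod (j k : N) (s : seq point) :
  N.modulo j n = N.modulo k n -> {subset s <= P} -> translate j s = translate k s.
Proof. by move=> e sP; apply/eq_in_map => p /sP; apply: shift_mod. Qed.

(** * Blocks through the first point of a regular orbit *)

Definition base_point (o : orbit) : point := (o, 0%num).

Lemma base_in (o : orbit) : o \in os -> base_point o \in P.
Proof. move=> oos; rewrite mem_points /= oos /=.
by have [/N.neq_0_lt_0/N.ltb_lt] := tidyP (tidy_in oos). Qed.

(** Justifies that [through] recognises an orbit by its offset: the offset is the key of the first
    point. *)
Lemma ooff_inj (o o' : orbit) : o \in os -> o' \in os -> ooff o = ooff o' -> o = o'.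
Proof.
move=> oos o'os e.
have [] : base_point o = base_point o' by apply: key_inj; rewrite ?base_in // /key /= e.
by [].
Qed.

Definition local_blocks (o : orbit) := flatten [seq through n o b | b <- bs].

(** The computed list misses no translate: if [shift j] carries a point of index i to index 0, then
    i + j is a multiple of [n], so j agrees with n - i modulo [n]. On an orbit of length below [n]
    several exponents modulo [n] would do so, hence the restriction to regular orbits. *)
Lemma local_blocksP (o : orbit) (T : seq N) : o \in os -> olen o = n ->
  reflect (exists b j, [/\ b \in bs, base_point o \in translate j b
                         & T = sort N.leb [seq key q | q <- translate j b]])
          (T \in local_blocks o).
Proof.
move=> oos ln; apply: (iffP flatten_mapP) => [[b bbs]|[b [j [bbs]]]].
  rewrite mem_undup => /mapP[[o' i]]; rewrite mem_filter /= => /andP[/eqP eo pb] ->.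
  have := block_in bbs pb; rewrite mem_points /= => /andP[o'os lt_i].
  have eo' := ooff_inj o'os oos eo; subst o'.
  exists b, (N.sub n i); split; rewrite ?/translate -?map_comp //.
  apply/mapP; exists (o, i) => //; rewrite /shift /= wrapE; last by case: (tidyP (tidy_in oos)).
  by rewrite ln mod_to_origin // -ln.
case/mapP => [[o' i] pb [eo ei]] ->; subst o'.
have := block_in bbs pb; rewrite mem_points /= => /andP[_ lt_i].
exists b => //; rewrite mem_undup; apply/mapP; exists (o, i); first by rewrite mem_filter /= eqxx.
rewrite /translate -map_comp; congr sort; apply/eq_in_map => q /(block_in bbs) qP /=.
congr key; apply: shift_mod => //.
move: ei; rewrite wrapE ?ln; last by rewrite -ln; case: (tidyP (tidy_in oos)).
by move/esym/mod_origin_uniq => -> //; rewrite -ln.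
Qed.

Section AtOrbit.
Variable o : orbit.
Hypotheses (oos : o \in os) (oreg : olen o = n).

Lemma local_perm : perm_eq
  (flatten [seq [seq k <- s | k != ooff o] | s <- local_blocks o])
  [seq key p | p <- P & group p != group (base_point o)].
Proof.
move/allP: os_ok => /(_ o oos); rewrite oreg eqxx /= => /eqP e.
rewrite -(perm_sort N.leb) e /kgs filter_map -map_comp /preim /=.
exact: perm_refl.
Qed.

Lemma local_exists (y : point) : y \in P -> group y != group (base_point o) ->
  exists b j, [/\ b \in bs, base_point o \in translate j b & y \in translate j b].
Proof.
move=> yP gy; have: key y \in [seq key p | p <- P & group p != group (base_point o)].
  by apply: map_f; rewrite mem_filter gy.
rewrite -(perm_mem local_perm) => /flatten_mapP[T /(local_blocksP _ oos oreg)[b [j [bbs rb ->]]]].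
rewrite mem_filter mem_sort => /andP[_ /mapP[q qb eq]].
by exists b, j; split=> //; rewrite (key_inj yP (translate_in (block_in bbs) qb) eq).
Qed.

(** The right-hand list of [local_perm] has no repetition, so [key y] occurs once on the left and
    the two translates have the same sorted key list. Sorting forgets the order in which a block
    lists its points; this is why the conclusion is equality of sets. *)
Lemma local_unique (y : point) (b b' : seq point) (j j' : N) :
  b \in bs -> b' \in bs -> y \in P -> group y != group (base_point o) ->
  base_point o \in translate j b -> y \in translate j b ->
  base_point o \in translate j' b' -> y \in translate j' b' ->
  translate j b =i translate j' b'.
Proof.
move=> bbs b'bs yP gy rb yb rb' yb'.
pose T b j := sort N.leb [seq key q | q <- translate j b].
have TL c k : c \in bs -> base_point o \in translate k c -> T c k \in local_blocks o.
  by move=> cbs rc; apply/local_blocksP => //; exists c, k.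
have yT c k : y \in translate k c -> key y \in [seq k <- T c k | k != ooff o].
  move=> yc; rewrite mem_filter mem_sort map_f // andbT.
  (* The filter removes only the origin, and [y] is not the origin because its group is
     different. *)
  apply: contraNneq gy => e; rewrite (key_inj yP (base_in oos)) // e /key /=.
  by rewrite N.add_0_r.
have u : uniq (flatten [seq [seq k <- s | k != ooff o] | s <- local_blocks o]).
  rewrite (perm_uniq local_perm) map_inj_in_uniq ?filter_uniq ?P_uniq //.
  by move=> p q; rewrite !mem_filter => /andP[_ pP] /andP[_ qP]; apply: key_inj.
(* Both key lists contain [key y], which the concatenation contains once. *)
have e := flatten_map_inj u (TL _ _ bbs rb) (TL _ _ b'bs rb') (yT _ _ yb) (yT _ _ yb').
have sub c k c' k' : c \in bs -> c' \in bs -> T c k = T c' k' ->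
    {subset translate k c <= translate k' c'}.
  move=> cbs c'bs eT p pc; have: key p \in T c k by rewrite mem_sort map_f.
  rewrite eT mem_sort => /mapP[q qc' eq].
  by rewrite (key_inj (translate_in (block_in cbs) pc) (translate_in (block_in c'bs) qc') eq).
by move=> p; apply/idP/idP; apply: sub.
Qed.
End AtOrbit.

(** * Transport of the covering property along sigma *)

Lemma shift0 (j : N) (p : point) : N.modulo j n = 0%num -> p \in P -> shift j p = p.
Proof.
move=> j0 pP; rewrite (@shift_mod j 0) ?N.Div0.mod_0_l //.
move: pP; case: p => o i; rewrite mem_points /shift /= => /andP[_ lt_i].
by rewrite N.add_0_r /wrap lt_i.
Qed.

Lemma shiftK (j : N) (p : point) :
  p \in P -> shift (N.sub n (N.modulo j n)) (shift j p) = p.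
Proof. by move=> pP; rewrite shiftD ?shift0 ?mod_opp. Qed.

Lemma shift_inj (j : N) : {in P &, injective (shift j)}.
Proof. by move=> p q pP qP e; rewrite -(shiftK j pP) e shiftK. Qed.

Lemma mem_translate (j : N) (s : seq point) (p : point) :
  {subset s <= P} -> p \in P -> (shift j p \in translate j s) = (p \in s).
Proof.
move=> sP pP; apply/mapP/idP => [[q qs e]|ps]; last by exists p.
by rewrite (shift_inj pP (sP _ qs) e).
Qed.

(** The inverse power of sigma preserves groups too; thus sigma permutes the groups. *)
Lemma group_shift_inv (j : N) (p q : point) : p \in P -> q \in P ->
  group (shift j p) = group (shift j q) -> group p = group q.
Proof.
move=> pP qP e; rewrite -(shiftK j pP) -(shiftK j qP).
by apply: group_shift e; apply: shift_in.
Qed.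

Lemma translate_uniq (j : N) (b : seq point) : b \in bs -> uniq (translate j b).
Proof.
move=> bbs; rewrite map_inj_in_uniq.
  by move/allP: bs_ok => /(_ b bbs) /and3P[_ /map_uniq].
by move=> p q /(block_in bbs) pP /(block_in bbs); apply: shift_inj.
Qed.

(** A base block meets every group at most once, and its translates inherit this because distinct
    groups stay distinct under sigma. *)
Lemma translate_group (j : N) (b : seq point) :
  b \in bs -> {in translate j b &, injective group}.
Proof.
move=> bbs _ _ /mapP[p pb ->] /mapP[q qb ->] e; congr shift.
have u : uniq [seq group p | p <- b].
  by move/allP: bs_ok => /(_ b bbs) /and3P[].
by apply: (map_uniq_inj u) => //; apply: group_shift_inv e; apply: (block_in bbs).
Qed.

Definition covers (x y : point) (b : seq point) (j : N) :=
  [/\ b \in bs, x \in translate j b & y \in translate j b].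

(** The exponent [m = n - i] moves [x] to the first point of its orbit, where the local statements
    apply. Translation by [i] brings a block back, and translation by [m] reduces uniqueness at [x]
    to uniqueness at the origin. *)
Lemma regular_cover (x y : point) : x \in P -> y \in P -> group x != group y ->
  olen x.1 = n ->
  (exists b j, covers x y b j) /\
  (forall b j b' j', covers x y b j -> covers x y b' j' ->
     translate j b =i translate j' b').
Proof.
case: x => o i xP yP gxy /= ln.
move: (xP); rewrite mem_points ln /= => /andP[oos lt_i].
pose m := N.sub n i.
have mi : N.modulo (N.add m i) n = 0%num by rewrite N.add_comm mod_to_origin.
have xm : shift m (o, i) = base_point o.
  rewrite /shift /= wrapE ?ln ?mod_to_origin //.
  by rewrite -ln; case: (tidyP (tidy_in oos)).
have ymP : shift m y \in P by apply: shift_in.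
have gm : group (shift m y) != group (base_point o).
  by apply: contraNneq gxy; rewrite -xm => /group_shift_inv ->.
split=> [|b j b' j' [bbs xb yb] [b'bs xb' yb'] p].
  have [b [j [bbs xb yb]]] := local_exists oos ln ymP gm.
  exists b, (N.add j i); rewrite /covers -translateD; last exact: block_in.
  have back q : q \in P -> q = shift i (shift m q) by move=> qP; rewrite shiftD // shift0.
  by rewrite (back _ xP) (back _ yP) xm; split=> //; apply: map_f.
have tP := translate_in (block_in bbs); have tP' := translate_in (block_in b'bs).
have e : translate (N.add j m) b =i translate (N.add j' m) b'.
  apply: (local_unique oos ln) => //; first exact: ymP; rewrite // -translateD;
    by [rewrite -xm map_f|rewrite map_f|apply: block_in].
(* Powers of sigma are injective on [P], so membership is transported for points of [P]; a point
   outside [P] is on neither translate. *)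
have [pP|pnP] := boolP (p \in P); last first.
  by apply/idP/idP => [/tP|/tP'] pP; rewrite pP in pnP.
have mem c k : c \in bs -> (p \in translate k c) = (shift m p \in translate (N.add k m) c).
  move=> cbs; rewrite -translateD; last exact: block_in.
  by rewrite mem_translate //; apply/translate_in/block_in.
by rewrite !mem // e.
Qed.

Lemma cross_cover (x y : point) : x \in P -> y \in P -> group x != group y ->
  (exists b j, covers x y b j) /\
  (forall b j b' j', covers x y b j -> covers x y b' j' ->
     translate j b =i translate j' b').
Proof.
have sym u v b j : covers u v b j -> covers v u b j by case.
move=> xP yP gxy; have [ln|lx] := eqVneq (olen x.1) n; first exact: regular_cover.
have [ln|ly] := eqVneq (olen y.1) n.
  have [[b [j c]] u] := regular_cover yP xP (introN eqP (fun e => negP gxy (introT eqP (esym e)))) ln.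
  split=> [|b1 j1 b2 j2 /sym c1 /sym c2]; last exact: u c1 c2.
  by exists b, j; apply: sym.
(* A short orbit has period 1 and starts at the spare label, so all its points carry that label. Two
   such points would contradict [gxy]. *)
have h p : p \in P -> olen p.1 != n -> group p = spare os.
  rewrite mem_points => /andP[/tidy_in/tidyP[_ _ _ _ sg] _] /eqP/sg[ef ep].
  by rewrite /group ef wrapE ep ?N.mod_1_r ?N.add_0_r.
by rewrite !h ?eqxx in gxy.
Qed.

(** * The design as sets over the finite type of points *)

(** The countable structure given to [N] passes to points through products, which supplies the
    choice structure needed by the finite type [seq_sub P]. *)
Let V : finType := seq_sub P.

Definition to_set (s : seq point) : {set V} := [set x : V | val x \in s].
(** A block invariant under a nontrivial power of sigma is listed several times here; [block_sets],
    being a set, forgets the repetitions. *)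
Definition blocks : seq (seq point) := [seq translate j b | b <- bs, j <- range n].
Definition block_sets : {set {set V}} := [set S in [seq to_set s | s <- blocks]].
Definition group_set (k : nat) : {set V} := [set x : V | group (val x) == bin_of_nat k].
Definition group_sets : {set {set V}} := [set group_set k | k : 'I_(size gs)].

Lemma card_val (Q : pred point) : #|[set x : V | Q (val x)]| = count Q P.
Proof.
rewrite cardsE cardE -(size_map val) -size_filter; apply: perm_size.
apply: uniq_perm; rewrite ?(map_inj_uniq val_inj) ?enum_uniq ?filter_uniq ?P_uniq //.
move=> p; rewrite mem_filter; apply/mapP/andP => [[x]|[Qp pP]].
  by rewrite mem_enum => Qx ->; split=> //; apply: valP.
by exists (SeqSub pP) => //; rewrite mem_enum.
Qed.

Lemma mem_block_sets (S : {set V}) :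
  reflect (exists b j, b \in bs /\ S = to_set (translate j b)) (S \in block_sets).
Proof.
rewrite inE; apply: (iffP mapP) => [[s /allpairsP[[b j] /= [bbs _ ->]] ->]|[b [j [bbs ->]]]].
  by exists b, j.
(* [blocks] uses exponents below [n] only; reduction modulo [n] does not alter a translate. *)
exists (translate (N.modulo j n) b).
  apply/allpairsP; exists (b, N.modulo j n); split=> //=.
  by rewrite mem_range; apply/N.ltb_lt/N.mod_lt => e; move: n_gt0; rewrite e.
by congr to_set; apply: translate_mod; rewrite ?N.Div0.mod_mod //; apply: block_in.
Qed.

Lemma card_group_set (k : nat) : k < size gs -> #|group_set k| = nth 0 gs k.
Proof.
move=> lt_k; rewrite (card_val (fun p => group p == bin_of_nat k)).
rewrite -(count_map group (pred1 (bin_of_nat k))) (permP groupsE) count_flatten.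
(* Label [k] occurs only in the stretch of copies of [k], so a single summand survives. *)
rewrite sumnE !big_map (bigD1_seq k) ?iota_uniq ?mem_iota //=.
rewrite count_nseq /= eqxx mul1n big1 ?addn0 // => i ne_ik.
by rewrite count_nseq /= (can_eq bin_of_natK) (negPf ne_ik).
Qed.

Lemma groupP (x : V) : exists k : 'I_(size gs), group (val x) = bin_of_nat k.
Proof.
have: group (val x) \in [seq group p | p <- P] by apply/map_f/valP.
rewrite (perm_mem groupsE) => /flatten_mapP[k]; rewrite mem_iota => /andP[_ lt_k].
by rewrite mem_nseq => /andP[_ /eqP ->]; exists (Ordinal lt_k).
Qed.

Lemma nth_gs_gt0 (k : nat) : k < size gs -> 0 < nth 0 gs k.
Proof. by move=> lt_k; apply: (allP gs_gt0); rewrite mem_nth. Qed.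

(** A point of the common set has both labels, and positive sizes provide such a point. Hence groups
    of equal size are not merged when the sets with the various labels are collected into
    [group_sets]. *)
Lemma group_set_inj : injective (fun k : 'I_(size gs) => group_set k).
Proof.
move=> k l e; have: 0 < #|group_set k| by rewrite card_group_set ?nth_gs_gt0.
case/card_gt0P => x xk; have := xk; rewrite e; move: xk; rewrite !inE => /eqP-> /eqP.
by move/(can_inj bin_of_natK)/val_inj.
Qed.

Lemma partition_groups : partition group_sets [set: V].
Proof.
apply/and3P; split.
- apply/eqP/setP => x; rewrite inE; apply/bigcupP.
  have [k gk] := groupP x; exists (group_set k); first by rewrite imset_f.
  by rewrite inE gk.
- apply/trivIsetP => _ _ /imsetP[k _ ->] /imsetP[l _ ->] ne.
  rewrite -setI_eq0; apply/eqP/setP => x; rewrite !inE.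
  by apply/negP => /andP[/eqP-> /eqP/(can_inj bin_of_natK) e]; rewrite e eqxx in ne.
- apply/imsetP => -[k _ /eqP]; rewrite eq_sym -cards_eq0 card_group_set //.
  by rewrite -leqn0 leqNgt nth_gs_gt0.
Qed.

Lemma size_points : #|V| = \sum_(gu <- t) gu.2 * gu.1.
Proof.
rewrite (card_seq_sub P_uniq) -(size_map group) (perm_size groupsE) size_flatten /shape.
rewrite -map_comp (eq_map (fun k => size_nseq _ _)).
have -> : [seq nth 0 gs k | k <- iota 0 (size gs)] = gs by apply: mkseq_nth.
rewrite /gs /group_sizes sumn_flatten sumnE !big_map; apply: eq_bigr => gu _.
by rewrite sumn_nseq mulnC.
Qed.

(** Because different labels give different sets, enumerating [group_sets] rearranges the list of
    the sets taken label by label, whose cardinals are the entries of [gs] in order. *)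
Lemma perm_groups : perm_eq [seq #|A : {set V}| | A <- enum group_sets] gs.
Proof.
have e : perm_eq (enum group_sets) [seq group_set k | k : 'I_(size gs)].
  apply: uniq_perm; rewrite ?enum_uniq ?(map_inj_uniq group_set_inj) ?enum_uniq //.
  move=> A; rewrite mem_enum; apply/imsetP/mapP => -[k _ ->]; exists k => //.
  by rewrite mem_enum.
rewrite (perm_trans (perm_map _ e)) // -map_comp.
rewrite (eq_map (g := fun k : 'I_(size gs) => nth 0 gs k)); last first.
  by move=> k /=; rewrite card_group_set.
by rewrite (map_comp (nth 0 gs) val) val_enum_ord map_nth_iota0 ?take_size.
Qed.

Lemma check_gdd_exists : gdd_exists 5 t.
Proof.
exists V, group_sets, block_sets; split.
- exact: size_points.
- exact: partition_groups.
- exact: perm_groups.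
- case: bs bs_neq0 (mem_block_sets) => // b bs' _ H.
  apply/set0Pn; exists (to_set (translate 0 b)); apply/H.
  by exists b, 0%num; rewrite mem_head.
- move=> S /mem_block_sets[b [j [bbs ->]]]; rewrite (card_val (mem (translate j b))) -size_filter.
  have /and3P[/eqP <- _ _] := allP bs_ok _ bbs; rewrite -(size_map (shift j) b).
  (* The cardinal counts the points of [P] on the translate. The translate is itself a list of
     distinct points of [P], so the count is its length. *)
  apply/perm_size/uniq_perm; rewrite ?filter_uniq ?P_uniq ?translate_uniq //.
  move=> p; rewrite mem_filter andb_idr // => pb.
  exact: translate_in (block_in bbs) _ pb.
- move=> _ _ x y /imsetP[k _ ->] /imsetP[l _ ->] ne; rewrite !inE => /eqP gx /eqP gy.
  have gxy : group (val x) != group (val y).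
    by apply: contraNneq ne; rewrite gx gy => /(can_inj bin_of_natK) ->.
  have [[b [j [bbs xb yb]]] u] := cross_cover (valP x) (valP y) gxy.
  exists (to_set (translate j b)); split.
    by split; rewrite ?[_ \in to_set _]inE //; apply/mem_block_sets; exists b, j.
  move=> S [/mem_block_sets[b' [j' [b'bs ->]]]]; rewrite ![_ \in to_set _]inE => xb' yb'.
  by apply/setP => z; rewrite !inE; apply: u.
- move=> _ S x y /imsetP[k _ ->] /mem_block_sets[b [j [bbs ->]]].
  rewrite !inE => /eqP gx /eqP gy ne [xb yb]; case/eqP: ne.
  (* A translate meets each group at most once, so the two points would coincide. *)
  by apply: val_inj; apply: (translate_group bbs xb yb); rewrite gx gy.
Qed.
End CheckSound.

(** * Decoding the compressed data *)

(** Orbits are numbered one after the other, so the orbit of [x] is the first one ending beyond [x].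
    The default of [nth] serves numbers beyond all orbits; it is not an orbit of the design, and
    [check] rejects a block with such a point. *)
Definition decode (os : seq orbit) (x : N) : point :=
  let o := nth (x, x, x, x) os (find (fun o => N.ltb x (N.add (ooff o) (olen o))) os) in
  (o, N.sub x (ooff o)).

(** Offsets are accumulated lengths. This leaves no gaps in the numbering, as [decode] expects, and
    makes the keys increase along [points], as [check] demands. *)
Fixpoint layout (off : N) (runs : seq (N * (N * N * N))) : seq orbit :=
  if runs is (k, (l, f, w)) :: runs' then
    [seq (l, N.add off (N.mul i l), f, w) | i <- range k] ++ layout (N.add off (N.mul k l)) runs'
  else [::].

(* [(r, m, ys)] is a permutation t with t o sigma = sigma^m o t, of order r modulo
   the group generated by sigma and the automorphisms before it in the list; [ys]
   lists the images of the first points of the orbits of sigma. *)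
Definition normalizing := (N * N * seq N)%type.

(** The relation t o sigma = sigma^m o t gives t(sigma^i p) = sigma^(m i) (t p), so t is determined
    by the images of the first points: index i goes to index i0 + m i of the image orbit, where i0
    is the index of the image of the first point. *)
Definition apply_normalizing (os : seq orbit) (a : normalizing) (x : N) : N :=
  let '(_, m, ys) := a in
  let o := (decode os x).1 in
  let y := nth x ys (find (fun o => N.ltb x (N.add (ooff o) (olen o))) os) in
  let o' := (decode os y).1 in
  N.add (ooff o')
    (N.modulo (N.add (N.sub y (ooff o')) (N.mul m (N.sub x (ooff o)))) (olen o')).

Definition block := (N * N * N * N * N)%type.

Definition apply_block (f : N -> N) (b : block) : block :=
  let '(x1, x2, x3, x4, x5) := b in (f x1, f x2, f x3, f x4, f x5).

(** [foldr] lets the last automorphism act first and so produces the images of a block under all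
    products a1^i1 ... ak^ik with exponents below the orders; with orders as described above, this
    is one image for each coset of the group generated by sigma. A block preserved modulo sigma by a
    nontrivial product would be produced repeatedly and fail [local_check], so it has to be given
    among the further base blocks. *)
Definition expand (os : seq orbit) (auts : seq normalizing) (bs : seq block) : seq block :=
  foldr (fun a bs =>
    flatten [seq traject (apply_block (apply_normalizing os a)) b (nat_of_bin a.1.1) | b <- bs])
  bs auts.

(* The order of sigma; the runs (number of orbits, (length, first group, period))
   of consecutive similar orbits; further automorphisms; blocks, given by the
   numbers of their points, to be expanded under these automorphisms; further
   base blocks. The further automorphisms only shorten the data: [check] validates
   the expanded list. *)
Definition design :=
  (N * seq (N * (N * N * N)) * seq normalizing * seq block * seq block)%type.

Definition realizes (t : gdd_type) (d : design) : bool :=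
  let '(n, runs, auts, bs, bs') := d in
  let os := layout 0 runs in
  check t n os
    [seq let '(x1, x2, x3, x4, x5) := b in [seq decode os x | x <- [:: x1; x2; x3; x4; x5]]
    | b <- expand os auts bs ++ bs'].

(** * The base blocks, type by type *)

(* One design for each of the [listed_types], in the same order. *)
Definition designs : seq design := [::
 (48, [:: (1, (48, 0, 48)); (1, (8, 48, 1)); (1, (1, 48, 1))], [::], [:: (0,1,9,11,16);
  (0,3,23,29,54); (0,4,18,31,52); (0,12,24,36,56)], [::]);
 (30, [:: (1, (30, 0, 30)); (1, (30, 30, 30)); (1, (6, 60, 1)); (1, (2, 60, 1)); (1, (1, 60, 1))],
  [::], [:: (0,1,17,22,39); (0,2,37,59,62); (0,3,7,48,64); (0,6,12,18,24); (0,10,42,44,56);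
  (0,11,30,51,66); (0,15,43,58,68); (0,31,50,54,55); (0,33,36,53,65)], [::]);
 (30, [:: (1, (30, 0, 30)); (1, (30, 30, 30)); (2, (6, 60, 1)); (1, (1, 60, 1))], [::],
  [:: (0,1,3,38,63); (0,4,16,31,55); (0,5,13,41,68); (0,6,30,48,56); (0,7,40,59,71);
  (0,9,20,43,61); (0,15,32,47,72); (0,44,46,49,66); (30,31,40,47,63)], [::]);
 (34, [:: (1, (34, 0, 34)); (1, (34, 34, 34)); (4, (2, 68, 1)); (1, (1, 68, 1))], [::],
  [:: (0,1,53,62,73); (0,2,5,15,44); (0,4,12,18,59); (0,7,64,65,70); (0,9,35,54,74);
  (0,11,43,48,69); (0,17,34,51,76); (0,36,49,56,67); (0,38,40,46,50)], [::]);
 (12, [:: (1, (12, 0, 12)); (1, (12, 12, 12)); (1, (12, 24, 12)); (1, (12, 36, 12)); (1, (12, 48,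
  12)); (1, (12, 60, 12)); (1, (12, 72, 1)); (1, (4, 72, 1)); (1, (1, 72, 1))], [:: (6, 1, [:: 66;
  42; 54; 30; 6; 18; 74; 86; 88])], [:: (0,1,27,51,77); (0,2,20,25,66); (0,3,15,47,74);
  (0,4,59,63,72); (0,5,34,39,87)], [:: (0,6,36,42,88); (24,30,60,66,88); (12,18,48,54,88)]);
 (20, [:: (1, (20, 0, 20)); (1, (20, 20, 20)); (1, (20, 40, 20)); (1, (20, 60, 20)); (4, (2, 80,
  1)); (1, (1, 80, 1))], [:: (2, 1, [:: 27; 7; 67; 47; 80; 82; 84; 86; 88])], [:: (0,1,47,73,83);
  (0,2,8,23,62); (0,3,78,79,80); (0,4,31,36,67); (0,7,40,49,77); (0,9,41,54,87); (0,22,43,48,85);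
  (0,26,55,57,64); (0,44,50,65,68); (40,44,48,52,56)], [:: (0,10,20,30,88); (40,50,60,70,88)]);
 (20, [:: (1, (20, 0, 20)); (1, (20, 20, 20)); (1, (20, 40, 20)); (1, (20, 60, 20)); (1, (4, 80,
  1)); (4, (2, 80, 1)); (1, (1, 80, 1))], [:: (4, 1, [:: 70; 10; 30; 50; 82; 86; 84; 91; 88;
  92])], [:: (0,1,24,39,88); (0,2,8,28,73); (0,3,41,54,81); (0,4,34,56,67); (0,9,25,68,84)],
  [:: (0,10,40,50,92); (20,30,60,70,92)]);
 (20, [:: (1, (20, 0, 20)); (1, (20, 20, 20)); (1, (20, 40, 20)); (1, (20, 60, 20)); (3, (4, 80,
  1)); (4, (2, 80, 1)); (5, (1, 80, 1))], [:: (4, 1, [:: 30; 50; 70; 10; 82; 86; 91; 94; 92; 98;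
  96; 100; 102; 103; 104; 101])], [:: (0,1,62,79,81); (0,2,9,55,87); (0,4,8,12,16);
  (0,5,36,77,95); (0,6,32,76,89); (0,20,49,63,99); (0,25,52,67,101)], [:: (0,10,40,50,100);
  (20,30,60,70,100)]);
 (42, [:: (1, (42, 0, 42)); (1, (42, 42, 42)); (10, (2, 84, 1)); (1, (1, 84, 1))],
  [:: (2, 1, [:: 66; 24; 86; 84; 90; 88; 94; 92; 98; 96; 102; 100; 104])], [:: (0,1,58,67,96);
  (0,2,8,28,32); (0,3,55,78,103); (0,5,44,61,88); (0,7,50,79,94); (0,11,49,64,85)],
  [:: (0,21,42,63,104)]);
 (22, [:: (1, (22, 0, 22)); (1, (22, 22, 22)); (1, (22, 44, 22)); (1, (22, 66, 22)); (4, (2, 88,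
  1)); (1, (1, 88, 1))], [:: (2, 1, [:: 43; 21; 87; 65; 89; 91; 93; 95; 96])], [:: (0,1,58,75,88);
  (0,2,5,44,82); (0,4,25,47,49); (0,6,26,34,60); (0,7,48,71,92); (0,9,59,72,90); (0,10,37,67,83);
  (0,30,55,62,81); (0,31,84,87,94); (44,45,49,57,81)], [:: (0,11,22,33,96); (44,55,66,77,96)]);
 (46, [:: (1, (46, 0, 46)); (1, (46, 46, 46)); (8, (2, 92, 1)); (1, (1, 92, 1))],
  [:: (2, 1, [:: 65; 19; 95; 93; 99; 97; 103; 101; 107; 105; 108])], [:: (0,1,57,90,107);
  (0,2,12,18,26); (0,3,71,75,86); (0,5,47,64,98); (0,7,61,80,94); (0,9,60,85,103)],
  [:: (0,23,46,69,108)]);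
 (24, [:: (1, (24, 0, 24)); (1, (24, 24, 24)); (1, (24, 48, 24)); (1, (24, 72, 24)); (1, (24, 96,
  1)); (1, (1, 96, 1))], [:: (4, 1, [:: 45; 69; 93; 21; 117; 120])], [:: (0,1,14,58,73);
  (0,2,17,95,114); (0,3,49,80,111); (0,4,38,79,99); (0,5,61,90,107); (0,6,32,74,106);
  (0,8,44,53,101)], [:: (0,12,48,60,120); (24,36,72,84,120)]);
 (20, [:: (1, (20, 0, 20)); (1, (20, 20, 20)); (1, (20, 40, 20)); (1, (20, 60, 20)); (1, (20, 80,
  20)); (2, (4, 100, 1)); (1, (1, 100, 1))], [:: (5, 1, [:: 23; 43; 63; 83; 3; 103; 107; 108])],
  [:: (0,1,4,28,63); (0,2,37,50,56); (0,5,10,15,108); (0,7,53,78,106); (0,8,26,69,99);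
  (0,9,23,98,103)], [:: (0,20,40,60,80); (0,32,44,76,88); (0,36,52,68,84)]);
 (50, [:: (1, (50, 0, 50)); (1, (50, 50, 50)); (6, (2, 100, 1)); (1, (1, 100, 1))],
  [:: (2, 1, [:: 58; 8; 102; 100; 106; 104; 110; 108; 112])], [:: (0,1,55,88,101); (0,2,44,80,92);
  (0,3,13,32,39); (0,4,20,69,97); (0,5,61,84,110); (0,9,76,91,107)], [:: (0,25,50,75,112)]);
 (10, [:: (1, (10, 0, 10)); (1, (10, 10, 10)); (1, (10, 20, 10)); (1, (10, 30, 10)); (1, (10, 40,
  10)); (1, (10, 50, 10)); (1, (10, 60, 10)); (1, (10, 70, 10)); (1, (10, 80, 10)); (1, (10, 90,
  10)); (12, (2, 100, 1)); (1, (1, 100, 1))], [:: (10, 1, [:: 71; 81; 91; 51; 61; 21; 31; 41; 1;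
  11; 103; 101; 107; 105; 111; 109; 115; 113; 119; 117; 123; 121; 124])], [:: (0,1,74,97,121);
  (0,2,4,6,8); (0,3,61,72,113); (0,13,65,70,107); (0,17,51,84,101); (0,19,62,91,116);
  (0,25,54,85,108)], [:: (0,5,50,55,124); (20,25,70,75,124); (40,45,90,95,124); (10,15,60,65,124);
  (30,35,80,85,124); (0,10,20,30,40); (50,60,70,80,90); (0,12,24,36,48); (50,62,74,86,98);
  (0,14,28,32,46); (50,64,78,82,96); (0,16,22,38,44); (50,66,72,88,94); (0,18,26,34,42);
  (50,68,76,84,92)]);
 (52, [:: (1, (52, 0, 52)); (1, (52, 52, 52)); (5, (4, 104, 1)); (1, (1, 104, 1))],
  [:: (2, 1, [:: 80; 28; 106; 110; 114; 118; 122; 124])], [:: (0,1,18,57,117); (0,2,7,83,114);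
  (0,3,25,96,120); (0,4,12,36,66); (0,6,19,59,111); (0,9,23,58,95); (0,10,21,89,106)],
  [:: (0,26,52,78,124)]);
 (54, [:: (1, (54, 0, 54)); (1, (54, 54, 54)); (4, (2, 108, 1)); (1, (1, 108, 1))],
  [:: (2, 1, [:: 84; 30; 110; 108; 114; 112; 116])], [:: (0,1,3,42,91); (0,4,24,32,65);
  (0,5,11,21,63); (0,7,55,84,115); (0,9,73,92,109); (0,14,37,76,94)], [:: (0,27,54,81,116)]);
 (54, [:: (1, (54, 0, 54)); (1, (54, 54, 54)); (4, (6, 108, 1)); (2, (2, 108, 1)); (1, (1, 108,
  1))], [:: (2, 1, [:: 84; 30; 114; 108; 126; 120; 134; 132; 136])], [:: (0,1,51,100,120);
  (0,2,67,75,124); (0,5,15,31,117); (0,6,36,58,70); (0,7,40,91,110); (0,9,34,94,111);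
  (0,11,66,83,135); (0,13,35,82,131)], [:: (0,27,54,81,136)]);
 (28, [:: (1, (28, 0, 28)); (1, (28, 28, 28)); (1, (28, 56, 28)); (1, (28, 84, 28)); (2, (4, 112,
  1)); (2, (2, 112, 1)); (5, (1, 112, 1))], [:: (4, 1, [:: 95; 11; 39; 67; 115; 116; 123; 121;
  124; 128; 125; 126; 127])], [:: (0,1,45,90,122); (0,2,12,31,42); (0,3,22,49,115);
  (0,4,39,59,64); (0,7,72,104,117); (0,8,34,58,71); (0,28,61,102,127)], [:: (0,14,56,70,124);
  (28,42,84,98,124)]);
 (124, [:: (1, (124, 0, 124)); (5, (4, 124, 1)); (1, (1, 124, 1))], [::], [:: (0,1,20,61,67);
  (0,2,17,39,137); (0,3,78,89,124); (0,4,76,84,112); (0,5,30,59,141); (0,7,97,110,131);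
  (0,9,33,51,101); (0,10,53,79,133); (0,31,62,93,144)], [::]);
 (64, [:: (1, (64, 0, 64)); (1, (64, 64, 64)); (2, (4, 128, 1)); (1, (1, 128, 1))],
  [:: (2, 1, [:: 83; 19; 131; 135; 136])], [:: (0,1,10,35,132); (0,2,23,117,129); (0,3,73,85,100);
  (0,4,42,50,113); (0,5,16,66,106); (0,6,13,93,124); (0,17,45,69,89)], [:: (0,32,64,96,136)]);
 (4, [:: (1, (4, 0, 4)); (1, (4, 4, 4)); (1, (4, 8, 4)); (1, (4, 12, 4)); (1, (4, 16, 4)); (1, (4,
  20, 4)); (1, (4, 24, 4)); (1, (4, 28, 4)); (1, (4, 32, 4)); (1, (4, 36, 4)); (1, (4, 40, 4));
  (1, (4, 44, 4)); (1, (4, 48, 4)); (1, (4, 52, 4)); (1, (4, 56, 4)); (1, (4, 60, 4)); (1, (4, 64,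
  4)); (1, (4, 68, 4)); (1, (4, 72, 4)); (1, (4, 76, 4)); (1, (4, 80, 4)); (1, (4, 84, 4)); (1,
  (4, 88, 4)); (1, (4, 92, 4)); (1, (4, 96, 4)); (1, (4, 100, 4)); (1, (4, 104, 4)); (1, (4, 108,
  4)); (1, (4, 112, 4)); (1, (4, 116, 4)); (1, (4, 120, 4)); (1, (4, 124, 4)); (2, (4, 128, 1));
  (10, (2, 128, 1)); (1, (1, 128, 1))], [:: (4, 1, [:: 17; 21; 25; 29; 33; 37; 41; 45; 49; 53; 57;
  61; 1; 5; 9; 13; 81; 85; 89; 93; 97; 101; 105; 109; 113; 117; 121; 125; 65; 69; 73; 77; 129;
  134; 139; 136; 143; 141; 144; 146; 151; 149; 155; 153; 156]); (2, 1, [:: 58; 62; 50; 54; 10; 14;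
  2; 6; 26; 30; 18; 22; 42; 46; 34; 38; 122; 126; 114; 118; 74; 78; 66; 70; 90; 94; 82; 86; 106;
  110; 98; 102; 130; 135; 138; 137; 142; 140; 147; 145; 151; 149; 154; 152; 156]); (2, 1, [:: 38;
  34; 46; 42; 54; 50; 62; 58; 6; 2; 14; 10; 22; 18; 30; 26; 102; 98; 110; 106; 118; 114; 126; 122;
  70; 66; 78; 74; 86; 82; 94; 90; 128; 132; 136; 138; 142; 140; 144; 146; 149; 151; 152; 154;
  156])], [:: (0,1,48,73,113); (0,5,75,98,145); (0,9,23,124,154); (0,13,56,84,137);
  (0,18,59,81,130); (0,19,102,115,140); (0,20,47,88,121); (0,22,66,126,151); (0,26,63,69,94);
  (0,28,35,70,135); (0,64,77,82,125); (0,71,83,118,152); (0,74,92,93,139); (0,80,107,110,133);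
  (0,85,100,111,129)], [:: (0,2,12,14,150); (16,18,28,30,148); (32,34,44,46,150);
  (48,50,60,62,148); (52,54,56,58,149); (4,6,8,10,151); (20,22,24,26,149); (36,38,40,42,151);
  (0,4,34,38,147); (16,20,50,54,146); (24,28,58,62,144); (8,12,42,46,145); (0,6,42,44,156);
  (16,22,58,60,156); (8,14,34,36,156); (24,30,50,52,156); (0,8,32,40,141); (16,24,48,56,143);
  (4,12,36,44,143); (20,28,52,60,141); (0,10,114,120,142); (16,26,66,72,140); (32,42,82,88,142);
  (48,58,98,104,140); (36,46,86,92,140); (52,62,102,108,142); (4,14,118,124,140);
  (20,30,70,76,142); (0,36,95,123,146); (16,52,75,111,147); (4,32,91,127,146); (20,48,79,107,147);
  (28,56,71,99,145); (8,44,87,115,144); (24,60,67,103,145); (12,40,83,119,144); (0,46,79,97,149);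
  (16,62,95,113,151); (12,34,67,109,149); (28,50,83,125,151); (20,58,91,117,150);
  (8,38,71,105,148); (24,54,87,121,150); (4,42,75,101,148); (64,66,68,70,147); (80,82,84,86,146);
  (96,98,100,102,147); (112,114,116,118,146); (120,122,124,126,144); (72,74,76,78,145);
  (88,90,92,94,144); (104,106,108,110,145); (64,72,98,106,141); (80,88,114,122,143);
  (68,76,102,110,143); (84,92,118,126,141); (64,76,96,108,150); (80,92,112,124,148);
  (84,88,116,120,149); (68,72,100,104,151); (64,78,102,104,156); (80,94,118,120,156);
  (68,74,98,108,156); (84,90,114,124,156)]);
 (66, [:: (1, (66, 0, 66)); (1, (66, 66, 66)); (8, (2, 132, 1)); (1, (1, 132, 1))],
  [:: (2, 1, [:: 90; 24; 134; 132; 138; 136; 142; 140; 146; 144; 148])], [:: (0,1,91,96,136);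
  (0,2,16,27,46); (0,3,9,54,67); (0,4,81,105,113); (0,7,82,111,143); (0,10,28,88,128);
  (0,13,76,125,135); (0,23,84,115,147)], [:: (0,33,66,99,148)]);
 (132, [:: (1, (132, 0, 132)); (1, (33, 132, 1)); (1, (4, 132, 1))], [::], [:: (0,1,68,83,154);
  (0,2,104,110,133); (0,3,7,91,132); (0,5,18,47,148); (0,8,46,106,149); (0,9,45,116,135);
  (0,10,21,79,168); (0,12,35,55,92); (0,14,76,115,160); (0,19,51,78,157); (0,33,66,99,147)], [::]);
 (68, [:: (1, (68, 0, 68)); (1, (68, 68, 68)); (6, (4, 136, 1)); (1, (1, 136, 1))],
  [:: (2, 1, [:: 70; 2; 138; 142; 146; 150; 154; 158; 160])], [:: (0,1,24,37,72);
  (0,2,61,115,145); (0,3,53,134,158); (0,4,56,83,112); (0,5,11,98,153); (0,8,22,48,84);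
  (0,10,43,85,151); (0,17,38,107,139); (0,19,78,105,141)], [:: (0,34,68,102,160)]);
 (72, [:: (1, (72, 0, 72)); (1, (72, 72, 72)); (5, (4, 144, 1)); (1, (1, 144, 1))],
  [:: (2, 1, [:: 112; 40; 146; 150; 154; 158; 162; 164])], [:: (0,1,112,129,161); (0,2,9,133,148);
  (0,3,18,49,154); (0,4,29,75,80); (0,6,56,101,109); (0,10,45,89,159); (0,11,39,53,77);
  (0,12,32,86,134); (0,13,51,132,144)], [:: (0,36,72,108,164)]);
 (144, [:: (1, (144, 0, 144)); (3, (12, 144, 1)); (1, (4, 144, 1)); (1, (1, 144, 1))], [::],
  [:: (0,1,64,126,157); (0,2,46,78,168); (0,3,12,27,60); (0,4,42,71,145); (0,5,22,30,148);
  (0,6,41,130,169); (0,7,50,90,179); (0,10,59,128,160); (0,11,97,110,182); (0,21,52,91,144);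
  (0,23,51,88,158); (0,36,72,108,184)], [::]);
 (74, [:: (1, (74, 0, 74)); (1, (74, 74, 74)); (14, (2, 148, 1)); (1, (1, 148, 1))],
  [:: (2, 1, [:: 120; 46; 150; 148; 154; 152; 158; 156; 162; 160; 166; 164; 170; 168; 174; 172;
  176])], [:: (0,1,77,118,171); (0,2,26,60,122); (0,3,81,140,167); (0,4,21,46,68);
  (0,5,98,133,151); (0,7,91,114,172); (0,8,20,38,147); (0,9,106,119,162); (0,11,80,99,158);
  (0,29,87,130,152)], [:: (0,37,74,111,176)]);
 (152, [:: (1, (152, 0, 152)); (4, (4, 152, 1)); (1, (1, 152, 1))], [::], [:: (0,1,15,62,165);
  (0,2,37,135,161); (0,3,9,66,156); (0,4,16,97,120); (0,5,51,123,130); (0,8,53,78,111);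
  (0,10,50,110,134); (0,11,67,88,132); (0,13,39,122,153); (0,38,76,114,168)], [::]);
 (38, [:: (1, (38, 0, 38)); (1, (38, 38, 38)); (1, (38, 76, 38)); (1, (38, 114, 38)); (1, (19,
  152, 1)); (18, (1, 152, 1))], [:: (3, 7, [:: 13; 51; 89; 127; 165; 173; 171; 172; 176; 174; 175;
  179; 177; 178; 182; 180; 181; 185; 183; 184; 188; 186; 187])], [:: (0,1,18,119,156);
  (0,9,51,97,162); (0,39,100,145,187); (0,40,111,148,178); (0,43,107,117,170); (0,46,86,121,174);
  (0,47,82,126,183); (0,54,90,144,171); (0,65,99,128,182); (38,39,54,121,156); (38,77,91,104,164);
  (76,116,137,144,165)], [:: (0,2,24,72,91); (0,4,10,68,106); (0,19,76,95,152); (0,38,41,59,71);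
  (0,57,130,138,150); (0,77,83,87,133); (0,114,127,129,143); (38,42,70,107,126);
  (38,57,114,133,152); (76,79,84,96,117)]);
 (78, [:: (1, (78, 0, 78)); (1, (78, 78, 78)); (12, (2, 156, 1)); (1, (1, 156, 1))],
  [:: (2, 1, [:: 138; 60; 158; 156; 162; 160; 166; 164; 170; 168; 174; 172; 178; 176; 180])],
  [:: (0,1,21,25,37); (0,2,28,72,88); (0,3,95,114,158); (0,5,105,132,165); (0,7,82,151,173);
  (0,10,48,103,125); (0,11,91,108,169); (0,13,46,60,98); (0,15,99,128,176); (0,23,110,145,160)],
  [:: (0,39,78,117,180)]);
 (78, [:: (1, (78, 0, 78)); (1, (78, 78, 78)); (6, (6, 156, 1)); (4, (2, 156, 1)); (1, (1, 156,
  1))], [:: (2, 1, [:: 118; 40; 166; 160; 178; 172; 190; 184; 194; 192; 198; 196; 200])],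
  [:: (0,1,63,131,175); (0,2,36,48,54); (0,3,129,148,198); (0,4,11,96,167); (0,5,127,141,176);
  (0,8,87,118,156); (0,9,132,153,194); (0,10,45,125,188); (0,13,38,95,159); (0,17,37,137,185);
  (0,22,84,113,187); (0,23,51,106,171)], [:: (0,39,78,117,200)]);
 (160, [:: (1, (160, 0, 160)); (8, (4, 160, 1)); (1, (1, 160, 1))], [::], [:: (0,1,91,114,170);
  (0,2,33,111,163); (0,3,21,58,166); (0,4,16,92,116); (0,5,43,146,191); (0,6,15,101,185);
  (0,7,29,106,173); (0,8,28,64,81); (0,10,35,62,128); (0,11,45,130,176); (0,13,39,110,182);
  (0,40,80,120,192)], [::]);
 (82, [:: (1, (82, 0, 82)); (1, (82, 82, 82)); (10, (2, 164, 1)); (1, (1, 164, 1))],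
  [:: (2, 1, [:: 156; 74; 166; 164; 170; 168; 174; 172; 178; 176; 182; 180; 184])],
  [:: (0,1,21,32,141); (0,2,45,87,97); (0,3,92,121,174); (0,4,18,40,74); (0,5,93,152,167);
  (0,6,25,58,86); (0,7,90,145,183); (0,9,100,116,144); (0,13,117,132,179); (0,17,113,148,170)],
  [:: (0,41,82,123,184)]);
 (82, [:: (1, (82, 0, 82)); (1, (82, 82, 82)); (20, (2, 164, 1)); (1, (1, 164, 1))],
  [:: (5, 59, [:: 80; 162; 172; 164; 166; 168; 170; 182; 174; 176; 178; 180; 192; 184; 186; 188;
  190; 202; 194; 196; 198; 200; 204])], [:: (0,1,103,112,176); (0,3,109,122,189);
  (0,5,93,120,195); (0,15,113,144,166)], [:: (0,2,30,38,50); (0,4,10,26,68); (0,41,82,123,204);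
  (82,84,116,128,136); (82,86,100,142,158)]);
 (168, [:: (1, (168, 0, 168)); (7, (4, 168, 1)); (1, (1, 168, 1))], [::], [:: (0,1,90,151,181);
  (0,2,69,131,194); (0,3,94,141,185); (0,4,48,63,160); (0,5,24,40,132); (0,6,32,81,145);
  (0,7,53,118,176); (0,9,95,146,189); (0,10,21,135,172); (0,13,58,83,171); (0,14,34,102,130);
  (0,42,84,126,196)], [::]);
 (84, [:: (1, (84, 0, 84)); (1, (84, 84, 84)); (2, (14, 168, 1)); (5, (4, 168, 1)); (1, (1, 168,
  1))], [:: (2, 1, [:: 131; 47; 187; 173; 199; 203; 207; 211; 215; 216])], [:: (0,1,15,154,212);
  (0,2,10,135,185); (0,3,61,166,202); (0,4,31,85,141); (0,5,35,72,179); (0,6,40,164,190);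
  (0,7,20,152,194); (0,9,38,159,204); (0,11,62,129,198); (0,16,59,162,173); (0,18,63,109,211);
  (0,19,95,155,169); (0,32,104,140,195)], [:: (0,42,84,126,216)]);
 (86, [:: (1, (86, 0, 86)); (1, (86, 86, 86)); (8, (2, 172, 1)); (1, (1, 172, 1))],
  [:: (2, 1, [:: 169; 83; 175; 173; 179; 177; 183; 181; 187; 185; 188])], [:: (0,1,15,23,52);
  (0,2,48,93,125); (0,3,76,80,90); (0,5,109,156,179); (0,7,113,141,157); (0,11,94,155,181);
  (0,12,30,128,148); (0,17,36,62,97); (0,21,120,153,172); (0,27,115,146,187)],
  [:: (0,43,86,129,188)]);
 (176, [:: (1, (176, 0, 176)); (6, (4, 176, 1)); (1, (1, 176, 1))], [::], [:: (0,1,33,107,163);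
  (0,2,19,29,185); (0,3,28,43,115); (0,4,51,101,131); (0,5,90,155,197); (0,6,37,99,189);
  (0,7,78,117,178); (0,8,24,116,164); (0,9,63,118,192); (0,11,34,52,134); (0,22,103,141,181);
  (0,44,88,132,200)], [::]);
 (88, [:: (1, (88, 0, 88)); (1, (88, 88, 88)); (3, (4, 176, 1)); (16, (2, 176, 1)); (1, (1, 176,
  1))], [:: (2, 1, [:: 122; 34; 178; 182; 186; 190; 188; 194; 192; 198; 196; 202; 200; 206; 204;
  210; 208; 214; 212; 218; 216; 220])], [:: (0,1,114,147,208); (0,2,20,26,80); (0,3,104,175,196);
  (0,4,16,56,112); (0,5,66,139,184); (0,7,97,128,194); (0,9,111,158,205); (0,11,116,165,200);
  (0,13,140,155,191); (0,14,35,65,178); (0,19,95,138,212); (0,25,107,166,217);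
  (0,38,129,171,182)], [:: (0,44,88,132,220)]);
 (184, [:: (1, (184, 0, 184)); (5, (4, 184, 1)); (1, (1, 184, 1))], [::], [:: (0,1,105,125,173);
  (0,2,96,148,180); (0,3,56,64,114); (0,5,82,103,113); (0,7,25,49,168); (0,9,43,78,193);
  (0,13,75,158,184); (0,14,29,51,200); (0,17,57,112,156); (0,19,110,137,191); (0,30,63,117,197);
  (0,46,92,138,204)], [::]);
 (184, [:: (1, (184, 0, 184)); (10, (4, 184, 1)); (1, (1, 184, 1))], [::], [:: (0,1,102,135,193);
  (0,2,107,111,130); (0,3,74,173,217); (0,5,31,174,202); (0,6,63,97,189); (0,7,125,162,197);
  (0,8,60,156,168); (0,9,27,62,214); (0,13,58,119,220); (0,17,55,98,186); (0,20,64,104,136);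
  (0,21,51,90,206); (0,25,67,114,209); (0,46,92,138,224)], [::]);
 (188, [:: (1, (188, 0, 188)); (7, (4, 188, 1)); (1, (1, 188, 1))], [::], [:: (0,1,61,173,184);
  (0,2,33,111,201); (0,3,58,121,211); (0,6,28,36,132); (0,7,46,89,196); (0,9,23,170,191);
  (0,10,35,83,107); (0,12,44,64,98); (0,13,66,151,215); (0,17,38,131,193); (0,19,68,119,148);
  (0,26,71,113,207); (0,47,94,141,216)], [::]);
 (192, [:: (1, (192, 0, 192)); (4, (4, 192, 1)); (1, (1, 192, 1))], [::], [:: (0,1,78,130,164);
  (0,2,15,19,70); (0,3,150,185,196); (0,5,54,87,207); (0,6,97,171,201); (0,8,47,79,88);
  (0,11,31,57,69); (0,14,81,99,193); (0,16,60,100,136); (0,22,65,131,155); (0,23,73,98,162);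
  (0,48,96,144,208)], [::]);
 (192, [:: (1, (192, 0, 192)); (9, (4, 192, 1)); (1, (1, 192, 1))], [::], [:: (0,1,108,120,184);
  (0,2,20,114,158); (0,3,14,77,204); (0,4,32,136,173); (0,5,22,167,225); (0,6,81,127,223);
  (0,7,66,161,213); (0,10,99,157,201); (0,13,52,68,92); (0,15,82,165,194); (0,21,50,91,196);
  (0,26,87,149,211); (0,33,86,135,217); (0,48,96,144,228)], [::]);
 (12, [:: (1, (12, 0, 12)); (1, (12, 12, 12)); (1, (12, 24, 12)); (1, (12, 36, 12)); (1, (12, 48,
  12)); (1, (12, 60, 12)); (1, (12, 72, 12)); (1, (12, 84, 12)); (1, (12, 96, 12)); (1, (12, 108,
  12)); (1, (12, 120, 12)); (1, (12, 132, 12)); (1, (12, 144, 12)); (1, (12, 156, 12)); (1, (12,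
  168, 12)); (1, (12, 180, 12)); (6, (6, 192, 1)); (4, (3, 192, 1)); (2, (2, 192, 1)); (5, (1,
  192, 1))], [:: (4, 1, [:: 49; 61; 73; 85; 97; 109; 121; 133; 145; 157; 169; 181; 1; 13; 25; 37;
  202; 196; 205; 211; 223; 217; 235; 238; 229; 232; 243; 241; 244; 245; 246; 247; 248]);
  (2, 1, [:: 179; 191; 155; 167; 35; 47; 11; 23; 83; 95; 59; 71; 131; 143; 107; 119; 203; 197;
  212; 206; 227; 221; 230; 233; 236; 239; 243; 241; 244; 245; 246; 247; 248]); (2, 1, [:: 85; 73;
  61; 49; 133; 121; 109; 97; 181; 169; 157; 145; 37; 25; 13; 1; 193; 199; 208; 214; 223; 217; 232;
  229; 238; 235; 243; 241; 244; 245; 246; 247; 248])], [:: (0,1,63,92,234); (0,2,82,152,192);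
  (0,3,86,183,224); (0,4,23,53,164); (0,5,78,187,210); (0,14,34,176,232); (0,15,60,149,223);
  (0,16,140,169,198); (0,25,116,123,235); (0,27,58,171,242); (0,28,110,121,213);
  (0,38,75,175,214); (0,39,74,159,222); (0,56,141,145,195)], [:: (0,6,96,102,248);
  (48,54,144,150,248); (72,78,168,174,248); (24,30,120,126,248); (84,90,180,186,248);
  (36,42,132,138,248); (12,18,108,114,248); (60,66,156,162,248); (0,12,24,36,245);
  (48,60,72,84,245); (96,108,120,132,245); (144,156,168,180,245); (0,18,120,138,247);
  (48,66,168,186,247); (24,42,96,114,247); (72,90,144,162,247); (0,30,114,132,246);
  (48,78,162,180,246); (12,42,102,120,246); (60,90,150,168,246); (0,42,108,126,244);
  (48,90,156,174,244); (12,30,96,138,244); (60,78,144,186,244)]);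
 (98, [:: (1, (98, 0, 98)); (1, (98, 98, 98)); (12, (2, 196, 1)); (1, (1, 196, 1))],
  [:: (3, 79, [:: 8; 106; 198; 200; 196; 204; 206; 202; 210; 212; 208; 216; 218; 214; 220])],
  [:: (0,1,105,178,196); (0,2,29,44,68); (0,3,119,152,210); (0,4,124,130,172); (0,6,101,141,173);
  (0,7,160,171,207); (0,11,117,122,216); (0,100,121,123,190)], [:: (0,49,98,147,220)]);
 (7, [:: (1, (7, 0, 7)); (1, (7, 7, 7)); (1, (7, 14, 7)); (1, (7, 21, 7)); (1, (7, 28, 7)); (1,
  (7, 35, 7)); (1, (7, 42, 7)); (1, (7, 49, 7)); (1, (7, 56, 7)); (1, (7, 63, 7)); (1, (7, 70,
  7)); (1, (7, 77, 7)); (1, (7, 84, 7)); (1, (7, 91, 7)); (1, (7, 98, 7)); (1, (7, 105, 7)); (1,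
  (7, 112, 7)); (1, (7, 119, 7)); (1, (7, 126, 7)); (1, (7, 133, 7)); (1, (7, 140, 7)); (1, (7,
  147, 7)); (1, (7, 154, 7)); (1, (7, 161, 7)); (1, (7, 168, 7)); (1, (7, 175, 7)); (1, (7, 182,
  7)); (1, (7, 189, 7)); (3, (7, 196, 1)); (24, (1, 196, 1))], [:: (7, 1, [:: 44; 2; 9; 16; 23;
  30; 37; 93; 51; 58; 65; 72; 79; 86; 142; 100; 107; 114; 121; 128; 135; 191; 149; 156; 163; 170;
  177; 184; 198; 205; 212; 217; 218; 219; 220; 221; 222; 223; 224; 225; 226; 227; 228; 229; 230;
  231; 232; 233; 234; 235; 236; 237; 238; 239; 240])], [:: (0,1,29,115,158); (0,2,99,143,211);
  (0,3,55,174,200); (0,7,17,50,124); (0,8,83,146,205); (0,9,15,156,203); (0,11,23,60,210);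
  (0,12,108,164,212); (0,14,40,76,186); (0,18,36,134,196); (0,22,88,96,207); (0,24,184,187,201);
  (0,51,63,84,185); (0,53,127,154,233); (0,54,133,161,226); (0,56,122,189,227);
  (0,57,102,149,235); (0,58,128,148,219); (0,59,101,188,225); (0,61,136,173,224);
  (0,64,110,160,239); (0,65,109,193,217); (0,67,139,194,229); (0,68,121,150,240);
  (0,69,72,79,166); (0,70,126,181,228); (0,71,132,182,222); (0,73,119,179,221);
  (0,77,106,177,234); (0,78,137,183,218); (0,80,116,144,145); (0,81,142,155,236);
  (0,82,125,195,223); (0,87,118,170,231); (0,90,105,130,140); (0,91,100,152,220);
  (0,93,120,151,237); (0,94,113,180,230); (0,95,112,191,232); (0,97,129,165,238);
  (0,111,162,176,192); (0,131,168,169,175); (49,50,83,181,216); (49,51,128,138,202);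
  (49,52,63,104,172); (49,58,64,99,199); (49,60,73,78,208); (49,75,174,189,212);
  (49,98,100,116,196); (49,103,111,118,193); (49,125,165,186,191); (49,151,164,175,211);
  (98,101,107,120,214); (98,109,121,163,209); (98,122,161,188,204); (98,147,162,179,203);
  (147,149,158,195,197)], [::]);
 (4, [:: (2, (4, 0, 4)); (2, (4, 4, 4)); (2, (4, 8, 4)); (2, (4, 12, 4)); (2, (4, 16, 4)); (2, (4,
  20, 4)); (2, (4, 24, 4)); (2, (4, 28, 4)); (1, (4, 32, 1)); (5, (2, 32, 1))], [:: (4, 1, [:: 19;
  23; 27; 31; 10; 14; 0; 4; 51; 55; 59; 63; 42; 46; 32; 36; 64; 69; 71; 73; 75; 77]);
  (2, 1, [:: 14; 10; 4; 0; 30; 26; 20; 16; 46; 42; 36; 32; 62; 58; 52; 48; 67; 69; 71; 73; 75;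
  77])], [:: (0,1,28,48,64); (0,2,45,47,69); (0,5,41,55,77); (0,8,19,29,53); (0,17,32,33,72);
  (0,36,40,52,60); (0,39,56,61,65)], [:: (0,6,35,37,71); (16,22,51,53,71); (8,14,43,45,70);
  (24,30,59,61,70); (0,9,34,43,74); (16,25,50,59,74); (4,13,38,47,74); (20,29,54,63,74);
  (0,11,16,27,68); (4,15,20,31,68); (0,13,49,62,70); (16,29,39,40,70); (4,9,53,58,70);
  (20,25,35,44,70); (0,15,54,57,75); (16,31,34,45,75); (4,11,50,61,75); (20,27,38,41,75);
  (32,43,50,57,68); (36,47,54,61,68)]);
 (40, [:: (1, (40, 0, 20)); (1, (40, 20, 20)); (3, (2, 40, 1))], [::], [:: (0,1,44,63,82);
  (0,2,5,16,73); (0,4,25,70,76); (0,6,33,41,52); (0,8,18,42,58); (0,9,56,69,85); (0,12,61,65,79);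
  (0,17,54,55,80); (40,42,65,70,73)], [::]);
 (24, [:: (1, (24, 0, 12)); (1, (24, 12, 12)); (1, (24, 24, 12)); (1, (24, 36, 12)); (1, (12, 48,
  1)); (2, (2, 48, 1)); (2, (1, 48, 1))], [:: (4, 1, [:: 39; 63; 87; 15; 102; 111; 109; 112;
  113])], [:: (0,1,33,36,92); (0,2,25,83,96); (0,4,15,70,80); (0,5,26,43,111); (0,6,16,69,105);
  (0,27,68,74,97)], [:: (0,24,48,72,112); (0,42,60,78,113)]);
 (52, [:: (1, (52, 0, 26)); (1, (52, 26, 26)); (7, (2, 52, 1))], [::], [:: (0,1,59,80,117);
  (0,2,62,96,102); (0,3,20,27,33); (0,4,40,77,85); (0,5,52,95,105); (0,8,18,64,86);
  (0,9,84,91,110); (0,11,65,66,115); (0,14,63,67,83); (0,15,76,87,107); (0,21,57,92,108);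
  (0,23,74,93,113); (52,54,77,91,101)], [::]);
 (28, [:: (2, (28, 0, 28)); (2, (28, 28, 28)); (2, (4, 56, 1)); (2, (1, 56, 1))],
  [:: (4, 1, [:: 107; 79; 9; 37; 112; 116; 120; 121])], [:: (0,1,40,59,108); (0,2,89,93,101);
  (0,3,13,51,85); (0,5,11,37,71); (0,7,14,21,120); (0,9,50,106,119); (0,29,78,109,112)],
  [:: (0,42,70,84,121)]);
 (60, [:: (1, (60, 0, 30)); (1, (60, 30, 30)); (3, (2, 60, 1))], [::], [:: (0,1,37,69,108);
  (0,2,28,42,84); (0,3,52,89,96); (0,4,10,31,48); (0,5,78,81,122); (0,7,77,90,124);
  (0,9,61,88,120); (0,13,66,67,118); (0,15,64,87,106); (0,19,62,74,117); (0,25,75,85,119);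
  (0,63,95,99,101); (0,65,80,100,111)], [::]);
 (30, [:: (1, (30, 0, 10)); (1, (30, 10, 10)); (1, (10, 20, 1)); (1, (1, 20, 1))], [::],
  [:: (0,1,9,32,57); (0,2,25,41,61); (0,3,19,33,67); (0,4,38,47,49); (0,6,12,18,24);
  (0,13,42,50,65); (0,15,40,55,70); (0,35,36,52,63); (0,51,54,58,60); (30,36,42,48,54)], [::]);
 (42, [:: (1, (42, 0, 14)); (1, (42, 14, 14)); (3, (2, 28, 1)); (1, (1, 28, 1))], [::],
  [:: (0,1,9,19,80); (0,2,7,62,70); (0,3,25,59,75); (0,4,30,53,82); (0,6,45,47,64);
  (0,11,42,43,85); (0,13,48,57,86); (0,15,66,69,88); (0,21,46,67,90); (42,46,52,57,64)], [::]);
 (24, [:: (1, (24, 0, 8)); (1, (24, 8, 8)); (1, (24, 16, 8)); (1, (24, 24, 8)); (5, (2, 32, 1));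
  (1, (1, 32, 1))], [:: (2, 1, [:: 37; 13; 85; 61; 96; 98; 100; 102; 104; 106])],
  [:: (0,1,30,88,90); (0,2,20,41,69); (0,3,26,35,73); (0,5,70,80,97); (0,7,55,85,103);
  (0,10,54,77,81); (0,11,61,64,101); (0,28,79,84,99); (0,34,86,93,104); (0,57,66,74,92);
  (0,63,72,82,83)], [:: (0,12,24,36,106); (48,60,72,84,106)]);
 (6, [:: (3, (6, 0, 6)); (3, (6, 6, 6)); (3, (6, 12, 6)); (3, (6, 18, 6)); (3, (6, 24, 6)); (3,
  (6, 30, 6)); (7, (2, 36, 1)); (1, (1, 36, 1))], [:: (3, 1, [:: 12; 0; 6; 30; 18; 24; 48; 36; 42;
  66; 54; 60; 84; 72; 78; 102; 90; 96; 108; 110; 112; 114; 116; 118; 120; 122]); (3, 1, [:: 52;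
  40; 46; 16; 4; 10; 34; 22; 28; 106; 94; 100; 70; 58; 64; 88; 76; 82; 108; 110; 112; 114; 116;
  118; 120; 122])], [:: (0,1,43,74,96); (0,2,68,84,102); (0,3,67,70,122); (0,7,29,33,37);
  (0,8,18,69,83); (0,9,99,100,117); (0,11,62,89,109); (0,19,95,104,119); (0,20,63,72,80);
  (0,21,79,92,110); (0,25,54,93,112); (0,27,71,82,121); (0,31,87,94,115); (54,56,61,80,84)], [::]);
 (120, [:: (1, (120, 0, 24)); (3, (8, 24, 1)); (1, (1, 24, 1))], [::], [:: (0,1,27,39,133);
  (0,2,65,78,129); (0,3,52,98,138); (0,4,19,66,125); (0,5,33,40,56); (0,6,20,37,124);
  (0,8,18,29,61); (0,9,50,84,141); (0,30,60,90,144)], [::]);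
 (140, [:: (1, (140, 0, 28)); (6, (4, 28, 1)); (1, (1, 28, 1))], [::], [:: (0,1,51,78,160);
  (0,2,67,121,147); (0,3,18,26,55); (0,4,44,76,124); (0,5,14,39,158); (0,6,17,104,116);
  (0,7,66,109,149); (0,10,71,93,153); (0,13,58,107,143); (0,35,70,105,164)], [::]);
 (160, [:: (1, (160, 0, 32)); (6, (4, 32, 1)); (1, (1, 32, 1))], [::], [:: (0,1,31,70,183);
  (0,2,10,78,126); (0,3,25,86,160); (0,4,16,33,104); (0,5,50,113,137); (0,6,26,107,145);
  (0,7,49,62,164); (0,9,67,142,174); (0,11,46,65,177); (0,14,57,123,168); (0,40,80,120,184)],
  [::]);
 (40, [:: (1, (40, 0, 8)); (1, (40, 8, 8)); (1, (40, 16, 8)); (1, (40, 24, 8)); (2, (20, 32, 1));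
  (2, (2, 32, 1)); (1, (1, 32, 1))], [:: (4, 1, [:: 155; 35; 75; 115; 195; 175; 203; 201; 204])],
  [:: (0,1,14,42,192); (0,2,128,157,197); (0,3,7,93,178); (0,5,59,84,103); (0,6,111,120,168);
  (0,9,62,79,200); (0,10,77,106,193); (0,12,50,125,179); (0,15,83,139,185); (0,18,51,152,172);
  (0,52,112,143,196); (0,55,118,142,161)], [:: (0,20,80,100,204); (40,60,120,140,204)]);
 (30, [:: (1, (30, 0, 6)); (1, (30, 6, 6)); (1, (30, 12, 6)); (1, (30, 18, 6)); (1, (30, 24, 6));
  (1, (30, 30, 6)); (22, (2, 36, 1)); (1, (1, 36, 1))], [:: (6, 1, [:: 127; 157; 97; 37; 67; 7;
  183; 181; 187; 185; 191; 189; 195; 193; 199; 197; 203; 201; 207; 205; 211; 209; 215; 213; 219;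
  217; 223; 221; 224])], [:: (0,1,107,150,211); (0,2,30,52,66); (0,3,155,178,189); (0,4,20,38,78);
  (0,5,119,146,205); (0,9,136,147,197); (0,13,95,160,203); (0,31,99,128,223); (0,33,94,165,218);
  (0,35,143,166,214); (0,37,137,176,180); (0,41,129,174,193); (0,43,93,144,187)],
  [:: (0,15,90,105,224); (30,45,120,135,224); (60,75,150,165,224)]);
 (200, [:: (1, (200, 0, 40)); (11, (4, 40, 1)); (1, (1, 40, 1))], [::], [:: (0,1,17,88,99);
  (0,2,77,119,240); (0,3,26,69,214); (0,4,12,48,72); (0,5,34,187,220); (0,6,33,91,227);
  (0,7,62,97,203); (0,9,31,170,211); (0,10,25,147,206); (0,14,51,121,216); (0,19,73,162,229);
  (0,20,76,104,168); (0,21,67,126,232); (0,41,106,155,237); (0,50,100,150,244)], [::]);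
 (110, [:: (1, (110, 0, 22)); (1, (110, 22, 22)); (12, (2, 44, 1)); (1, (1, 44, 1))],
  [:: (2, 1, [:: 179; 69; 223; 221; 227; 225; 231; 229; 235; 233; 239; 237; 243; 241; 244])],
  [:: (0,1,122,157,242); (0,2,76,100,193); (0,3,131,172,236); (0,4,54,87,154); (0,5,184,195,225);
  (0,6,32,70,119); (0,7,68,96,118); (0,8,37,53,215); (0,9,147,194,222); (0,13,31,93,125);
  (0,15,58,144,164); (0,19,143,182,230); (0,25,141,200,234)], [:: (0,55,110,165,244)]);
 (110, [:: (1, (110, 0, 22)); (1, (110, 22, 22)); (22, (2, 44, 1)); (1, (1, 44, 1))],
  [:: (2, 1, [:: 115; 5; 223; 221; 227; 225; 231; 229; 235; 233; 239; 237; 243; 241; 247; 245;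
  251; 249; 255; 253; 259; 257; 263; 261; 264])], [:: (0,1,146,205,233); (0,2,20,48,60);
  (0,3,77,210,218); (0,4,39,76,198); (0,5,114,195,226); (0,6,16,30,84); (0,7,156,213,254);
  (0,9,153,176,241); (0,11,150,175,248); (0,13,143,212,258); (0,15,172,217,246);
  (0,17,169,196,231); (0,19,138,201,222); (0,21,137,168,263); (0,43,142,203,238)],
  [:: (0,55,110,165,264)]);
 (24, [:: (1, (24, 0, 4)); (1, (24, 4, 4)); (1, (24, 8, 4)); (1, (24, 12, 4)); (2, (4, 16, 1));
  (2, (1, 16, 1))], [:: (4, 1, [:: 39; 63; 87; 15; 98; 102; 104; 105])], [:: (0,1,46,59,88);
  (0,2,38,53,98); (0,3,9,34,44); (0,5,28,55,68); (0,7,71,77,101)], [:: (0,24,48,72,105);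
  (0,42,60,78,104)]);
 (4, [:: (4, (4, 0, 2)); (4, (4, 2, 2)); (4, (4, 4, 2)); (4, (4, 6, 2)); (2, (4, 8, 1)); (2, (2,
  8, 1))], [:: (4, 1, [:: 25; 29; 17; 21; 3; 7; 11; 15; 57; 61; 49; 53; 35; 39; 43; 47; 67; 68;
  74; 73]); (2, 1, [:: 7; 3; 15; 11; 23; 19; 31; 27; 39; 35; 47; 43; 55; 51; 63; 59; 67; 71; 73;
  75])], [:: (0,1,21,24,49); (0,5,60,61,66); (0,9,38,43,68); (0,16,46,58,72); (0,17,44,57,64);
  (0,22,47,55,70); (0,23,35,50,74); (0,32,37,54,63)], [::]);
 (40, [:: (1, (40, 0, 5)); (1, (40, 5, 5)); (8, (2, 10, 1))], [::], [:: (0,1,55,64,81);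
  (0,2,6,28,44); (0,3,65,76,87); (0,7,74,77,84); (0,8,16,24,32); (0,9,60,61,90); (0,11,50,57,89);
  (0,13,48,71,95); (0,17,45,66,93); (0,19,59,72,82); (0,41,43,47,69); (40,48,56,64,72)], [::]);
 (40, [:: (1, (40, 0, 5)); (1, (40, 5, 5)); (2, (10, 10, 1))], [::], [:: (0,1,55,57,86);
  (0,2,31,68,98); (0,3,67,74,93); (0,4,21,69,82); (0,6,13,51,83); (0,8,16,24,32); (0,12,47,73,91);
  (0,14,44,53,76); (0,18,41,60,92); (0,40,52,58,95); (0,43,59,72,89); (0,46,49,50,84)], [::]);
 (28, [:: (4, (28, 0, 14)); (14, (2, 14, 1))], [:: (2, 1, [:: 99; 71; 43; 15; 115; 113; 119; 117;
  121; 123; 127; 125; 131; 129; 133; 135; 138; 136]); (2, 1, [:: 70; 98; 14; 42; 114; 112; 116;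
  118; 122; 120; 126; 124; 128; 130; 134; 132; 138; 136])], [:: (0,1,107,110,126); (0,2,8,12,37);
  (0,5,41,82,123); (0,7,79,102,115); (0,9,59,74,133); (0,11,50,91,117); (0,30,57,103,129);
  (0,32,80,96,138)], [::]);
 (60, [:: (2, (60, 0, 15)); (1, (4, 15, 1))], [:: (2, 1, [:: 75; 15; 123])], [:: (0,1,7,33,111);
  (0,2,95,109,123); (0,3,39,52,118); (0,4,35,44,96); (0,5,72,82,94); (0,17,74,97,116)], [::]);
 (60, [:: (2, (60, 0, 15)); (4, (4, 15, 1))], [:: (2, 1, [:: 118; 58; 122; 126; 130; 134])],
  [:: (0,1,32,68,82); (0,2,8,88,109); (0,3,7,47,111); (0,5,27,62,130); (0,9,50,83,120);
  (0,11,37,66,133); (0,12,24,36,48); (0,17,35,78,124)], [::]);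
 (60, [:: (2, (60, 0, 15)); (6, (4, 15, 1))], [:: (2, 1, [:: 118; 58; 126; 122; 130; 134; 142;
  138])], [:: (0,1,82,115,135); (0,2,16,28,64); (0,3,20,24,55); (0,6,67,77,129); (0,7,86,104,141);
  (0,9,89,102,120); (0,11,63,85,143); (0,19,70,107,124)], [::]);
 (30, [:: (4, (30, 0, 15)); (4, (6, 15, 1)); (6, (2, 15, 1))], [:: (2, 1, [:: 69; 99; 9; 39; 135;
  141; 123; 129; 146; 144; 150; 148; 154; 152]); (2, 1, [:: 98; 68; 38; 8; 140; 134; 128; 122;
  145; 147; 149; 151; 153; 155])], [:: (0,1,40,84,145); (0,2,57,115,127); (0,3,13,99,138);
  (0,4,53,93,140); (0,5,14,87,136); (0,6,12,18,24); (0,7,59,79,149); (0,8,42,89,126);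
  (0,11,54,109,128); (0,32,74,118,155)], [::]);
 (128, [:: (1, (128, 0, 16)); (5, (4, 16, 1))], [::], [:: (0,1,98,111,138); (0,2,38,45,53);
  (0,3,57,82,144); (0,4,26,60,104); (0,5,11,70,143); (0,9,23,42,130); (0,10,37,99,134);
  (0,12,52,73,93)], [::]);
 (136, [:: (1, (136, 0, 17)); (4, (4, 17, 1))], [::], [:: (0,1,55,70,136); (0,2,29,64,105);
  (0,3,42,49,143); (0,4,77,96,120); (0,5,28,37,84); (0,6,14,36,124); (0,10,21,71,149);
  (0,13,58,111,146)], [::]);
 (144, [:: (1, (144, 0, 18)); (1, (16, 18, 1)); (1, (12, 18, 1)); (1, (4, 18, 1))], [::],
  [:: (0,1,4,48,87); (0,2,29,120,155); (0,5,69,76,165); (0,6,52,136,144); (0,9,25,37,131);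
  (0,10,43,113,174); (0,11,56,123,170); (0,15,93,110,166); (0,19,42,82,151); (0,20,55,85,150)],
  [::]);
 (160, [:: (1, (160, 0, 20)); (2, (20, 20, 1)); (1, (4, 20, 1))], [::], [:: (0,1,47,135,156);
  (0,2,54,123,191); (0,3,36,85,170); (0,6,70,147,162); (0,7,34,63,193); (0,8,81,92,169);
  (0,9,50,74,173); (0,10,53,71,203); (0,12,42,144,196); (0,14,62,129,160); (0,15,32,137,195);
  (0,22,66,125,187)], [::]);
 (42, [:: (4, (42, 0, 21)); (8, (2, 21, 1)); (4, (1, 21, 1))], [:: (2, 1, [:: 64; 22; 148; 106;
  170; 168; 174; 172; 176; 178; 180; 182; 185; 184; 187; 186]); (2, 1, [:: 159; 117; 75; 33; 170;
  168; 175; 173; 179; 177; 183; 181; 187; 186; 185; 184])], [:: (0,1,107,145,155);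
  (0,2,60,73,161); (0,3,114,165,179); (0,4,24,30,74); (0,5,54,62,94); (0,7,148,167,172);
  (0,9,87,130,182); (0,11,28,86,113); (0,45,118,143,170); (0,47,115,138,185)], [::]);
 (84, [:: (2, (84, 0, 21)); (10, (4, 21, 1))], [:: (2, 1, [:: 131; 47; 175; 171; 183; 179; 187;
  195; 191; 199; 203; 207])], [:: (0,1,36,69,73); (0,2,61,99,187); (0,3,17,98,198);
  (0,5,71,90,203); (0,6,94,116,183); (0,7,124,163,172); (0,8,40,64,101); (0,9,113,132,171);
  (0,10,41,143,205); (0,26,112,141,190); (0,27,118,152,195); (0,30,106,144,180)], [::]);
 (44, [:: (4, (44, 0, 22)); (8, (2, 22, 1))], [:: (2, 1, [:: 124; 168; 36; 80; 178; 176; 182; 180;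
  186; 184; 190; 188]); (2, 1, [:: 68; 24; 156; 112; 176; 178; 180; 182; 184; 186; 188; 190])],
  [:: (0,1,93,166,181); (0,2,7,32,136); (0,3,106,159,179); (0,4,74,141,161); (0,6,34,75,125);
  (0,8,50,76,108); (0,9,48,61,113); (0,11,97,126,186); (0,17,54,77,175); (0,45,102,169,190)],
  [::]);
 (88, [:: (2, (88, 0, 22)); (2, (8, 22, 1)); (5, (4, 22, 1))], [:: (2, 1, [:: 122; 34; 186; 178;
  194; 198; 202; 206; 210])], [:: (0,1,139,150,207); (0,2,15,97,209); (0,3,24,72,127);
  (0,4,104,116,191); (0,5,32,89,107); (0,6,141,171,195); (0,7,36,45,53); (0,10,51,168,176);
  (0,14,63,105,202); (0,20,128,151,185); (0,26,54,144,188); (0,31,98,153,196)], [::]);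
 (184, [:: (1, (184, 0, 23)); (8, (4, 23, 1))], [::], [:: (0,1,3,78,203); (0,4,40,67,122);
  (0,5,65,73,95); (0,6,47,105,193); (0,7,59,83,147); (0,9,19,34,212); (0,11,54,145,198);
  (0,12,32,112,168); (0,13,42,123,188); (0,14,45,71,208); (0,17,114,163,207); (0,18,51,149,185)],
  [::]);
 (192, [:: (1, (192, 0, 24)); (7, (4, 24, 1))], [::], [:: (0,1,45,52,61); (0,2,79,125,209);
  (0,3,74,181,219); (0,4,12,112,162); (0,5,43,64,169); (0,6,33,95,201); (0,10,65,155,206);
  (0,13,91,122,212); (0,15,41,134,192); (0,17,49,153,173); (0,18,40,94,157); (0,25,82,111,196)],
  [::]);
 (200, [:: (1, (200, 0, 25)); (1, (4, 25, 1))], [::], [:: (0,1,69,98,197); (0,2,34,146,186);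
  (0,5,13,76,193); (0,6,17,95,136); (0,9,53,113,174); (0,10,33,57,148); (0,15,36,142,170);
  (0,18,49,141,163); (0,19,46,84,126); (0,39,90,157,203)], [::]);
 (100, [:: (2, (100, 0, 25)); (12, (2, 25, 1))], [:: (2, 1, [:: 169; 69; 203; 201; 207; 205; 211;
  209; 215; 213; 219; 217; 223; 221])], [:: (0,1,156,167,200); (0,2,17,62,185); (0,3,8,64,76);
  (0,4,74,169,192); (0,6,16,122,180); (0,7,149,186,216); (0,9,139,198,211); (0,13,154,173,220);
  (0,14,49,71,162); (0,18,52,72,171); (0,21,128,197,205); (0,33,143,196,214)], [::]);
 (104, [:: (2, (104, 0, 26)); (10, (2, 26, 1))], [:: (2, 1, [:: 205; 101; 211; 209; 215; 213; 219;
  217; 223; 221; 227; 225])], [:: (0,1,160,195,212); (0,2,27,94,163); (0,3,43,47,169);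
  (0,5,107,170,216); (0,6,14,137,191); (0,7,24,82,140); (0,9,28,62,157); (0,11,119,178,222);
  (0,13,111,184,227); (0,15,120,203,211); (0,16,49,81,174); (0,18,38,74,114)], [::]);
 (108, [:: (2, (108, 0, 27)); (4, (4, 27, 1))], [:: (2, 1, [:: 195; 87; 219; 223; 227; 231])],
  [:: (0,1,12,84,160); (0,2,21,61,157); (0,3,10,79,205); (0,4,38,66,210); (0,5,35,142,223);
  (0,6,88,153,213); (0,8,64,124,139); (0,9,50,95,132); (0,14,57,163,218); (0,16,33,128,146);
  (0,23,150,181,224); (0,37,138,191,231)], [::]);
 (224, [:: (1, (224, 0, 28)); (3, (4, 28, 1))], [::], [:: (0,1,62,187,225); (0,2,119,177,230);
  (0,3,97,200,207); (0,4,36,138,152); (0,5,85,101,158); (0,6,25,48,69); (0,8,53,68,145);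
  (0,9,50,120,150); (0,10,39,65,98); (0,11,146,189,234); (0,12,34,52,143); (0,13,64,95,170)],
  [::]);
 (18, [:: (1, (18, 0, 2)); (1, (18, 2, 2)); (1, (18, 4, 2)); (1, (18, 6, 2)); (1, (1, 8, 1))],
  [:: (2, 1, [:: 23; 5; 59; 41; 72])], [:: (0,1,36,57,62); (0,3,23,40,51); (0,5,30,39,55);
  (0,7,22,38,67); (0,19,42,65,66); (0,26,41,44,58)], [:: (0,9,18,27,72); (36,45,54,63,72)]);
 (108, [:: (1, (108, 0, 12)); (3, (4, 12, 1)); (1, (1, 12, 1))], [::], [:: (0,1,38,67,114);
  (0,2,9,15,110); (0,3,20,43,76); (0,4,14,22,53); (0,5,62,87,119); (0,11,45,61,89);
  (0,27,54,81,120)], [::]);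
 (36, [:: (1, (36, 0, 4)); (1, (36, 4, 4)); (1, (36, 8, 4)); (1, (36, 12, 4)); (2, (2, 16, 1));
  (1, (1, 16, 1))], [:: (4, 1, [:: 36; 72; 108; 0; 146; 144; 148])], [:: (0,1,48,123,145);
  (0,2,65,116,127); (0,3,43,77,84); (0,5,27,51,100); (0,6,45,113,136); (0,10,52,71,118);
  (0,15,38,94,126)], [:: (0,18,72,90,148); (36,54,108,126,148)]);
 (36, [:: (1, (36, 0, 4)); (1, (36, 4, 4)); (1, (36, 8, 4)); (1, (36, 12, 4)); (4, (4, 16, 1));
  (4, (2, 16, 1)); (1, (1, 16, 1))], [:: (4, 1, [:: 36; 72; 108; 0; 145; 148; 153; 156; 162; 161;
  166; 165; 168])], [:: (0,1,22,66,144); (0,2,79,127,137); (0,3,37,94,148); (0,5,52,98,126);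
  (0,6,67,81,159); (0,7,69,109,163); (0,9,41,80,97); (0,11,95,131,152); (0,13,51,117,165)],
  [:: (0,18,72,90,168); (36,54,108,126,168)]);
 (180, [:: (1, (180, 0, 20)); (4, (4, 20, 1)); (1, (1, 20, 1))], [::], [:: (0,1,37,52,85);
  (0,2,23,109,186); (0,3,16,28,169); (0,4,50,76,118); (0,5,43,98,190); (0,6,75,116,133);
  (0,7,29,106,183); (0,8,32,67,123); (0,9,92,126,170); (0,18,119,149,192); (0,45,90,135,196)],
  [::]);
 (90, [:: (1, (90, 0, 10)); (1, (90, 10, 10)); (14, (2, 20, 1)); (1, (1, 20, 1))],
  [:: (2, 1, [:: 178; 88; 182; 180; 186; 184; 190; 188; 194; 192; 198; 196; 202; 200; 206; 204;
  208])], [:: (0,1,113,148,192); (0,2,8,76,118); (0,3,105,142,203); (0,4,25,140,166);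
  (0,5,125,176,183); (0,7,95,144,207); (0,9,107,170,190); (0,11,44,59,78); (0,13,96,169,196);
  (0,18,36,54,72); (0,24,62,93,151); (0,29,106,153,185)], [:: (0,45,90,135,208)]);
 (90, [:: (1, (90, 0, 10)); (1, (90, 10, 10)); (2, (18, 20, 1)); (1, (1, 20, 1))],
  [:: (2, 1, [:: 178; 88; 214; 196; 216])], [:: (0,1,74,106,213); (0,2,9,130,182);
  (0,3,59,157,195); (0,4,27,52,208); (0,5,18,119,143); (0,6,99,153,168); (0,8,51,97,206);
  (0,11,96,118,137); (0,12,26,112,183); (0,28,61,131,194); (0,32,141,178,201);
  (0,35,104,150,202)], [:: (0,45,90,135,216)]);
 (180, [:: (1, (180, 0, 20)); (2, (20, 20, 1)); (2, (4, 20, 1)); (1, (1, 20, 1))], [::],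
  [:: (0,1,3,22,222); (0,4,61,137,197); (0,5,28,54,204); (0,6,59,169,227); (0,7,73,125,208);
  (0,8,91,155,199); (0,9,77,101,195); (0,10,37,85,202); (0,12,30,141,182); (0,13,99,130,164);
  (0,14,98,136,183); (0,15,56,102,209); (0,32,67,138,218); (0,36,72,108,144); (0,45,90,135,228)],
  [::]);
 (252, [:: (1, (252, 0, 28)); (1, (1, 28, 1))], [:: (3, 121, [:: 191; 252])], [:: (0,2,9,76,238);
  (0,3,44,49,194); (0,19,66,149,183)], [:: (0,1,21,25,121); (0,8,48,60,113); (0,15,57,144,216);
  (0,63,126,189,252)]);
 (9, [:: (10, (9, 0, 9)); (2, (9, 10, 1)); (10, (1, 9, 1))], [:: (5, 1, [:: 31; 40; 4; 13; 22; 76;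
  85; 49; 58; 67; 94; 103; 111; 112; 108; 109; 110; 116; 117; 113; 114; 115])],
  [:: (0,1,23,67,88); (0,2,10,50,97); (0,3,41,64,101); (0,4,61,78,99); (0,11,80,84,102);
  (0,12,26,58,68); (0,15,35,91,109); (0,21,83,106,116); (0,24,49,90,115); (0,25,47,62,112);
  (0,52,55,59,98); (0,60,75,89,117); (45,46,48,68,90); (45,56,64,107,110)], [::]);
 (19, [:: (10, (19, 0, 19)); (2, (19, 20, 1)); (10, (1, 19, 1))], [:: (10, 1, [:: 156; 175; 99;
  118; 137; 61; 80; 4; 23; 42; 194; 213; 236; 237; 233; 234; 235; 231; 232; 228; 229; 230])],
  [:: (0,1,87,174,216); (0,2,36,145,212); (0,3,51,187,204); (0,4,29,35,60); (0,5,97,156,200);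
  (0,7,68,81,126); (0,8,118,163,194); (0,9,84,189,217); (0,22,71,99,123); (0,23,144,177,203);
  (0,26,67,122,211); (0,37,125,165,235); (0,42,158,193,230); (0,56,137,225,233)], [::]);
 (19, [:: (11, (19, 0, 19)); (1, (19, 20, 1)); (11, (1, 19, 1))], [:: (11, 1, [:: 191; 1; 20; 39;
  58; 77; 96; 115; 134; 153; 172; 210; 238; 228; 229; 230; 231; 232; 233; 234; 235; 236; 237])],
  [:: (0,1,17,32,126); (0,4,39,127,205); (0,5,45,137,143); (0,7,73,158,175); (0,8,72,207,212);
  (0,9,92,129,134); (0,20,79,210,231); (0,22,71,87,131); (0,25,80,202,233); (0,28,75,195,220);
  (0,30,48,176,237); (0,43,112,161,222); (0,46,142,173,227)], [::]);
 (15, [:: (4, (15, 0, 5)); (1, (5, 5, 1)); (1, (3, 5, 1))], [:: (4, 8, [:: 54; 4; 19; 39; 64;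
  67])], [:: (0,1,24,48,52); (0,2,29,56,64); (0,3,6,9,12)], [:: (0,4,42,43,65); (15,22,51,53,67);
  (0,16,33,57,66); (0,17,36,49,63)]);
 (120, [:: (1, (120, 0, 10)); (2, (4, 10, 1))], [::], [:: (0,1,14,22,26); (0,2,51,87,93);
  (0,3,66,77,121); (0,5,39,58,126); (0,7,52,83,111); (0,15,38,56,103); (0,24,48,72,96)], [::]);
 (60, [:: (2, (60, 0, 10)); (1, (4, 10, 1)); (6, (2, 10, 1))], [:: (2, 1, [:: 118; 58; 120; 126;
  124; 130; 128; 134; 132])], [:: (0,1,64,73,135); (0,2,16,28,71); (0,3,86,105,125);
  (0,4,22,47,88); (0,5,11,104,123); (0,7,31,52,113); (0,23,85,112,128)], [::]);
 (60, [:: (2, (60, 0, 10)); (2, (12, 10, 1)); (1, (4, 10, 1))], [:: (2, 1, [:: 118; 58; 142; 130;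
  146])], [:: (0,1,26,98,142); (0,2,23,64,126); (0,3,18,94,125); (0,4,13,81,88); (0,5,32,119,143);
  (0,6,44,113,129); (0,8,49,63,133); (0,12,24,36,48); (0,14,31,109,144)], [::]);
 (132, [:: (1, (132, 0, 11)); (5, (4, 11, 1))], [::], [:: (0,1,4,98,108); (0,2,45,51,144);
  (0,5,95,118,132); (0,7,54,69,138); (0,8,61,101,119); (0,9,26,91,149); (0,12,32,68,84);
  (0,27,73,102,142)], [::]);
 (144, [:: (1, (144, 0, 12)); (1, (4, 12, 1))], [::], [:: (0,1,5,51,112); (0,2,15,40,79);
  (0,3,62,71,125); (0,6,26,34,55); (0,7,18,121,145); (0,10,52,66,109); (0,16,47,74,91)], [::]);
 (36, [:: (2, (36, 0, 6)); (2, (36, 6, 6)); (12, (2, 12, 1))], [:: (4, 1, [:: 72; 108; 36; 0; 146;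
  144; 150; 148; 154; 152; 158; 156; 162; 160; 166; 164])], [:: (0,1,76,115,148); (0,2,11,28,63);
  (0,3,82,131,153); (0,4,44,90,116); (0,5,78,129,145); (0,7,74,127,159); (0,13,107,136,161);
  (0,14,95,117,133); (0,15,84,125,167)], [::]);
 (78, [:: (2, (78, 0, 13)); (4, (2, 13, 1))], [:: (2, 1, [:: 143; 65; 159; 157; 163; 161])],
  [:: (0,1,8,42,134); (0,2,30,107,124); (0,3,46,58,119); (0,4,60,113,132); (0,5,81,90,157);
  (0,6,16,63,152); (0,11,25,49,148); (0,27,87,120,160)], [::]);
 (78, [:: (2, (78, 0, 13)); (14, (2, 13, 1))], [:: (2, 1, [:: 118; 40; 158; 156; 162; 160; 166;
  164; 170; 168; 174; 172; 178; 176; 182; 180])], [:: (0,1,96,141,169); (0,2,12,62,100);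
  (0,3,129,148,174); (0,4,24,46,125); (0,5,115,142,160); (0,6,17,40,70); (0,7,80,127,156);
  (0,9,84,99,177); (0,21,123,152,182); (0,35,106,147,165)], [::]);
 (42, [:: (2, (42, 0, 7)); (2, (42, 7, 7)); (16, (2, 14, 1))], [:: (2, 1, [:: 43; 1; 127; 85; 171;
  169; 175; 173; 179; 177; 183; 181; 187; 185; 191; 189; 195; 193; 199; 197])],
  [:: (0,1,139,158,177); (0,2,19,91,101); (0,3,126,131,179); (0,4,24,30,116); (0,5,85,156,193);
  (0,8,76,152,154); (0,9,48,159,171); (0,10,83,135,143); (0,11,44,71,196); (0,13,109,132,195);
  (0,46,115,149,174); (0,47,87,160,180); (0,52,129,142,189); (0,54,125,147,173);
  (0,57,95,162,181); (0,59,123,163,187); (0,61,117,127,186); (0,62,130,141,190);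
  (0,84,88,100,106); (0,97,98,136,145); (0,107,134,137,168); (84,99,142,159,198)], [::]);
 (60, [:: (3, (60, 0, 15)); (2, (4, 15, 1))], [:: (3, 1, [:: 109; 169; 4; 182; 186])],
  [:: (0,1,10,47,182); (0,2,116,128,157); (0,3,8,86,162); (0,4,65,91,119); (0,7,49,118,125);
  (0,12,24,36,48); (0,16,33,95,145); (0,19,92,112,140); (0,21,64,102,148); (0,25,82,176,184)],
  [::]);
 (90, [:: (2, (90, 0, 15)); (8, (2, 15, 1))], [:: (2, 1, [:: 178; 88; 182; 180; 186; 184; 190;
  188; 194; 192])], [:: (0,1,18,51,124); (0,2,44,54,66); (0,3,9,85,148); (0,4,95,114,172);
  (0,7,41,128,144); (0,11,152,173,190); (0,20,43,96,158); (0,25,92,119,195); (0,29,109,140,183);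
  (0,35,99,136,186)], [::]);
 (60, [:: (3, (60, 0, 15)); (7, (4, 15, 1))], [:: (3, 1, [:: 109; 169; 4; 182; 186; 190; 194; 198;
  202; 206])], [:: (0,1,73,98,119); (0,2,53,78,207); (0,3,22,116,198); (0,4,61,111,130);
  (0,5,82,124,187); (0,6,139,157,193); (0,8,40,71,121); (0,11,34,100,203); (0,12,24,36,48);
  (0,13,145,176,188); (0,16,70,103,158); (0,17,65,161,181)], [::]);
 (90, [:: (2, (90, 0, 15)); (18, (2, 15, 1))], [:: (2, 1, [:: 178; 88; 182; 180; 186; 184; 190;
  188; 194; 192; 198; 196; 202; 200; 206; 204; 210; 208; 214; 212])], [:: (0,1,152,171,201);
  (0,2,36,48,74); (0,3,40,113,148); (0,4,10,24,32); (0,5,128,139,215); (0,7,92,121,189);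
  (0,9,146,173,181); (0,13,111,154,208); (0,17,104,155,186); (0,21,130,179,193);
  (0,23,102,167,207); (0,31,94,127,197)], [::]);
 (60, [:: (3, (60, 0, 15)); (4, (12, 15, 1))], [:: (3, 1, [:: 109; 169; 4; 182; 194; 206; 222])],
  [:: (0,1,29,117,183); (0,2,19,100,176); (0,3,52,175,209); (0,4,51,97,197); (0,5,40,79,196);
  (0,6,83,130,217); (0,7,33,171,181); (0,10,139,155,199); (0,12,24,36,48); (0,14,108,166,220);
  (0,18,82,154,222); (0,21,112,121,213); (0,22,85,163,189); (0,23,66,133,214)], [::]);
 (192, [:: (1, (192, 0, 16)); (5, (4, 16, 1))], [::], [:: (0,1,54,91,133); (0,2,40,70,83);
  (0,3,34,185,211); (0,4,62,172,178); (0,5,22,33,89); (0,8,93,129,148); (0,9,75,114,197);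
  (0,12,57,104,177); (0,21,98,163,202); (0,23,69,118,195); (0,25,51,86,204)], [::]);
 (192, [:: (1, (192, 0, 16)); (3, (12, 16, 1)); (1, (4, 16, 1))], [::], [:: (0,1,24,60,121);
  (0,2,104,186,217); (0,3,22,158,207); (0,4,9,138,222); (0,7,38,81,208); (0,10,116,151,210);
  (0,11,50,79,192); (0,12,26,101,119); (0,13,28,150,200); (0,17,44,69,152); (0,20,125,146,203);
  (0,30,92,145,220); (0,33,98,147,231)], [::]);
 (102, [:: (2, (102, 0, 17)); (2, (2, 17, 1))], [:: (2, 1, [:: 201; 99; 207; 205])],
  [:: (0,1,7,116,145); (0,2,43,57,69); (0,3,21,75,125); (0,4,83,110,141); (0,5,82,139,185);
  (0,8,58,105,171); (0,9,24,182,198); (0,10,32,74,150); (0,11,123,186,207); (0,13,62,155,192)],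
  [::]);
 (204, [:: (1, (204, 0, 17)); (6, (4, 17, 1))], [::], [:: (0,1,71,74,221); (0,2,44,140,200);
  (0,5,26,41,61); (0,7,25,37,152); (0,8,40,112,128); (0,9,38,159,227); (0,10,75,165,210);
  (0,11,97,110,214); (0,14,101,123,151); (0,19,62,125,204); (0,23,47,80,158); (0,27,58,149,216)],
  [::]);
 (204, [:: (1, (204, 0, 17)); (2, (12, 17, 1)); (5, (4, 17, 1))], [::], [:: (0,1,74,156,163);
  (0,2,33,71,245); (0,3,26,129,229); (0,4,18,54,198); (0,5,110,139,233); (0,8,19,98,205);
  (0,9,118,157,225); (0,12,64,84,172); (0,13,76,104,208); (0,15,81,174,237); (0,16,43,167,221);
  (0,21,61,158,220); (0,22,57,149,211); (0,25,83,142,241)], [::]);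
 (72, [:: (3, (72, 0, 18)); (2, (4, 18, 1))], [:: (3, 1, [:: 123; 195; 51; 219; 223])],
  [:: (0,1,41,97,202); (0,2,12,82,170); (0,3,20,48,196); (0,4,15,78,169); (0,5,30,63,106);
  (0,6,49,143,155); (0,7,100,116,157); (0,8,59,111,215); (0,19,98,136,205); (0,22,163,189,216);
  (0,35,77,166,223)], [::]);
 (108, [:: (2, (108, 0, 18)); (7, (4, 18, 1))], [:: (2, 1, [:: 195; 87; 219; 223; 227; 231; 235;
  239; 243])], [:: (0,1,139,214,226); (0,2,7,69,243); (0,3,178,205,229); (0,4,59,65,207);
  (0,8,76,132,212); (0,9,95,134,220); (0,10,73,87,166); (0,11,129,154,219); (0,12,91,128,152);
  (0,15,38,57,236); (0,16,60,173,210); (0,20,127,153,183); (0,34,115,165,235)], [::]);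
 (36, [:: (6, (36, 0, 18)); (5, (4, 18, 1)); (14, (2, 18, 1))], [:: (6, 1, [:: 152; 188; 116; 44;
  80; 8; 218; 222; 226; 230; 234; 238; 236; 242; 240; 246; 244; 250; 248; 254; 252; 258; 256; 262;
  260])], [:: (0,1,58,95,235); (0,2,117,151,217); (0,3,133,158,238); (0,4,14,80,92);
  (0,5,40,48,183); (0,6,17,193,228); (0,7,118,159,250); (0,9,132,165,226); (0,13,145,190,253);
  (0,15,136,175,257); (0,16,62,100,128); (0,47,142,161,243); (0,51,164,191,222);
  (0,53,127,206,246); (0,59,109,186,263)], [::]);
 (114, [:: (2, (114, 0, 19)); (16, (2, 19, 1))], [:: (2, 1, [:: 199; 85; 231; 229; 235; 233; 239;
  237; 243; 241; 247; 245; 251; 249; 255; 253; 259; 257])], [:: (0,1,173,214,233);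
  (0,2,24,168,199); (0,3,150,203,259); (0,4,12,46,227); (0,5,131,206,252); (0,6,32,50,154);
  (0,7,35,91,101); (0,9,121,164,236); (0,11,40,100,193); (0,15,140,177,246); (0,16,52,97,134);
  (0,21,158,225,250); (0,27,132,183,228); (0,49,120,179,240)], [::]);
 (114, [:: (2, (114, 0, 19)); (8, (6, 19, 1)); (2, (2, 19, 1))], [:: (2, 1, [:: 199; 85; 235; 229;
  247; 241; 259; 253; 271; 265; 279; 277])], [:: (0,1,169,183,242); (0,2,41,147,253);
  (0,3,138,161,275); (0,4,24,96,226); (0,5,49,134,233); (0,6,52,84,157); (0,7,163,172,276);
  (0,8,25,126,261); (0,10,61,164,244); (0,11,59,71,99); (0,13,124,205,268); (0,16,37,144,236);
  (0,27,56,175,246); (0,31,146,180,258); (0,35,132,201,265); (0,47,136,200,239)], [::]);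
 (240, [:: (1, (240, 0, 20)); (2, (4, 20, 1))], [::], [:: (0,1,87,106,242); (0,2,116,170,227);
  (0,3,8,84,182); (0,4,26,79,198); (0,6,62,73,210); (0,7,162,209,246); (0,9,21,104,217);
  (0,10,35,109,211); (0,14,41,132,191); (0,16,34,71,123); (0,17,82,110,207); (0,24,101,152,195);
  (0,48,96,144,192)], [::]);
 (126, [:: (2, (126, 0, 21)); (1, (14, 21, 1)); (3, (2, 21, 1))], [:: (3, 67, [:: 45; 171; 255;
  271; 267; 269])], [:: (0,1,206,238,264); (0,2,15,106,227); (0,4,52,143,176); (0,5,130,245,268);
  (0,9,40,160,248); (0,14,101,152,197); (0,128,140,157,198); (0,148,155,195,199)],
  [:: (0,6,29,102,260); (0,18,54,234,255); (0,153,171,243,252); (126,132,156,187,257)]);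
 (126, [:: (2, (126, 0, 21)); (20, (2, 21, 1))], [:: (2, 1, [:: 238; 112; 254; 252; 258; 256; 262;
  260; 266; 264; 270; 268; 274; 272; 278; 276; 282; 280; 286; 284; 290; 288])],
  [:: (0,1,142,193,256); (0,2,72,116,211); (0,3,219,230,269); (0,4,30,184,242); (0,5,60,94,112);
  (0,6,22,29,49); (0,8,36,86,214); (0,9,130,191,279); (0,13,208,241,284); (0,15,129,188,290);
  (0,17,220,251,282); (0,24,88,133,179); (0,25,145,226,266); (0,35,153,232,273);
  (0,39,174,215,262); (0,53,149,218,252)], [::]);
 (126, [:: (2, (126, 0, 21)); (30, (2, 21, 1))], [:: (2, 1, [:: 244; 118; 254; 252; 258; 256; 262;
  260; 266; 264; 270; 268; 274; 272; 278; 276; 282; 280; 286; 284; 290; 288; 294; 292; 298; 296;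
  302; 300; 306; 304; 310; 308])], [:: (0,1,135,216,267); (0,2,20,52,80); (0,3,204,229,253);
  (0,4,26,62,118); (0,5,159,170,287); (0,6,30,44,116); (0,7,188,203,305); (0,9,141,178,300);
  (0,13,136,227,270); (0,17,144,223,280); (0,19,186,239,311); (0,23,133,218,290);
  (0,27,131,198,260); (0,29,128,205,296); (0,31,187,248,275); (0,33,145,232,276);
  (0,43,138,193,257); (0,51,166,235,295)], [::]);
 (132, [:: (2, (132, 0, 22)); (1, (4, 22, 1))], [:: (2, 1, [:: 235; 103; 267])],
  [:: (0,1,135,150,258); (0,2,27,59,179); (0,3,53,115,174); (0,4,47,98,160); (0,5,116,170,235);
  (0,6,37,77,199); (0,7,147,215,223); (0,10,28,39,185); (0,12,60,224,260); (0,13,46,87,214);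
  (0,14,49,155,218); (0,19,42,209,267); (0,26,78,159,189)], [::]);
 (264, [:: (1, (264, 0, 22)); (6, (4, 22, 1))], [::], [:: (0,1,61,84,245); (0,2,50,104,114);
  (0,3,18,253,278); (0,4,105,143,238); (0,5,90,111,275); (0,6,34,42,93); (0,7,53,126,266);
  (0,9,76,173,248); (0,12,89,128,168); (0,13,68,120,137); (0,24,81,146,232); (0,27,182,229,269);
  (0,31,94,165,223); (0,33,78,227,280); (0,43,141,190,284)], [::]);
 (264, [:: (1, (264, 0, 22)); (11, (4, 22, 1))], [::], [:: (0,1,139,170,306); (0,2,104,166,201);
  (0,3,53,130,279); (0,4,147,156,248); (0,5,19,42,283); (0,6,34,82,218); (0,7,25,178,264);
  (0,8,51,68,124); (0,10,55,161,287); (0,11,38,85,296); (0,12,36,180,193); (0,15,54,189,301);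
  (0,21,70,99,274); (0,26,105,223,289); (0,30,87,145,271); (0,32,72,141,205); (0,33,122,183,293)],
  [::]);
 (132, [:: (2, (132, 0, 22)); (16, (4, 22, 1))], [:: (2, 1, [:: 168; 36; 268; 264; 276; 272; 284;
  280; 292; 288; 300; 296; 308; 304; 312; 316; 320; 324])], [:: (0,1,6,47,313); (0,2,211,253,323);
  (0,3,29,231,297); (0,4,96,167,204); (0,7,109,137,264); (0,8,32,77,112); (0,9,59,221,300);
  (0,10,89,224,285); (0,11,25,161,283); (0,12,68,84,217); (0,13,199,232,288); (0,15,188,245,294);
  (0,17,98,256,270); (0,18,170,189,306); (0,21,83,146,324); (0,27,153,254,319);
  (0,38,155,216,273); (0,39,159,213,310); (0,58,181,248,272)], [::]);
 (138, [:: (2, (138, 0, 23)); (14, (2, 23, 1))], [:: (2, 1, [:: 208; 70; 278; 276; 282; 280; 286;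
  284; 290; 288; 294; 292; 298; 296; 302; 300])], [:: (0,1,35,88,239); (0,2,16,76,130);
  (0,3,173,228,281); (0,4,153,160,201); (0,5,32,72,234); (0,6,118,206,249); (0,9,166,187,294);
  (0,11,179,242,299); (0,12,42,57,94); (0,13,31,152,190); (0,17,164,273,287); (0,19,182,218,240);
  (0,25,169,216,277); (0,28,89,154,222); (0,33,142,181,302); (0,59,195,268,290)], [::]);
 (138, [:: (2, (138, 0, 23)); (24, (2, 23, 1))], [:: (2, 1, [:: 208; 70; 278; 276; 282; 280; 286;
  284; 290; 288; 294; 292; 298; 296; 302; 300; 306; 304; 310; 308; 314; 312; 318; 316; 322;
  320])], [:: (0,1,61,73,123); (0,2,28,42,86); (0,3,155,236,321); (0,4,132,164,198);
  (0,5,182,261,293); (0,7,169,200,276); (0,8,114,173,203); (0,9,149,260,305); (0,11,36,56,74);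
  (0,13,156,255,291); (0,17,148,191,299); (0,19,234,267,315); (0,21,213,268,284);
  (0,22,90,190,231); (0,29,171,218,301); (0,35,185,270,317); (0,37,212,263,283);
  (0,49,186,257,309)], [::]);
 (46, [:: (6, (46, 0, 23)); (34, (2, 23, 1))], [:: (2, 1, [:: 78; 32; 170; 124; 262; 216; 278;
  276; 282; 280; 286; 284; 290; 288; 294; 292; 298; 296; 302; 300; 306; 304; 310; 308; 314; 312;
  318; 316; 322; 320; 326; 324; 330; 328; 334; 332; 338; 336; 342; 340])], [:: (0,1,194,252,297);
  (0,2,6,20,274); (0,3,13,34,108); (0,5,48,187,324); (0,7,141,219,287); (0,8,24,109,242);
  (0,9,50,152,300); (0,11,93,140,298); (0,17,83,238,310); (0,19,82,190,334); (0,47,232,271,338);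
  (0,52,142,275,331); (0,53,98,166,339); (0,54,205,262,281); (0,57,255,270,318);
  (0,58,114,129,282); (0,59,171,215,289); (0,60,178,263,279); (0,61,124,182,319);
  (0,62,150,245,315); (0,64,116,192,306); (0,65,96,196,323); (0,67,106,256,342);
  (0,68,172,233,295); (0,94,160,181,327); (0,97,153,209,288); (0,99,132,151,333);
  (0,100,199,226,321); (0,103,111,127,258); (0,107,167,170,308); (0,110,149,221,285);
  (0,117,119,123,137); (0,122,206,247,307); (0,125,130,200,305); (0,126,168,222,322);
  (0,133,236,244,260); (0,135,179,195,340); (0,139,146,273,312); (0,145,162,235,328);
  (0,147,227,257,284); (0,154,204,259,278); (0,156,186,249,330); (0,157,158,261,292);
  (0,159,197,210,291); (0,164,188,241,314); (0,165,174,237,276); (0,173,191,216,343);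
  (0,176,218,265,294); (0,202,214,240,250); (0,220,225,239,303); (92,102,169,181,243);
  (92,103,217,232,280); (92,111,166,194,301); (92,146,259,270,316); (92,149,209,231,297);
  (92,154,251,252,336); (92,186,229,250,326); (92,193,236,245,308); (92,224,237,266,335);
  (92,255,257,261,275)], [::]);
 (144, [:: (2, (144, 0, 24)); (8, (4, 24, 1))], [:: (2, 1, [:: 151; 7; 289; 293; 297; 301; 305;
  309; 313; 317])], [:: (0,1,123,248,314); (0,2,37,113,183); (0,3,67,121,260); (0,4,69,158,266);
  (0,5,55,62,310); (0,6,45,177,302); (0,8,20,112,227); (0,9,134,196,279); (0,11,49,228,289);
  (0,13,29,224,271); (0,14,44,117,246); (0,15,93,244,305); (0,17,98,164,280); (0,18,74,212,272);
  (0,25,165,256,292); (0,34,191,277,297); (0,42,101,209,318)], [::]);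
 (288, [:: (1, (288, 0, 24)); (13, (4, 24, 1))], [::], [:: (0,1,162,247,307); (0,2,123,137,310);
  (0,3,62,173,301); (0,4,152,183,219); (0,5,164,176,204); (0,6,58,66,134); (0,7,30,149,331);
  (0,9,218,275,292); (0,10,93,271,313); (0,11,49,238,338); (0,15,44,200,232); (0,16,80,114,196);
  (0,18,81,263,298); (0,19,113,150,319); (0,20,97,201,255); (0,21,187,262,326); (0,35,86,249,334);
  (0,45,147,242,321); (0,55,145,210,290)], [::]);
 (18, [:: (6, (18, 0, 9)); (6, (18, 9, 9)); (6, (18, 18, 9)); (2, (2, 27, 1))],
  [:: (18, 1, [:: 172; 190; 208; 118; 136; 154; 280; 298; 316; 226; 244; 262; 76; 103; 67; 22; 49;
  13; 326; 324])], [:: (0,1,14,288,304); (0,3,76,175,323); (0,6,107,162,170); (0,7,59,103,202);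
  (0,20,129,150,263); (0,21,38,259,273); (0,22,46,229,239); (0,23,141,196,272); (0,24,85,169,200);
  (0,29,66,199,220); (0,31,153,223,285); (0,34,91,176,269); (0,57,145,250,306);
  (0,58,115,193,226); (0,74,181,219,324); (0,79,114,183,256)], [::]);
 (26, [:: (1, (26, 0, 2)); (1, (26, 2, 2)); (1, (26, 4, 2)); (1, (26, 6, 2)); (8, (2, 8, 1)); (1,
  (1, 8, 1))], [:: (2, 1, [:: 35; 9; 87; 61; 107; 105; 111; 109; 115; 113; 119; 117; 120])],
  [:: (0,1,30,97,107); (0,3,41,46,55); (0,7,68,71,93); (0,9,60,81,117); (0,11,69,102,118);
  (0,27,76,100,115); (0,28,56,85,94); (0,31,62,63,79); (0,33,59,103,113); (0,34,88,99,111);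
  (0,36,82,89,108); (0,75,90,95,104)], [:: (0,13,26,39,120); (52,65,78,91,120)]);
 (78, [:: (1, (78, 0, 6)); (1, (78, 6, 6)); (1, (1, 12, 1))], [:: (2, 1, [:: 138; 60; 156])],
  [:: (0,1,32,122,137); (0,2,61,102,152); (0,3,73,111,149); (0,4,26,71,135); (0,9,29,96,110);
  (0,10,35,51,130); (0,13,83,106,140)], [:: (0,39,78,117,156)]);
 (78, [:: (1, (78, 0, 6)); (1, (78, 6, 6)); (10, (2, 12, 1)); (1, (1, 12, 1))],
  [:: (2, 1, [:: 143; 65; 159; 157; 163; 161; 167; 165; 171; 169; 175; 173; 176])],
  [:: (0,1,96,141,173); (0,2,49,63,71); (0,3,130,149,164); (0,4,20,101,135); (0,5,91,126,160);
  (0,10,50,84,116); (0,11,52,98,125); (0,13,80,105,168); (0,21,100,123,158)],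
  [:: (0,39,78,117,176)]);
 (78, [:: (1, (78, 0, 6)); (1, (78, 6, 6)); (6, (6, 12, 1)); (2, (2, 12, 1)); (1, (1, 12, 1))],
  [:: (2, 1, [:: 118; 40; 166; 160; 178; 172; 190; 184; 194; 192; 196])], [:: (0,1,22,35,188);
  (0,2,104,142,171); (0,3,23,154,183); (0,4,71,90,176); (0,5,82,110,164); (0,8,37,108,168);
  (0,9,19,128,182); (0,14,89,136,163); (0,15,99,116,194); (0,16,107,139,161); (0,25,52,88,121)],
  [:: (0,39,78,117,196)]);
 (208, [:: (1, (208, 0, 16)); (1, (4, 16, 1)); (1, (1, 16, 1))], [::], [:: (0,1,42,61,124);
  (0,2,17,115,135); (0,3,106,132,155); (0,4,28,50,142); (0,5,40,127,201); (0,6,39,77,208);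
  (0,8,45,107,198); (0,9,120,149,174); (0,11,83,119,150); (0,13,143,164,194); (0,52,104,156,212)],
  [::]);
 (104, [:: (1, (104, 0, 8)); (1, (104, 8, 8)); (6, (4, 16, 1)); (1, (1, 16, 1))],
  [:: (2, 1, [:: 205; 101; 209; 213; 217; 221; 225; 229; 232])], [:: (0,1,15,42,116);
  (0,2,195,201,219); (0,3,76,163,175); (0,4,30,188,206); (0,5,51,70,127); (0,7,43,54,166);
  (0,9,38,183,223); (0,10,79,157,214); (0,13,84,148,192); (0,17,143,198,210); (0,21,171,194,228);
  (0,22,67,105,226)], [:: (0,52,104,156,232)]);
 (130, [:: (1, (130, 0, 10)); (1, (130, 10, 10)); (1, (1, 20, 1))], [:: (2, 1, [:: 173; 43;
  260])], [:: (0,1,48,189,207); (0,2,97,217,259); (0,3,102,121,149); (0,4,136,147,223);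
  (0,5,22,103,225); (0,6,29,85,240); (0,7,71,84,168); (0,8,142,180,205); (0,14,75,166,200);
  (0,15,106,209,245); (0,16,57,164,208); (0,21,93,137,199); (0,26,52,78,104)],
  [:: (0,65,130,195,260)]);
 (28, [:: (2, (28, 0, 4)); (2, (28, 4, 4)); (1, (4, 8, 1)); (2, (1, 8, 1))], [:: (4, 1, [:: 91;
  67; 9; 37; 114; 116; 117])], [:: (0,1,30,62,107); (0,2,11,69,75); (0,3,37,83,113);
  (0,5,79,90,100); (0,7,63,88,101)], [:: (0,14,33,47,117); (56,70,89,103,117); (0,54,70,96,116)]);
 (24, [:: (4, (24, 0, 6)); (2, (6, 6, 1)); (2, (4, 6, 1))], [:: (4, 1, [:: 39; 63; 87; 15; 105;
  99; 111; 115])], [:: (0,1,15,62,110); (0,2,65,93,104); (0,3,46,89,113); (0,4,68,79,98);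
  (0,5,50,76,87); (0,7,80,88,107)], [::]);
 (56, [:: (2, (56, 0, 7)); (3, (4, 7, 1))], [:: (2, 1, [:: 89; 33; 113; 117; 121])],
  [:: (0,1,3,74,112); (0,4,68,79,111); (0,5,38,67,123); (0,6,15,37,118); (0,8,66,86,96);
  (0,12,39,59,99)], [::]);
 (128, [:: (1, (128, 0, 8)); (1, (4, 8, 1))], [::], [:: (0,1,53,59,108); (0,2,7,89,99);
  (0,3,33,47,60); (0,4,19,42,54); (0,9,26,37,103); (0,18,61,83,131)], [::]);
 (12, [:: (4, (12, 0, 3)); (4, (12, 3, 3)); (4, (12, 6, 3)); (4, (6, 9, 1)); (3, (4, 9, 1))],
  [:: (6, 1, [:: 93; 81; 69; 57; 141; 129; 117; 105; 45; 33; 21; 9; 165; 159; 153; 147; 171; 175;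
  179]); (2, 1, [:: 66; 54; 90; 78; 114; 102; 138; 126; 18; 6; 42; 30; 150; 144; 162; 156; 170;
  174; 178])], [:: (0,1,5,54,101); (0,2,66,126,147); (0,13,111,140,176); (0,14,71,79,170);
  (0,16,92,123,157); (0,17,37,83,163); (0,25,75,118,174); (0,26,51,133,151); (0,38,82,108,166);
  (0,41,93,120,149)], [::]);
 (80, [:: (2, (80, 0, 10)); (4, (2, 10, 1))], [:: (2, 1, [:: 156; 76; 162; 160; 166; 164])],
  [:: (0,1,15,97,129); (0,2,8,89,141); (0,3,45,57,149); (0,4,17,119,135); (0,5,41,98,157);
  (0,7,25,34,58); (0,11,85,134,167); (0,19,84,127,160)], [::]);
 (160, [:: (1, (160, 0, 10)); (5, (4, 10, 1))], [::], [:: (0,1,43,95,99); (0,2,69,115,173);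
  (0,3,85,138,163); (0,5,21,102,153); (0,6,19,125,167); (0,8,44,92,131); (0,9,27,86,168);
  (0,11,34,145,177); (0,14,38,71,143); (0,32,64,96,128)], [::]);
 (160, [:: (1, (160, 0, 10)); (1, (20, 10, 1)); (1, (8, 10, 1))], [::], [:: (0,1,19,27,179);
  (0,2,6,35,51); (0,3,101,126,169); (0,5,12,68,89); (0,9,53,67,183); (0,11,47,75,129);
  (0,13,52,74,181); (0,15,32,87,177); (0,23,66,114,167); (0,24,81,119,175)], [::]);
 (6, [:: (8, (6, 0, 3)); (8, (6, 3, 3)); (8, (6, 6, 3)); (6, (6, 10, 1)); (8, (2, 9, 1))],
  [:: (12, 1, [:: 140; 134; 104; 98; 116; 110; 128; 122; 44; 38; 8; 2; 20; 14; 32; 26; 92; 86; 56;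
  50; 68; 62; 80; 74; 176; 164; 170; 158; 146; 152; 194; 192; 182; 180; 186; 184; 190; 188]);
  (2, 1, [:: 30; 24; 42; 36; 6; 0; 18; 12; 78; 72; 90; 84; 54; 48; 66; 60; 126; 120; 138; 132;
  102; 96; 114; 108; 144; 150; 156; 162; 168; 174; 190; 188; 194; 192; 182; 180; 186; 184])],
  [:: (0,1,74,152,192); (0,2,122,127,132); (0,8,37,50,178); (0,13,52,126,150); (0,14,51,67,186);
  (0,20,49,163,195); (0,25,81,133,148); (0,26,94,117,162); (0,31,66,141,169); (0,32,90,128,179);
  (0,53,105,172,191); (0,55,135,161,180)], [::]);
 (80, [:: (2, (80, 0, 10)); (2, (4, 10, 1)); (16, (2, 10, 1))], [:: (2, 1, [:: 135; 55; 163; 167;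
  171; 169; 175; 173; 179; 177; 183; 181; 187; 185; 191; 189; 195; 193; 199; 197])],
  [:: (0,1,86,127,170); (0,2,5,59,163); (0,4,28,66,72); (0,7,89,124,176); (0,9,104,153,173);
  (0,11,105,142,188); (0,13,115,132,197); (0,15,91,152,192); (0,16,32,48,64); (0,22,83,129,164);
  (0,25,92,143,180); (0,27,106,139,187)], [::]);
 (88, [:: (2, (88, 0, 11)); (10, (2, 11, 1))], [:: (2, 1, [:: 122; 34; 178; 176; 182; 180; 186;
  184; 190; 188; 194; 192])], [:: (0,1,39,73,79); (0,2,30,102,138); (0,3,137,172,195);
  (0,4,74,93,105); (0,5,29,37,152); (0,7,26,68,120); (0,13,98,155,176); (0,17,146,167,184);
  (0,23,103,148,188); (0,25,90,131,180)], [::]);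
 (44, [:: (4, (44, 0, 11)); (5, (4, 11, 1)); (8, (2, 11, 1)); (4, (1, 11, 1))], [:: (4, 1, [:: 87;
  131; 175; 43; 179; 181; 184; 188; 195; 199; 197; 203; 201; 207; 204; 211; 209; 213; 214; 215;
  212])], [:: (0,1,29,151,175); (0,2,5,87,193); (0,4,10,36,105); (0,7,86,159,196);
  (0,9,58,137,203); (0,13,106,157,181); (0,14,67,161,177); (0,17,89,108,186); (0,21,78,145,210);
  (0,47,118,139,207); (0,50,122,140,214); (0,56,96,156,188)], [::]);
 (96, [:: (2, (96, 0, 12)); (3, (4, 12, 1))], [:: (2, 1, [:: 142; 46; 192; 196; 200])],
  [:: (0,1,68,182,187); (0,2,46,113,155); (0,3,17,25,76); (0,4,61,99,126); (0,6,47,171,199);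
  (0,7,63,137,150); (0,9,19,148,200); (0,11,43,81,184); (0,16,78,98,128); (0,21,157,188,193)],
  [::]);
 (192, [:: (1, (192, 0, 12)); (4, (12, 12, 1)); (1, (4, 12, 1))], [::], [:: (0,1,11,31,223);
  (0,2,58,176,227); (0,3,62,173,212); (0,4,147,152,232); (0,6,23,112,205); (0,7,101,122,240);
  (0,8,41,146,235); (0,9,34,73,195); (0,13,27,82,129); (0,15,53,124,193); (0,26,61,140,204);
  (0,28,95,127,203); (0,29,66,117,231); (0,42,92,149,226)], [::]);
 (104, [:: (2, (104, 0, 13)); (2, (2, 13, 1))], [:: (2, 1, [:: 117; 13; 211; 209])],
  [:: (0,1,68,164,207); (0,2,47,128,192); (0,3,18,134,205); (0,4,12,29,201); (0,5,152,171,198);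
  (0,6,44,54,76); (0,7,90,161,177); (0,9,62,108,138); (0,11,35,84,168); (0,23,118,159,209)], [::]);
 (208, [:: (1, (208, 0, 13)); (6, (4, 13, 1))], [::], [:: (0,1,83,102,171); (0,2,155,161,225);
  (0,3,60,111,175); (0,4,16,72,96); (0,5,15,178,228); (0,7,74,149,223); (0,8,131,145,162);
  (0,9,95,174,219); (0,11,40,84,187); (0,18,41,99,215); (0,20,110,158,186); (0,25,87,114,210)],
  [::]);
 (52, [:: (4, (52, 0, 13)); (6, (4, 13, 1)); (10, (2, 13, 1))], [:: (4, 1, [:: 192; 114; 23; 75;
  210; 213; 218; 221; 226; 229; 234; 233; 238; 237; 242; 241; 247; 245; 251; 249])],
  [:: (0,1,6,126,209); (0,2,19,29,225); (0,3,119,163,245); (0,4,85,106,138); (0,7,136,173,232);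
  (0,8,54,66,88); (0,9,99,141,215); (0,11,148,170,251); (0,14,82,175,216); (0,15,75,139,222);
  (0,16,79,127,151); (0,21,115,176,239); (0,53,108,181,240); (0,59,133,168,231)], [::]);
 (224, [:: (1, (224, 0, 14)); (9, (4, 14, 1))], [::], [:: (0,1,16,102,202); (0,2,19,161,242);
  (0,3,13,206,249); (0,4,153,173,217); (0,5,30,163,246); (0,6,43,117,231); (0,8,76,88,192);
  (0,9,92,164,188); (0,26,67,115,172); (0,27,62,121,255); (0,29,114,147,232); (0,34,87,177,225);
  (0,39,97,170,237); (0,46,95,145,256)], [::]);
 (120, [:: (2, (120, 0, 15)); (4, (2, 15, 1))], [:: (2, 1, [:: 206; 86; 242; 240; 246; 244])],
  [:: (0,1,134,167,240); (0,2,124,187,223); (0,3,110,132,186); (0,4,39,92,207); (0,5,29,48,100);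
  (0,6,22,80,149); (0,7,38,155,169); (0,8,42,111,152); (0,11,151,201,224); (0,12,56,158,184);
  (0,18,79,163,200); (0,27,126,181,244)], [::]);
 (240, [:: (1, (240, 0, 15)); (7, (4, 15, 1))], [::], [:: (0,1,52,68,145); (0,2,39,56,125);
  (0,3,116,140,149); (0,4,10,80,208); (0,5,126,139,262); (0,7,26,185,265); (0,8,65,174,217);
  (0,11,133,162,256); (0,12,40,84,104); (0,14,167,205,247); (0,18,59,161,241); (0,21,71,179,213);
  (0,22,85,215,255); (0,46,129,187,250)], [::]);
 (256, [:: (1, (256, 0, 16)); (5, (4, 16, 1))], [::], [:: (0,1,14,31,57); (0,2,21,131,265);
  (0,3,126,185,275); (0,4,124,168,173); (0,6,85,122,223); (0,7,25,72,170); (0,8,175,204,244);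
  (0,9,54,109,203); (0,10,76,151,228); (0,11,35,113,183); (0,15,106,174,220); (0,22,63,121,271);
  (0,23,50,189,257); (0,34,95,137,261)], [::]);
 (256, [:: (1, (256, 0, 16)); (10, (4, 16, 1))], [::], [:: (0,1,18,102,222); (0,2,22,108,184);
  (0,3,61,98,265); (0,4,111,156,200); (0,5,31,218,260); (0,6,77,159,272); (0,7,73,138,293);
  (0,8,67,207,231); (0,9,19,146,290); (0,11,47,135,188); (0,12,40,63,206); (0,13,91,242,283);
  (0,15,157,186,269); (0,21,147,202,285); (0,30,123,169,278); (0,39,81,122,257)], [::]);
 (136, [:: (2, (136, 0, 17)); (6, (2, 17, 1))], [:: (2, 1, [:: 260; 124; 274; 272; 278; 276; 282;
  280])], [:: (0,1,161,206,274); (0,2,56,95,183); (0,3,19,137,175); (0,4,25,30,201);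
  (0,6,83,226,257); (0,7,74,200,266); (0,8,94,104,122); (0,9,29,195,239); (0,11,46,124,179);
  (0,13,49,73,190); (0,15,159,258,281); (0,27,84,147,194); (0,33,81,173,245); (0,61,148,219,279)],
  [::]);
 (68, [:: (1, (68, 0, 4)); (1, (68, 4, 4)); (3, (4, 8, 1)); (1, (1, 8, 1))], [:: (2, 1, [:: 70; 2;
  138; 142; 146; 148])], [:: (0,1,75,120,133); (0,2,39,93,146); (0,3,38,108,127); (0,5,14,92,114);
  (0,6,17,103,139); (0,7,50,76,123); (0,15,42,121,143)], [:: (0,34,68,102,148)]);
 (68, [:: (1, (68, 0, 4)); (1, (68, 4, 4)); (8, (4, 8, 1)); (1, (1, 8, 1))], [:: (2, 1, [:: 69; 1;
  137; 145; 141; 153; 149; 157; 165; 161; 168])], [:: (0,1,81,99,162); (0,2,13,132,145);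
  (0,3,42,107,155); (0,5,84,101,115); (0,6,33,93,151); (0,7,53,77,143); (0,9,30,91,158);
  (0,10,83,126,166); (0,19,69,114,136)], [:: (0,34,68,102,168)]);
 (102, [:: (1, (102, 0, 6)); (1, (102, 6, 6)); (4, (2, 12, 1)); (1, (1, 12, 1))],
  [:: (2, 1, [:: 104; 2; 206; 204; 210; 208; 212])], [:: (0,1,129,168,211); (0,2,108,157,190);
  (0,3,76,130,185); (0,4,23,68,146); (0,5,27,92,137); (0,7,77,88,199); (0,8,58,173,189);
  (0,9,40,143,202); (0,13,41,105,161); (0,17,136,171,205)], [:: (0,51,102,153,212)]);
 (102, [:: (1, (102, 0, 6)); (1, (102, 6, 6)); (14, (2, 12, 1)); (1, (1, 12, 1))],
  [:: (2, 1, [:: 104; 2; 206; 204; 210; 208; 214; 212; 218; 216; 222; 220; 226; 224; 230; 228;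
  232])], [:: (0,1,142,191,229); (0,2,9,88,91); (0,4,38,114,170); (0,5,109,194,227);
  (0,8,65,146,156); (0,15,44,70,111); (0,19,145,186,222); (0,21,127,154,206); (0,22,50,119,181);
  (0,25,124,155,217); (0,33,103,162,213); (0,35,118,157,211)], [:: (0,51,102,153,232)]);
 (102, [:: (1, (102, 0, 6)); (1, (102, 6, 6)); (8, (6, 12, 1)); (1, (1, 12, 1))],
  [:: (2, 1, [:: 104; 2; 212; 206; 224; 218; 236; 230; 248; 242; 252])], [:: (0,1,8,93,250);
  (0,2,109,185,229); (0,3,25,174,227); (0,4,15,159,207); (0,5,73,110,219); (0,13,62,189,215);
  (0,14,46,126,142); (0,19,50,156,191); (0,20,57,190,243); (0,21,103,161,228); (0,23,114,177,216);
  (0,27,111,158,208); (0,28,69,188,242); (0,38,138,181,232)], [:: (0,51,102,153,252)]);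
 (68, [:: (1, (68, 0, 4)); (1, (68, 4, 4)); (1, (68, 8, 4)); (1, (68, 12, 4)); (2, (2, 16, 1));
  (1, (1, 16, 1))], [:: (4, 1, [:: 205; 1; 69; 137; 275; 273; 276])], [:: (0,1,59,82,186);
  (0,2,65,123,252); (0,6,49,181,237); (0,7,73,102,207); (0,11,68,221,273); (0,13,100,118,160);
  (0,14,47,196,227); (0,15,112,129,183); (0,22,178,201,208); (0,26,74,150,251); (0,27,94,164,260);
  (0,30,93,171,223); (0,31,69,152,263)], [:: (0,34,136,170,276); (68,102,204,238,276)]);
 (160, [:: (1, (160, 0, 8)); (2, (20, 8, 1))], [::], [:: (0,1,27,30,182); (0,2,60,121,142);
  (0,4,35,126,176); (0,5,49,150,167); (0,6,17,85,193); (0,7,105,117,160); (0,9,42,115,199);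
  (0,13,65,90,179); (0,14,36,107,185); (0,19,76,113,164); (0,23,86,132,186)], [::]);
 (60, [:: (1, (60, 0, 3)); (1, (60, 3, 3)); (1, (60, 6, 3)); (10, (4, 9, 1))], [:: (3, 1, [:: 175;
  55; 115; 183; 187; 191; 195; 199; 203; 207; 211; 215; 219])], [:: (0,1,63,110,199);
  (0,2,7,77,188); (0,4,64,80,172); (0,8,28,112,152); (0,10,89,155,182); (0,11,69,98,212);
  (0,14,71,173,207); (0,17,91,114,194); (0,19,105,146,211); (0,22,73,179,184); (0,25,103,150,218);
  (0,26,119,141,201)], [::]);
 (20, [:: (10, (20, 0, 10)); (9, (4, 10, 1))], [:: (10, 1, [:: 175; 185; 105; 135; 155; 75; 85; 5;
  35; 55; 201; 205; 209; 213; 217; 221; 225; 229; 233])], [:: (0,1,39,52,202); (0,2,47,145,156);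
  (0,3,35,129,191); (0,4,8,12,16); (0,5,133,198,217); (0,6,73,105,232); (0,7,103,186,212);
  (0,21,93,146,228); (0,22,81,153,220); (0,24,59,152,196); (0,26,97,171,211); (0,31,77,108,226);
  (0,34,149,183,205)], [:: (0,28,46,64,82); (100,128,146,164,182); (0,36,42,68,94);
  (100,136,142,168,194)]);
 (20, [:: (10, (20, 0, 10)); (7, (4, 10, 1)); (6, (2, 10, 1))], [:: (10, 1, [:: 181; 101; 121;
  141; 161; 81; 1; 21; 41; 61; 203; 207; 211; 215; 219; 223; 227; 231; 229; 235; 233; 239; 237])],
  [:: (0,1,179,186,230); (0,2,17,83,201); (0,4,88,116,122); (0,6,79,97,226); (0,7,58,195,216);
  (0,8,33,44,146); (0,9,75,164,213); (0,21,136,197,222); (0,22,57,189,204); (0,24,52,103,151);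
  (0,42,155,181,208); (0,43,126,191,236); (0,49,143,196,235)], [::]);
 (110, [:: (2, (110, 0, 11)); (20, (2, 11, 1))], [:: (2, 1, [:: 115; 5; 223; 221; 227; 225; 231;
  229; 235; 233; 239; 237; 243; 241; 247; 245; 251; 249; 255; 253; 259; 257])],
  [:: (0,1,135,214,256); (0,2,32,92,104); (0,3,19,149,211); (0,4,14,40,68); (0,5,156,183,237);
  (0,7,169,210,243); (0,9,24,76,199); (0,13,115,204,220); (0,17,153,188,255); (0,23,114,167,228);
  (0,25,166,205,226); (0,29,137,202,232); (0,37,124,185,249); (0,47,158,217,244)], [::]);
 (168, [:: (1, (168, 0, 8)); (2, (4, 8, 1)); (1, (1, 8, 1))], [::], [:: (0,1,54,71,175);
  (0,2,20,59,161); (0,3,31,82,116); (0,4,41,91,103); (0,5,11,26,170); (0,10,43,110,133);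
  (0,13,107,121,143); (0,19,49,95,124); (0,42,84,126,176)], [::]);
 (168, [:: (1, (168, 0, 8)); (1, (24, 8, 1)); (1, (4, 8, 1)); (1, (1, 8, 1))], [::],
  [:: (0,1,92,95,157); (0,2,59,142,174); (0,4,53,90,173); (0,5,51,118,195); (0,6,39,66,153);
  (0,7,25,38,189); (0,9,29,98,134); (0,10,110,133,170); (0,14,44,61,191); (0,19,71,146,185);
  (0,42,84,126,196)], [::]);
 (126, [:: (1, (126, 0, 6)); (1, (126, 6, 6)); (8, (2, 12, 1)); (1, (1, 12, 1))],
  [:: (2, 1, [:: 197; 71; 255; 253; 259; 257; 263; 261; 267; 265; 268])], [:: (0,1,74,77,219);
  (0,2,43,58,216); (0,4,95,134,198); (0,5,190,204,230); (0,7,151,208,262); (0,8,154,186,247);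
  (0,9,88,113,137); (0,10,129,166,221); (0,11,28,110,237); (0,19,39,136,182); (0,21,202,231,266);
  (0,23,195,240,256); (0,51,132,191,252)], [:: (0,63,126,189,268)]);
 (23, [:: (1, (23, 0, 1)); (1, (23, 1, 1)); (1, (23, 2, 1)); (1, (23, 3, 1)); (1, (23, 4, 1)); (1,
  (23, 5, 1)); (1, (23, 6, 1)); (1, (23, 7, 1)); (7, (1, 8, 1))], [:: (7, 1, [:: 24; 47; 70; 93;
  116; 139; 1; 162; 185; 186; 187; 188; 189; 190; 184])], [:: (0,23,54,104,156);
  (0,24,77,148,171); (0,25,58,121,189); (0,26,65,69,125); (0,29,76,93,175); (0,30,74,152,172);
  (0,34,79,100,146); (0,35,73,166,186); (0,37,57,143,164); (0,42,114,139,179)], [::]);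
 (36, [:: (4, (36, 0, 6)); (10, (2, 6, 1))], [:: (2, 1, [:: 71; 35; 143; 107; 144; 146; 148; 150;
  152; 154; 156; 158; 160; 162]); (2, 1, [:: 124; 88; 52; 16; 147; 145; 151; 149; 155; 153; 159;
  157; 163; 161])], [:: (0,1,52,68,137); (0,2,28,61,65); (0,3,14,106,125); (0,5,91,98,161);
  (0,9,113,128,149); (0,13,76,134,144); (0,17,97,123,159); (0,38,73,117,155)], [::]);
 (42, [:: (4, (42, 0, 7)); (4, (2, 7, 1))], [:: (2, 1, [:: 127; 85; 43; 1; 171; 169; 175; 173]);
  (2, 1, [:: 47; 5; 131; 89; 171; 169; 175; 173])], [:: (0,1,89,149,157); (0,2,5,111,136);
  (0,4,54,78,94); (0,6,31,103,123); (0,9,46,129,174); (0,10,23,43,153); (0,12,57,73,139);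
  (0,15,44,159,170)], [::]);
 (42, [:: (4, (42, 0, 7)); (14, (2, 7, 1))], [:: (2, 1, [:: 127; 85; 43; 1; 171; 169; 175; 173;
  179; 177; 183; 181; 187; 185; 191; 189; 195; 193]); (2, 1, [:: 47; 5; 131; 89; 171; 169; 175;
  173; 179; 177; 183; 181; 187; 185; 191; 189; 195; 193])], [:: (0,1,45,128,194); (0,2,38,60,90);
  (0,3,72,137,171); (0,5,17,27,123); (0,8,26,51,108); (0,9,55,164,190); (0,11,47,142,186);
  (0,13,129,148,180); (0,50,111,143,179); (0,53,89,150,173)], [::]);
 (96, [:: (2, (96, 0, 8)); (4, (4, 8, 1))], [:: (2, 1, [:: 142; 46; 194; 198; 202; 206])],
  [:: (0,1,14,116,138); (0,2,62,149,156); (0,3,129,146,203); (0,4,46,65,85); (0,5,33,108,166);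
  (0,6,29,107,193); (0,9,52,109,119); (0,12,37,78,177); (0,21,47,118,204); (0,27,106,157,196)],
  [::]);
 (192, [:: (1, (192, 0, 8)); (1, (32, 8, 1)); (1, (4, 8, 1))], [::], [:: (0,1,68,179,216);
  (0,2,41,101,175); (0,3,116,150,222); (0,4,27,127,133); (0,5,12,90,204); (0,9,46,135,205);
  (0,10,43,97,225); (0,11,29,49,84); (0,15,109,145,194); (0,21,52,82,206); (0,22,50,75,193);
  (0,26,77,148,221)], [::]);
 (108, [:: (2, (108, 0, 9)); (2, (2, 9, 1))], [:: (2, 1, [:: 173; 65; 219; 217])],
  [:: (0,1,7,51,67); (0,2,31,134,142); (0,3,59,130,152); (0,4,124,147,167); (0,5,141,174,217);
  (0,10,83,131,170); (0,11,87,118,202); (0,12,94,137,208); (0,13,53,91,159); (0,15,61,89,119)],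
  [::]);
 (54, [:: (4, (54, 0, 9)); (22, (2, 9, 1))], [:: (2, 1, [:: 202; 148; 94; 40; 219; 217; 223; 221;
  224; 226; 231; 229; 232; 234; 236; 238; 243; 241; 244; 246; 251; 249; 252; 254; 256; 258]);
  (2, 1, [:: 55; 1; 163; 109; 216; 218; 220; 222; 227; 225; 228; 230; 235; 233; 239; 237; 240;
  242; 247; 245; 248; 250; 255; 253; 259; 257])], [:: (0,1,79,158,237); (0,2,46,170,174);
  (0,3,132,202,228); (0,5,29,120,136); (0,6,20,32,75); (0,7,195,212,242); (0,11,96,127,224);
  (0,13,71,86,244); (0,19,142,194,222); (0,21,101,140,232); (0,23,57,160,254); (0,59,148,215,256);
  (0,60,121,165,216); (0,62,146,214,250)], [::]);
 (120, [:: (2, (120, 0, 10)); (2, (2, 10, 1))], [:: (2, 1, [:: 206; 86; 242; 240])],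
  [:: (0,1,54,215,222); (0,2,64,86,193); (0,3,76,157,232); (0,4,19,42,111); (0,5,21,179,238);
  (0,6,35,109,171); (0,8,102,155,236); (0,12,43,164,219); (0,14,63,137,225); (0,24,48,72,96);
  (0,25,197,234,242); (0,27,79,142,175)], [::]);
 (240, [:: (1, (240, 0, 10)); (3, (4, 10, 1))], [::], [:: (0,1,9,67,228); (0,2,59,113,249);
  (0,3,37,151,162); (0,4,112,156,221); (0,5,106,122,154); (0,6,143,169,184); (0,7,25,52,76);
  (0,14,99,193,247); (0,17,46,121,204); (0,22,124,167,198); (0,28,63,96,135); (0,38,93,191,240)],
  [::]);
 (240, [:: (1, (240, 0, 10)); (8, (4, 10, 1))], [::], [:: (0,1,92,173,216); (0,2,56,64,168);
  (0,3,146,205,251); (0,4,77,196,212); (0,5,23,57,106); (0,6,37,175,247); (0,7,165,226,264);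
  (0,9,154,223,242); (0,11,58,137,256); (0,12,88,127,211); (0,13,66,111,254); (0,15,42,93,269);
  (0,19,55,118,151); (0,22,107,153,261)], [::]);
 (132, [:: (2, (132, 0, 11)); (10, (2, 11, 1))], [:: (2, 1, [:: 168; 36; 266; 264; 270; 268; 274;
  272; 278; 276; 282; 280])], [:: (0,1,158,227,265); (0,2,61,64,197); (0,4,53,93,256);
  (0,5,171,178,194); (0,6,52,82,100); (0,8,20,98,248); (0,9,181,200,281); (0,10,24,115,135);
  (0,13,58,155,262); (0,15,161,190,276); (0,21,81,162,258); (0,26,101,186,214);
  (0,35,184,251,268); (0,37,137,222,274)], [::]);
 (200, [:: (1, (200, 0, 8)); (1, (4, 8, 1)); (1, (1, 8, 1))], [::], [:: (0,1,42,45,60);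
  (0,2,89,117,163); (0,4,53,67,86); (0,5,70,180,193); (0,6,79,148,171); (0,9,31,107,134);
  (0,10,36,57,91); (0,11,62,105,200); (0,17,78,116,146); (0,50,100,150,204)], [::]);
 (40, [:: (5, (40, 0, 8)); (1, (40, 8, 1)); (1, (4, 8, 1)); (1, (1, 8, 1))], [:: (5, 1, [:: 133;
  173; 13; 53; 93; 213; 241; 244])], [:: (0,1,51,188,239); (0,2,89,157,218); (0,3,109,138,223);
  (0,4,63,77,226); (0,5,60,161,232); (0,6,19,129,243); (0,7,114,193,200); (0,9,67,125,166);
  (0,10,20,30,244); (0,11,81,175,225); (0,12,42,174,191); (0,15,93,169,217); (0,18,100,145,215);
  (0,57,92,154,213)], [::]);
 (168, [:: (1, (168, 0, 6)); (1, (8, 6, 1)); (3, (4, 6, 1))], [::], [:: (0,1,111,166,184);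
  (0,4,20,51,151); (0,5,94,159,183); (0,7,40,116,141); (0,8,23,105,127); (0,10,87,140,168);
  (0,11,46,129,177); (0,13,56,75,136); (0,26,70,99,173)], [::]);
 (84, [:: (2, (84, 0, 6)); (2, (12, 6, 1)); (4, (4, 6, 1))], [:: (2, 1, [:: 131; 47; 179; 191;
  193; 203; 199; 205])], [:: (0,1,71,135,176); (0,2,10,37,99); (0,3,55,98,169); (0,4,68,85,186);
  (0,5,26,141,189); (0,7,46,159,194); (0,9,133,158,197); (0,11,88,121,198); (0,15,34,56,191);
  (0,17,129,160,204); (0,23,86,130,170)], [::]);
 (196, [:: (1, (196, 0, 7)); (4, (4, 7, 1))], [::], [:: (0,1,20,131,144); (0,2,26,69,171);
  (0,3,58,117,211); (0,4,9,96,160); (0,6,37,47,197); (0,8,68,83,116); (0,11,29,110,206);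
  (0,12,50,73,107); (0,16,90,134,166); (0,17,71,174,201)], [::]);
 (7, [:: (28, (7, 0, 7)); (3, (7, 7, 1)); (15, (1, 7, 1))], [:: (7, 1, [:: 44; 2; 9; 16; 23; 30;
  37; 93; 51; 58; 65; 72; 79; 86; 142; 100; 107; 114; 121; 128; 135; 191; 149; 156; 163; 170; 177;
  184; 197; 204; 211; 217; 218; 219; 220; 221; 222; 223; 224; 225; 226; 227; 228; 229; 230;
  231])], [:: (0,1,139,173,185); (0,2,36,75,208); (0,3,180,191,207); (0,8,18,167,201);
  (0,9,26,106,216); (0,11,89,100,210); (0,12,74,92,150); (0,13,103,129,162); (0,16,115,134,197);
  (0,19,58,160,164); (0,22,54,67,211); (0,23,57,181,203); (0,24,83,135,141); (0,25,66,86,113);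
  (0,27,121,157,198); (0,50,131,170,225); (0,51,143,169,217); (0,52,114,183,226);
  (0,53,55,61,128); (0,60,142,192,223); (0,62,107,148,230); (0,64,130,178,229);
  (0,65,137,174,218); (0,71,116,187,228); (0,72,108,166,221); (0,76,127,179,224);
  (0,79,132,151,227); (0,80,109,188,222); (0,82,102,155,219); (0,85,153,163,171);
  (0,93,117,193,231); (0,96,111,176,220); (0,110,120,122,165); (49,50,82,137,197);
  (49,52,68,109,153); (49,58,88,162,201); (49,59,64,110,206); (49,60,71,139,215);
  (49,99,164,180,186); (49,104,135,145,205); (49,120,124,142,171); (49,148,194,195,200);
  (49,152,172,177,216); (49,167,190,193,204); (98,99,110,167,203); (98,107,139,171,213);
  (98,114,127,194,201); (98,157,159,172,212)], [::]);
 (224, [:: (1, (224, 0, 8)); (3, (4, 8, 1))], [::], [:: (0,1,7,132,150); (0,2,103,173,234);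
  (0,3,47,58,97); (0,4,89,199,211); (0,5,33,67,76); (0,10,59,78,119); (0,14,52,83,98);
  (0,20,86,107,202); (0,23,113,170,224); (0,26,61,91,230); (0,27,63,100,145)], [::]);
 (112, [:: (2, (112, 0, 8)); (3, (4, 8, 1)); (10, (2, 8, 1))], [:: (2, 1, [:: 172; 60; 224; 228;
  232; 238; 236; 242; 240; 246; 244; 250; 248; 254; 252])], [:: (0,1,125,139,150);
  (0,2,73,143,230); (0,3,7,33,77); (0,5,183,204,242); (0,6,151,173,224); (0,9,45,92,210);
  (0,10,28,62,217); (0,12,58,75,206); (0,13,179,222,235); (0,15,116,177,254); (0,19,121,180,238);
  (0,23,134,219,250); (0,31,164,221,245)], [::]);
 (56, [:: (2, (56, 0, 4)); (2, (56, 4, 4)); (5, (4, 8, 1)); (16, (2, 8, 1))], [:: (4, 1, [:: 179;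
  123; 11; 67; 225; 229; 233; 237; 241; 246; 245; 251; 249; 254; 253; 258; 257; 262; 261; 266;
  265; 271; 269; 274; 273])], [:: (0,1,120,214,258); (0,2,79,203,230); (0,3,25,110,239);
  (0,5,151,198,270); (0,6,99,192,206); (0,7,172,189,254); (0,9,134,167,262); (0,10,37,137,241);
  (0,11,128,194,272); (0,13,139,181,246); (0,15,129,179,266); (0,18,81,177,226);
  (0,21,111,113,195); (0,26,71,175,235); (0,59,118,191,251)], [::]);
 (126, [:: (2, (126, 0, 9)); (4, (2, 9, 1))], [:: (2, 1, [:: 244; 118; 254; 252; 258; 256])],
  [:: (0,1,38,41,60); (0,2,70,172,204); (0,4,61,75,240); (0,5,48,214,229); (0,6,30,82,152);
  (0,7,17,46,194); (0,8,100,159,223); (0,11,147,250,258); (0,12,137,168,247); (0,13,133,158,186);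
  (0,20,161,203,238); (0,21,188,221,253)], [::]);
 (126, [:: (2, (126, 0, 9)); (24, (2, 9, 1))], [:: (2, 1, [:: 244; 118; 254; 252; 258; 256; 262;
  260; 266; 264; 270; 268; 274; 272; 278; 276; 282; 280; 286; 284; 290; 288; 294; 292; 298;
  296])], [:: (0,1,33,35,59); (0,3,187,230,281); (0,4,20,86,226); (0,5,217,224,270);
  (0,6,70,118,215); (0,10,22,52,98); (0,11,132,221,272); (0,13,213,242,289); (0,15,182,235,293);
  (0,17,142,203,264); (0,19,137,160,259); (0,21,202,249,252); (0,25,208,239,276);
  (0,39,185,240,296); (0,41,188,245,262); (0,49,128,179,284)], [::]);
 (140, [:: (2, (140, 0, 10)); (1, (4, 10, 1))], [:: (2, 1, [:: 216; 76; 280])],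
  [:: (0,1,6,127,235); (0,2,66,83,144); (0,3,105,178,281); (0,4,12,118,145); (0,7,31,168,239);
  (0,9,46,98,225); (0,11,56,72,163); (0,15,112,171,258); (0,18,65,119,223); (0,23,115,192,269);
  (0,27,148,184,233); (0,29,62,211,255); (0,32,99,196,254)], [::]);
 (140, [:: (2, (140, 0, 10)); (6, (4, 10, 1))], [:: (2, 1, [:: 216; 76; 282; 286; 290; 294; 298;
  302])], [:: (0,1,14,157,295); (0,2,26,195,258); (0,3,179,252,299); (0,4,32,47,115);
  (0,5,74,123,259); (0,6,92,128,214); (0,7,106,203,303); (0,8,31,163,182); (0,9,61,154,213);
  (0,11,64,229,245); (0,21,58,96,199); (0,27,105,236,287); (0,33,89,146,231); (0,39,147,192,291);
  (0,42,201,247,283)], [::]);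
 (232, [:: (1, (232, 0, 8)); (1, (1, 8, 1))], [::], [:: (0,1,20,85,127); (0,2,131,134,143);
  (0,4,39,122,185); (0,5,43,60,222); (0,6,13,27,81); (0,11,36,135,202); (0,18,52,173,206);
  (0,22,109,137,183); (0,23,73,102,163); (0,31,76,113,170); (0,58,116,174,232)], [::]);
 (116, [:: (1, (116, 0, 4)); (1, (116, 4, 4)); (5, (4, 8, 1)); (1, (1, 8, 1))],
  [:: (2, 1, [:: 133; 17; 235; 239; 243; 247; 251; 252])], [:: (0,1,173,208,235);
  (0,2,155,229,250); (0,3,120,181,202); (0,5,19,150,201); (0,6,73,162,224); (0,7,25,129,139);
  (0,9,46,87,244); (0,11,200,215,241); (0,13,63,190,223); (0,17,123,154,180); (0,22,93,164,191);
  (0,30,77,213,239)], [:: (0,58,116,174,252)]);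
 (24, [:: (8, (24, 0, 6)); (10, (2, 6, 1))], [:: (2, 1, [:: 125; 101; 173; 149; 29; 5; 77; 53;
  195; 193; 199; 197; 203; 201; 207; 205; 211; 209]); (2, 1, [:: 27; 3; 75; 51; 123; 99; 171; 147;
  193; 195; 197; 199; 201; 203; 205; 207; 209; 211]); (2, 1, [:: 170; 146; 122; 98; 74; 50; 26; 2;
  195; 193; 199; 197; 203; 201; 207; 205; 211; 209])], [:: (0,1,123,161,198); (0,2,111,149,172);
  (0,3,97,124,209); (0,4,32,51,133); (0,5,55,94,159); (0,7,16,38,59); (0,10,73,116,155);
  (0,11,139,171,202); (0,29,164,175,194); (0,76,99,179,204)], [::]);
 (96, [:: (2, (96, 0, 6)); (6, (6, 6, 1)); (2, (2, 6, 1))], [:: (2, 1, [:: 182; 86; 200; 194; 212;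
  206; 224; 218; 230; 228])], [:: (0,1,62,172,193); (0,2,111,124,198); (0,3,115,188,228);
  (0,4,21,161,209); (0,5,85,135,225); (0,7,27,64,170); (0,8,49,107,223); (0,9,31,104,160);
  (0,10,43,68,221); (0,14,105,155,213); (0,15,67,136,200); (0,19,45,98,215)], [::]);
 (112, [:: (2, (112, 0, 7)); (1, (4, 7, 1))], [:: (2, 1, [:: 159; 47; 227])],
  [:: (0,1,86,195,200); (0,2,55,94,134); (0,3,13,78,226); (0,4,76,176,187); (0,6,66,128,144);
  (0,8,87,131,181); (0,9,24,54,127); (0,12,44,95,169); (0,19,139,177,220); (0,22,129,170,193)],
  [::]);
 (224, [:: (1, (224, 0, 7)); (6, (4, 7, 1))], [::], [:: (0,1,66,153,201); (0,2,47,197,244);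
  (0,3,58,125,233); (0,4,111,136,155); (0,5,43,170,240); (0,6,15,32,110); (0,8,108,142,193);
  (0,10,46,174,194); (0,11,33,86,227); (0,12,64,80,121); (0,13,94,131,231); (0,18,79,141,236)],
  [::]);
 (28, [:: (8, (28, 0, 7)); (4, (4, 7, 1)); (14, (2, 7, 1))], [:: (4, 1, [:: 211; 183; 141; 113;
  50; 22; 106; 78; 228; 226; 238; 234; 247; 245; 240; 242; 250; 248; 254; 252; 262; 260; 258; 256;
  266; 264]); (2, 1, [:: 37; 9; 93; 65; 149; 121; 205; 177; 225; 229; 233; 237; 241; 243; 245;
  247; 249; 251; 253; 255; 259; 257; 263; 261; 265; 267])], [:: (0,1,130,170,248);
  (0,2,33,200,230); (0,3,117,193,259); (0,4,47,83,99); (0,5,106,153,241); (0,6,18,36,213);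
  (0,8,61,93,143); (0,9,160,199,237); (0,11,138,192,261); (0,13,135,201,254); (0,29,69,215,245);
  (0,34,100,123,224); (0,39,155,219,264); (0,102,113,220,239)], [::]);
 (128, [:: (2, (128, 0, 8)); (4, (2, 8, 1))], [:: (2, 1, [:: 207; 79; 259; 257; 263; 261])],
  [:: (0,1,60,189,246); (0,2,150,159,203); (0,3,54,212,253); (0,4,50,65,174); (0,5,145,228,263);
  (0,6,36,58,249); (0,7,28,38,117); (0,12,115,149,166); (0,14,95,187,221); (0,19,85,105,238);
  (0,26,99,204,241); (0,27,182,217,257)], [::]);
 (128, [:: (2, (128, 0, 8)); (14, (2, 8, 1))], [:: (2, 1, [:: 182; 54; 258; 256; 262; 260; 266;
  264; 270; 268; 274; 272; 278; 276; 282; 280])], [:: (0,1,82,107,134); (0,2,14,52,55);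
  (0,4,27,230,247); (0,5,194,239,274); (0,6,74,92,199); (0,7,182,245,268); (0,9,66,94,237);
  (0,10,30,183,252); (0,11,188,225,279); (0,13,39,97,174); (0,15,166,227,258); (0,19,148,197,283);
  (0,29,167,244,266); (0,33,163,198,263)], [::]);
 (36, [:: (8, (36, 0, 9)); (6, (2, 9, 1))], [:: (2, 1, [:: 85; 121; 13; 49; 229; 265; 157; 193;
  289; 291; 293; 295; 297; 299]); (2, 1, [:: 189; 153; 261; 225; 45; 9; 117; 81; 290; 288; 294;
  292; 298; 296]); (2, 1, [:: 39; 3; 111; 75; 183; 147; 255; 219; 288; 290; 292; 294; 296; 298])],
  [:: (0,1,213,269,277); (0,2,71,169,219); (0,3,60,241,245); (0,5,74,141,197); (0,6,29,118,130);
  (0,10,42,56,133); (0,11,156,221,288); (0,15,49,149,196); (0,16,82,166,275); (0,17,138,176,195);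
  (0,43,139,194,255); (0,44,104,163,250); (0,50,164,274,292); (0,73,211,260,296)], [::]);
 (24, [:: (9, (24, 0, 6)); (2, (8, 6, 1)); (1, (4, 6, 1))], [:: (3, 1, [:: 142; 76; 118; 214; 148;
  190; 70; 4; 46; 216; 224; 232]); (3, 1, [:: 206; 164; 182; 62; 20; 38; 134; 92; 110; 216; 224;
  232])], [:: (0,1,70,101,146); (0,2,139,184,228); (0,3,32,166,225); (0,4,79,89,217);
  (0,5,115,134,214); (0,7,41,154,235); (0,8,46,55,167); (0,9,40,92,107); (0,11,130,181,212);
  (0,26,131,153,220); (0,28,57,121,164)], [::]);
 (12, [:: (18, (12, 0, 6)); (3, (12, 6, 1)); (2, (2, 6, 1))], [:: (6, 1, [:: 151; 163; 175; 187;
  199; 211; 115; 127; 139; 43; 55; 67; 79; 91; 103; 7; 19; 31; 235; 247; 223; 255; 253]);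
  (3, 1, [:: 54; 60; 36; 90; 96; 72; 18; 24; 0; 162; 168; 144; 198; 204; 180; 126; 132; 108; 234;
  246; 222; 252; 254])], [:: (0,1,23,170,223); (0,2,58,119,243); (0,3,53,61,219);
  (0,4,29,151,217); (0,5,52,140,236); (0,15,110,203,232); (0,16,81,145,239); (0,19,51,116,154);
  (0,20,45,94,161); (0,21,88,173,249); (0,37,77,141,228); (0,47,134,157,190); (0,57,143,160,255)],
  [::]);
 (126, [:: (2, (126, 0, 7)); (2, (6, 7, 1))], [:: (2, 1, [:: 238; 112; 262; 256])],
  [:: (0,1,67,83,164); (0,2,152,174,239); (0,3,8,41,200); (0,4,78,103,188); (0,6,128,208,218);
  (0,9,162,243,257); (0,11,40,58,113); (0,12,76,148,185); (0,15,129,146,258); (0,19,51,220,246);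
  (0,20,54,127,157); (0,31,165,222,253)], [::]);
 (126, [:: (2, (126, 0, 7)); (16, (2, 7, 1))], [:: (2, 1, [:: 238; 112; 254; 252; 258; 256; 262;
  260; 266; 264; 270; 268; 274; 272; 278; 276; 282; 280])], [:: (0,1,132,201,264);
  (0,2,48,74,211); (0,3,159,184,272); (0,4,71,108,118); (0,5,11,43,191); (0,9,144,225,280);
  (0,13,129,158,262); (0,15,139,170,258); (0,16,36,76,248); (0,17,75,99,202); (0,19,157,218,252);
  (0,23,188,227,271); (0,30,92,171,244); (0,33,142,183,278)], [::]);
 (288, [:: (1, (288, 0, 8)); (6, (4, 8, 1))], [::], [:: (0,1,11,92,205); (0,2,127,169,306);
  (0,3,57,76,103); (0,4,118,155,271); (0,5,131,238,310); (0,6,75,265,301); (0,7,117,210,294);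
  (0,9,61,106,124); (0,12,82,211,262); (0,13,33,47,179); (0,15,68,154,198); (0,22,165,223,298);
  (0,25,66,214,253); (0,28,71,221,257); (0,30,79,141,291)], [::]);
 (30, [:: (4, (30, 0, 3)); (4, (30, 3, 3)); (10, (2, 6, 1))], [:: (4, 1, [:: 166; 136; 226; 196;
  106; 76; 46; 16; 242; 240; 246; 244; 250; 248; 254; 252; 258; 256]); (2, 1, [:: 45; 15; 105; 75;
  165; 135; 225; 195; 243; 241; 247; 245; 251; 249; 255; 253; 259; 257])], [:: (0,1,139,141,197);
  (0,4,41,120,187); (0,5,168,175,253); (0,8,52,208,237); (0,10,119,128,142); (0,11,118,167,245);
  (0,13,95,218,257); (0,32,203,213,248); (0,34,116,160,206); (0,35,100,137,186);
  (0,43,80,135,209); (0,61,166,239,242)], [::]);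
 (132, [:: (2, (132, 0, 6)); (5, (4, 6, 1))], [:: (2, 1, [:: 168; 36; 268; 264; 274; 278; 282])],
  [:: (0,1,8,137,178); (0,2,159,169,283); (0,3,16,20,121); (0,5,63,208,275); (0,9,61,152,250);
  (0,15,53,88,211); (0,19,75,100,149); (0,21,49,89,182); (0,22,45,205,242); (0,26,179,256,266);
  (0,29,99,142,224); (0,39,187,233,268); (0,47,147,212,276)], [::]);
 (132, [:: (2, (132, 0, 6)); (1, (12, 6, 1)); (4, (6, 6, 1)); (1, (4, 6, 1))], [:: (2, 1, [:: 235;
  103; 271; 283; 277; 295; 289; 303])], [:: (0,1,77,141,160); (0,2,121,155,301);
  (0,3,205,227,279); (0,4,31,183,274); (0,5,117,170,223); (0,7,88,116,264); (0,8,157,209,291);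
  (0,9,49,70,197); (0,10,139,245,288); (0,14,43,100,263); (0,17,85,207,266); (0,25,63,98,143);
  (0,33,91,262,281); (0,37,87,251,282); (0,39,193,260,294)], [::]);
 (154, [:: (2, (154, 0, 7)); (4, (2, 7, 1))], [:: (2, 1, [:: 168; 14; 310; 308; 314; 312])],
  [:: (0,1,26,305,307); (0,3,53,141,233); (0,4,19,78,219); (0,5,23,108,277); (0,6,87,116,261);
  (0,8,17,62,268); (0,10,124,205,284); (0,11,187,248,314); (0,12,64,276,303); (0,20,57,192,298);
  (0,22,82,213,244); (0,24,58,113,228); (0,32,71,118,297); (0,33,199,242,311)], [::]);
 (72, [:: (4, (72, 0, 6)); (10, (2, 6, 1))], [:: (2, 1, [:: 124; 52; 268; 196; 290; 288; 294; 292;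
  298; 296; 302; 300; 306; 304]); (2, 1, [:: 151; 223; 7; 79; 290; 288; 294; 292; 298; 296; 302;
  300; 306; 304])], [:: (0,1,89,280,284); (0,2,55,153,269); (0,3,110,143,293); (0,5,27,154,278);
  (0,7,47,74,105); (0,8,21,193,257); (0,9,58,121,263); (0,10,93,223,275); (0,11,57,166,200);
  (0,16,212,259,287); (0,29,91,213,304); (0,35,122,208,303); (0,79,197,256,290);
  (0,101,157,260,296)], [::]);
 (15, [:: (1, (15, 0, 15)); (3, (15, 16, 5)); (1, (1, 15, 1))], [:: (2, 4, [:: 8; 17; 47; 32;
  60])], [:: (0,2,15,47,54); (0,18,55,56,59); (15,33,42,46,59)], [:: (0,1,12,41,50);
  (0,5,17,33,51); (0,6,20,42,48); (0,19,23,25,26); (0,22,31,58,60)]);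
 (15, [:: (1, (15, 0, 15)); (1, (15, 15, 15)); (1, (15, 30, 15)); (1, (15, 46, 3)); (1, (1, 45,
  1))], [:: (2, 11, [:: 4; 39; 24; 49; 60])], [:: (0,16,21,39,46); (0,17,30,36,43);
  (0,18,19,22,50); (0,23,32,52,59)], [:: (0,1,5,13,58); (0,6,15,35,54); (0,25,40,51,60);
  (15,40,48,49,53)]);
 (10, [:: (2, (10, 0, 5)); (4, (10, 5, 5))], [:: (2, 1, [:: 18; 8; 38; 28; 58; 48])],
  [:: (0,1,13,20,26); (0,2,40,51,58); (0,3,19,42,46); (0,4,21,32,39); (0,22,24,41,55);
  (0,23,36,44,45); (0,28,34,50,52); (0,30,31,47,54)], [::])]%num.

(** * Evaluation of the test for all listed types *)

(** One evaluation settles all types: [all2] pairs each type with the design in the same position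
    and also compares the lengths of the two lists. Only lists and numbers are evaluated; finite
    types and sets occur solely in [check_gdd_exists], which interprets the result. *)
Lemma designs_realize : all2 realizes listed_types designs.
Proof. by vm_compute. Qed.

Lemma all2_exists (S : eqType) (T : Type) (r : S -> T -> bool) (s : seq S) (s' : seq T) (x : S) :
  all2 r s s' -> x \in s -> exists y, r x y.
Proof.
elim: s s' => // a s IH [//|b s'] /= /andP[rab rs]; rewrite inE => /predU1P[->|]; first by exists b.
exact: IH rs.
Qed.

Theorem theorem1p1 (t : gdd_type) (ht : t \in listed_types) : gdd_exists 5 t.
Proof. by have [[[[[n runs] auts] bs] bs'] /check_gdd_exists] := all2_exists designs_realize ht. Qed.
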